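(* Let $d\geq 2$, let $K_1$ and $K_2$ be two strictly convex and compact subsets of $\mathbb{R}^d$ with smooth boundary, and fix a choice of orientation (outgoing or ingoing normal) for each of them. Let $$\mathsf{T}_{K_1,K_2}=\sum_{\gamma\in\mathcal{P}_{K_1,K_2},\ \ell(\gamma)>T_0}\delta_{\ell(\gamma)}\in\mathcal{S}'(\mathbb{R}),$$ and let $\widehat{\mathsf{T}}_{K_1,K_2}(\tau)=\sum_{\gamma\in\mathcal{P}_{K_1,K_2},\ \ell(\gamma)>T_0}e^{-i\tau\ell(\gamma)}\in\mathcal{S}'(\mathbb{R})$ be its Fourier transform. Then the singular support of $\widehat{\mathsf{T}}_{K_1,K_2}$ satisfies $$\operatorname{Sing\,supp}\,\widehat{\mathsf{T}}_{K_1,K_2}\subset \operatorname{Sp}\left(-\sqrt{-\Delta}\right)\cup\operatorname{Sp}\left(\sqrt{-\Delta}\right),$$ where $\Delta=\sum_{j=1}^d\partial_{x_j}^2$ is the flat Laplace operator on $\mathbb{T}^d=\mathbb{R}^d/2\pi\mathbb{Z}^d$ and $\operatorname{Sp}$ denotes the spectrum.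
   Context: Strictly convex compact set with smooth boundary: a subset $K\subset\mathbb{R}^d$ which is either a single point or a compact convex set with nonempty interior whose boundary $\partial K$ is smooth and has all its sectional curvatures positive (equivalently, the second fundamental form of $\partial K$ with respect to the inward normal is positive definite; for $d=2$ this means that the boundary curve has positive curvature). Torus: $\mathbb{T}^d=\mathbb{R}^d/2\pi\mathbb{Z}^d$ carries the flat metric, $\mathfrak{p}:\mathbb{R}^d\to\mathbb{T}^d$ is the canonical projection, and $S\mathbb{T}^d=\mathbb{T}^d\times\mathbb{S}^{d-1}$. Orientations and normal bundles: for each $i\in\{1,2\}$, an orientation is fixed on $\partial K_i$ by choosing either the outgoing or the ingoing unit normal vector to $K_i$. Let $N(K_i)\subset S\mathbb{T}^d$ be the set of all $(\mathfrak{p}(x),\theta)$ with $x\in\partial K_i$ and $\theta\in\mathbb{S}^{d-1}$ the chosen (outgoing or ingoing) unit normal to $\partial K_i$ at $x$. If $K_i=\{x_i\}$ is a point, then $N(K_i)=\{\mathfrak{p}(x_i)\}\times\mathbb{S}^{d-1}$. Orthogeodesics: $\mathcal{P}_{K_1,K_2}$ is the set of unit speed geodesic curves $\gamma:[0,\ell]\to\mathbb{T}^d$, with $\ell=\ell(\gamma)>0$ the length of $\gamma$, that are directly orthogonal to $K_1$ and $K_2$, i.e. $(\gamma(0),\gamma'(0))\in N(K_1)$ and $(\gamma(\ell),\gamma'(\ell))\in N(K_2)$. Unit speed geodesics are the curves $t\mapsto x+t\theta$ with $(x,\theta)\in S\mathbb{T}^d$. Truncation: $T_0>0$ is a fixed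 number such that $\{\gamma\in\mathcal{P}_{K_1,K_2}:T_0<\ell(\gamma)\leq T\}$ is finite for every $T>T_0$ (such a $T_0$ exists, and the number of elements of this set is $\mathcal{O}(T^d)$ as $T\to+\infty$, so the series above converge in $\mathcal{S}'(\mathbb{R})$). Conventions: the Fourier transform is $\hat f(\xi)=\int_{\mathbb{R}}e^{-ix\xi}f(x)\,dx$, extended to $\mathcal{S}'(\mathbb{R})$. The singular support of a distribution is the complement of the largest open set on which it is $C^\infty$. One has $\operatorname{Sp}(\pm\sqrt{-\Delta})=\{\pm|\xi|:\xi\in\mathbb{Z}^d\}$. *)

(* Defs.v *)
From HB Require Import structures.
From mathcomp Require Import all_boot all_order all_algebra.
From mathcomp Require Import generic_quotient.
From mathcomp Require Import all_classical all_reals all_analysis.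
From mathcomp Require Import complex.

Set Implicit Arguments.
Unset Strict Implicit.
Unset Printing Implicit Defensive.

Import Order.TTheory GRing.Theory Num.Theory.
Import numFieldNormedType.Exports.

Local Open Scope classical_set_scope.
Local Open Scope ring_scope.
Local Open Scope complex_scope.
Local Open Scope quotient_scope.

Section EuclideanSpace.
Context {R : realType} {d : nat}.
Implicit Types (u v w x y : 'rV[R]_d) (f rho : 'rV[R]_d -> R).
Implicit Types (K U : set 'rV[R]_d).

Definition dotv u v : R := \sum_(i < d) u 0 i * v 0 i.

(* The norm that the library puts on matrices is the sup norm. *)
Definition enorm v : R := Num.sqrt (dotv v v).

Definition partial (i : 'I_d) f : 'rV[R]_d -> R :=
  fun x => 'D_(delta_mx 0 i) f x.

Definition iter_partial (s : seq 'I_d) f : 'rV[R]_d -> R := foldr partial f s.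

Definition smooth_on U f : Prop :=
  forall (s : seq 'I_d) x, U x ->
    {for x, continuous (iter_partial s f)} /\
    forall i : 'I_d, derivable (iter_partial s f) x (delta_mx 0 i).

Definition grad f x : 'rV[R]_d := \row_i partial i f x.

Definition boundary K : set 'rV[R]_d := closure K `\` interior K.

(* On the open set U, K is the sublevel set {rho <= 0} of a submersion, so
   that its boundary is there the smooth hypersurface {rho = 0}. *)
Definition local_defining_function K U rho : Prop :=
  [/\ open U, smooth_on U rho,
      forall y, U y -> grad rho y != 0 &
      forall y, U y -> (K y <-> rho y <= 0)].

Definition outward_normal rho x : 'rV[R]_d :=
  (enorm (grad rho x))^-1 *: grad rho x.

Definition inward_normal rho x : 'rV[R]_d := - outward_normal rho x.

(* Second fundamental form of the level set of rho through x, with respect to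
   the inward normal n: II(v, w) = - <D_v n, w> for v, w tangent at x.  It is
   positive definite for spheres. *)
Definition second_fundamental_form rho x v w : R :=
  - dotv ('D_v (inward_normal rho) x) w.

Definition tangent rho x : set 'rV[R]_d := [set v | dotv (grad rho x) v = 0].

Definition smooth_positively_curved_boundary K : Prop :=
  forall x, boundary K x ->
  exists U rho, [/\ U x, local_defining_function K U rho &
    forall v, tangent rho x v -> v != 0 ->
      0 < second_fundamental_form rho x v v].

Definition strictly_convex_compact K : Prop :=
  (exists x, K = [set x]) \/
  [/\ compact K, convex_set K, interior K !=set0 &
      smooth_positively_curved_boundary K].

Inductive orientation := Outgoing | Ingoing.

Definition unit_normal K (o : orientation) x (theta : 'rV[R]_d) : Prop :=
  exists U rho, [/\ U x, local_defining_function K U rho &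
    theta = match o with
            | Outgoing => outward_normal rho x
            | Ingoing => inward_normal rho x
            end].

End EuclideanSpace.

Section Torus.
Context (R : realType) (d : nat).

Definition lattice_congr (x y : 'rV[R]_d) : bool :=
  `[< exists k : 'rV[int]_d, x - y = (2 * pi) *: map_mx intr k >].

Lemma lattice_congr_refl : reflexive lattice_congr.
Proof.
by move=> x; apply/asboolP; exists 0; rewrite subrr map_mx0 scaler0.
Qed.

Lemma lattice_congr_sym : symmetric lattice_congr.
Proof.
suff H x y : lattice_congr x y -> lattice_congr y x.
  by move=> x y; apply/idP/idP; exact: H.
move=> /asboolP[k xy]; apply/asboolP; exists (- k).
by rewrite map_mxN scalerN -xy opprB.
Qed.

Lemma lattice_congr_trans : transitive lattice_congr.
Proof.
move=> y x z /asboolP[k xy] /asboolP[l yz]; apply/asboolP; exists (k + l).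
by rewrite map_mxD scalerDr -xy -yz addrA subrK.
Qed.

Canonical lattice_congr_equiv := EquivRel lattice_congr
  lattice_congr_refl lattice_congr_sym lattice_congr_trans.

Definition torus := {eq_quot lattice_congr}.

Definition proj (x : 'rV[R]_d) : torus := \pi_torus x.

End Torus.

Section Orthogeodesics.
Context {R : realType} {d : nat}.
Implicit Types (K : set 'rV[R]_d) (o : orientation).

(* Subset of the unit tangent bundle of the torus, whose fibres are identified
   with R^d.  A singleton has no local defining function at its point, so the
   two cases do not interfere. *)
Definition normal_bundle K o : set (torus R d * 'rV[R]_d) :=
  [set p | (exists x, [/\ K = [set x], p.1 = proj x & enorm p.2 = 1]) \/
           (exists x, [/\ boundary K x, p.1 = proj x &
                          unit_normal K o x p.2])].

Record curve := Curve {
  len : R ;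
  path_of : {t : R | 0 <= t <= len} -> torus R d }.

HB.instance Definition _ := gen_eqMixin curve.
HB.instance Definition _ := gen_choiceMixin curve.

(* The velocity of the geodesic t |-> proj (x + t theta) is constantly theta. *)
Definition orthogeodesics K1 o1 K2 o2 : set curve :=
  [set g | 0 < len g /\
    exists x theta : 'rV[R]_d,
      [/\ enorm theta = 1,
          forall t, path_of (c := g) t = proj (x + val t *: theta),
          normal_bundle K1 o1 (proj x, theta) &
          normal_bundle K2 o2 (proj (x + len g *: theta), theta)]].

Definition truncated_orthogeodesics K1 o1 K2 o2 (T0 T : R) : set curve :=
  orthogeodesics K1 o1 K2 o2 `&` [set g | T0 < len g <= T].

End Orthogeodesics.

Section TemperedDistributions.
Context {R : realType}.
Implicit Types (phi psi : R -> R[i]) (V : set R).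

Definition cmod (z : R[i]) : R := complex.Re `|z|.

Definition reF {T : Type} (f : T -> R[i]) : T -> R := fun x => complex.Re (f x).
Definition imF {T : Type} (f : T -> R[i]) : T -> R := fun x => complex.Im (f x).

Definition cderiv (n : nat) phi : R -> R[i] :=
  fun x => derive1n n (reF phi) x +i* derive1n n (imF phi) x.

Definition csmooth_on V phi : Prop :=
  forall n x, V x ->
    derivable (derive1n n (reF phi)) x 1 /\
    derivable (derive1n n (imF phi)) x 1.

Definition cintegral phi : R[i] :=
  (\int[lebesgue_measure]_x reF phi x)
  +i* (\int[lebesgue_measure]_x imF phi x).

Definition schwartz phi : Prop :=
  csmooth_on setT phi /\
  forall j k : nat, exists M : R,
    forall x, `|x| ^+ j * cmod (cderiv k phi x) <= M.

Definition schwartz_seminorm (j k : nat) phi : R :=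
  sup [set `|x| ^+ j * cmod (cderiv k phi x) | x in setT].

(* Distributions are functionals on all functions R -> R[i] of which only the
   values on Schwartz functions are meaningful. *)
Definition functional := (R -> R[i]) -> R[i].
Implicit Types (u : functional).

Definition tempered u : Prop :=
  (forall (a : R[i]) phi psi, schwartz phi -> schwartz psi ->
    u (fun x => a * phi x + psi x) = a * u phi + u psi) /\
  exists (C : R) (N : nat), forall phi, schwartz phi ->
    cmod (u phi) <= C * \sum_(j < N) \sum_(k < N) schwartz_seminorm j k phi.

Definition tempered_cvg (u_ : R -> functional) u : Prop :=
  tempered u /\
  forall phi, schwartz phi ->
    complex.Re (u_ t phi) @[t --> +oo%R] --> complex.Re (u phi) /\
    complex.Im (u_ t phi) @[t --> +oo%R] --> complex.Im (u phi).

Definition fourier phi : R -> R[i] :=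
  fun xi => cintegral (fun x => (cos (x * xi) -i* sin (x * xi)) * phi x).

Definition fourier_distribution u : functional := fun phi => u (fourier phi).

Definition support phi : set R := closure [set x | phi x != 0].

Definition smooth_distribution_on V u : Prop :=
  exists2 f : R -> R[i], csmooth_on V f &
    forall phi, schwartz phi -> compact (support phi) ->
      support phi `<=` V -> u phi = cintegral (fun x => f x * phi x).

Definition singular_support u : set R :=
  ~` (\bigcup_(V in [set V | open V /\ smooth_distribution_on V u]) V).

End TemperedDistributions.

Section OrthospectralDistribution.
Context {R : realType} {d : nat}.
Implicit Types (K : set 'rV[R]_d) (o : orientation).

Definition truncated_length_distribution K1 o1 K2 o2 (T0 T : R) :
    @functional R :=
  fun phi => \sum_(g \in truncated_orthogeodesics K1 o1 K2 o2 T0 T) phi (len g).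

Definition length_distribution K1 o1 K2 o2 (T0 : R) : @functional R :=
  fun phi =>
    let S T := truncated_length_distribution K1 o1 K2 o2 T0 T phi in
    lim (complex.Re (S T) @[T --> +oo%R])
    +i* lim (complex.Im (S T) @[T --> +oo%R]).

End OrthospectralDistribution.

Section LaplaceSpectrum.
Context (R : realType).

(* Integral over the box [0, 2 pi]^d, as an iterated integral. *)
Fixpoint box_integral (d : nat) : ('rV[R]_d -> R) -> R :=
  match d with
  | 0 => fun f => f 0
  | n.+1 => fun f =>
      \int[lebesgue_measure]_(t in `[0, 2 * pi])
        box_integral (fun x : 'rV[R]_n => f (row_mx (const_mx t : 'rV_1) x))
  end.

Context (d : nat).
Implicit Types (f : torus R d -> R[i]).

Definition torus_smooth f : Prop :=
  smooth_on setT (reF (f \o @proj R d)) /\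
  smooth_on setT (imF (f \o @proj R d)).

Definition torus_L2norm f : R :=
  Num.sqrt (box_integral (fun x => cmod (f (proj x)) ^+ 2)).

Definition laplacian (g : 'rV[R]_d -> R) : 'rV[R]_d -> R :=
  fun x => \sum_(j < d) partial j (partial j g) x.

Definition torus_laplacian f : torus R d -> R[i] :=
  fun q => laplacian (reF (f \o @proj R d)) (repr q)
           +i* laplacian (imF (f \o @proj R d)) (repr q).

(* Resolvent set of the self-adjoint operator - Laplacian on L^2 of the torus,
   the closure of its restriction to smooth functions: z is in the resolvent
   set of the closure iff, on the smooth functions, - Laplacian - z is bounded
   below and has dense range. *)
Definition resolvent_set : set R[i] :=
  [set z |
    let A f := fun q => - torus_laplacian f q - z * f q in
    (exists2 c : R, 0 < c & forall f, torus_smooth f ->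
       c * torus_L2norm f <= torus_L2norm (A f)) /\
    (forall g, torus_smooth g -> forall e : R, 0 < e ->
       exists2 f, torus_smooth f & torus_L2norm (fun q => A f q - g q) < e)].

Definition spectrum : set R[i] := ~` resolvent_set.

(* The spectrum of - Laplacian lies in [0, +oo[. *)
Definition spectrum_sqrt : set R :=
  [set Num.sqrt m | m in [set m : R | spectrum m%:C]].

Definition spectrum_opp_sqrt : set R := [set - s | s in spectrum_sqrt].

End LaplaceSpectrum.

Arguments spectrum_sqrt R d : clear implicits.
Arguments spectrum_opp_sqrt R d : clear implicits.

(* Main.v *)
(* For large k in Z^d the orthogeodesics are indexed by k: if Y_i(theta) is the
   point of the boundary of K_i with chosen normal theta, the equation
   Y_1(theta) + l theta = Y_2(theta) + 2 pi k has a unique solution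
   (theta(k), l(k)), and all but finitely many orthogeodesics arise in this way.
   The implicit equation shows that l is a discrete symbol of order 1: its
   differences of order r are O(|k|^(1 - r)); moreover
   l(k + e_i) - l(k) = 2 pi theta_i(k) + O(1/|k|).  If tau^2 is not of the form
   |xi|^2 with xi in Z^d, then tau theta is never an integer vector, so that by
   compactness the numbers exp(-i tau (l(k + e_i) - l(k))) - 1 cannot be
   simultaneously small for large k.  Summation by parts then replaces the
   amplitude a of sum_k a(k) exp(-i tau l(k)) by one of order one less; after
   finitely many steps the series converges absolutely together with as many
   tau-derivatives as desired, locally uniformly near tau.  Finally |xi|^2 is an
   eigenvalue of - Laplacian, with eigenfunction exp(i xi.x).  Summation by parts
   stands in for the Poisson summation formula and stationary phase. *)

Require Import Defs.
From mathcomp Require Import all_boot all_order all_algebra all_fingroup.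
From mathcomp Require Import all_classical all_reals all_analysis.
From mathcomp Require Import complex ring lra zify.

Set Implicit Arguments.
Unset Strict Implicit.
Unset Printing Implicit Defensive.

Import Order.TTheory GRing.Theory Num.Theory.
Import numFieldNormedType.Exports.

Local Open Scope classical_set_scope.
Local Open Scope ring_scope.

(** The inverse Gauss maps [Y_i] are never differentiated; their regularity is stated for finite
    differences in [k]. If [rho] defines the boundary, Taylor expansion of [rho] and of its gradient
    between two boundary points gives a linear system for the difference of the points, whose right
    side is the difference of the normals plus remainders quadratic in the unknown. Being quadratic,
    these gain a difference, so the system bootstraps; curvature makes its determinant nonzero. The
    implicit equation is bootstrapped likewise: in [l theta = 2 pi k - (Y_1 - Y_2)(theta)] the last
    term has one order less than the others, and one order buys one difference. The other obstacle
    is that the series diverges at the start, so summation by parts has no sum to act on. It is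
    performed after integration against a test function of [tau], where integrations by parts in
    [tau] provide decay in [k]; the sum moves under the integral only once the amplitude has low
    order. From then on further steps leave the sum unchanged, and taking more of them yields every
    order of differentiability of one and the same function. *)

Lemma mvt_bound (R : realType) (f df : R -> R) (M : R) :
  (forall t : R, 0 <= t <= 1 -> is_derive t 1 f (df t)) ->
  (forall t : R, 0 <= t <= 1 -> `|df t| <= M) -> `|f 1 - f 0| <= M.
Proof.
move=> fd dfM.
have [||c cI ->] := @MVT_segment R f df 0 1 ler01.
- move=> x; rewrite in_itv/= => /andP[x0 x1]; apply: fd.
  by rewrite (ltW x0) (ltW x1).
- apply: derivable_within_continuous => x; rewrite in_itv/= => xI.
  by have [] := fd x xI.
by rewrite subr0 mulr1; apply: dfM; move: cI; rewrite in_itv.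
Qed.

(** * Discrete symbols *)

Section Symbol.
Context {R : realType} {L : zmodType} {J : Type}.
Variables (e : J -> L) (w : L -> R) (F : set_system L).

Definition lattice_weight :=
  (forall k, 1 <= w k) /\
  (forall j k, w (k + e j) <= 2 * w k /\ w k <= 2 * w (k + e j)).

Definition shift_invariant :=
  forall j (P : set L), (\forall k \near F, P k) ->
    \forall k \near F, P (k + e j).

(** Instantiated with three filters: [at_infinity], [at_direction] and [everywhere]. Shift
    invariance is what allows an estimate at [k] to be used at [k + e j]. *)
Definition symbol_setting := [/\ Filter F, lattice_weight & shift_invariant].

Definition dif {I : Type} (j : J) (a : I -> L -> R) : I -> L -> R :=
  fun i k => a i (k + e j) - a i k.

Definition shf {I : Type} (j : J) (a : I -> L -> R) : I -> L -> R :=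
  fun i k => a i (k + e j).

Definition bnd {I : Type} (m : int) (D : set I) (a : I -> L -> R) :=
  exists C, \forall k \near F, forall i, D i -> `|a i k| <= C * w k ^ m.

(* [sym n m D a]: differences of order [r <= n] of the family [a] are
   O(w ^ (m - r)), uniformly over the parameters in [D]. *)
Fixpoint sym {I : Type} (n : nat) (m : int) (D : set I) (a : I -> L -> R) :=
  bnd m D a /\
  match n with
  | 0 => True
  | n'.+1 => forall j, sym n' (m - 1) D (dif j a)
  end.

Hypothesis hS : symbol_setting.

#[local] Instance symbol_filter : Filter F. Proof. by case: hS. Qed.

Let hw : lattice_weight. Proof. by case: hS. Qed.
Let hF : shift_invariant. Proof. by case: hS. Qed.

#[local] Set Default Proof Using "Type hS".

Lemma w_gt0 k : 0 < w k.
Proof. exact: lt_le_trans ltr01 (hw.1 k). Qed.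

Lemma w_ne0 k : w k != 0.
Proof. by rewrite gt_eqF// w_gt0. Qed.

Lemma wz_gt0 k (m : int) : 0 < w k ^ m.
Proof. by rewrite exprz_gt0// w_gt0. Qed.

Lemma wz_le k (m m' : int) : m <= m' -> w k ^ m <= w k ^ m'.
Proof. by move=> mm'; rewrite ler_weXz2l// hw.1. Qed.

Lemma wz_shift (m : int) :
  exists2 C : R, 0 < C & forall j k, w (k + e j) ^ m <= C * w k ^ m.
Proof.
have w2 : forall (x y : R), 0 < x -> 0 < y -> x <= 2 * y -> forall n : nat,
    x ^+ n <= 2 ^+ n * y ^+ n.
  move=> x y x0 y0 xy n; rewrite -exprMn lerXn2r// nnegrE ltW//.
  by rewrite mulr_gt0.
case: m => n.
  exists (2 ^+ n) => [|j k]; first by rewrite exprn_gt0.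
  by apply: w2 (hw.2 j k).1 n; exact: w_gt0.
exists (2 ^+ n.+1) => [|j k]; first by rewrite exprn_gt0.
have := w2 _ _ (w_gt0 k) (w_gt0 (k + e j)) (hw.2 j k).2 n.+1.
rewrite NegzE -!exprnN => h.
rewrite -[X in X <= _]mul1r ler_pdivrMr ?exprn_gt0 ?w_gt0//.
by rewrite mulrAC ler_pdivlMr ?exprn_gt0 ?w_gt0// mul1r.
Qed.

Lemma bnd_ex {I : Type} m (D : set I) a : bnd m D a ->
  exists2 C, 0 < C &
    \forall k \near F, forall i, D i -> `|a i k| <= C * w k ^ m.
Proof.
move=> [C h]; exists (Num.max C 1); first by rewrite lt_max ltr01 orbT.
apply: filterS h => k h i Di; apply: le_trans (h i Di) _.
apply: ler_wpM2r; first exact/ltW/wz_gt0.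
by rewrite le_max lexx.
Qed.

Lemma bnd_le {I : Type} m m' (D : set I) a : m <= m' -> bnd m D a -> bnd m' D a.
Proof.
move=> mm' /bnd_ex[C C0 h]; exists C; apply: filterS h => k h i Di.
by apply: le_trans (h i Di) _; rewrite ler_pM2l// wz_le.
Qed.

Lemma bnd_ext {I : Type} m (D : set I) a b :
  (\forall k \near F, forall i, D i -> a i k = b i k) -> bnd m D a -> bnd m D b.
Proof.
move=> ab [C h]; exists C; apply: filterS2 ab h => k ab h i Di.
by rewrite -ab//; exact: h.
Qed.

Lemma bnd_shf {I : Type} m (D : set I) j a : bnd m D a -> bnd m D (shf j a).
Proof.
move=> /bnd_ex[C C0 h]; have [C' C'0 hC'] := wz_shift m.
exists (C * C'); apply: filterS (hF j h) => k hk i Di.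
apply: le_trans (hk i Di) _; rewrite -mulrA ler_pM2l//; exact: hC'.
Qed.

Lemma bnd_add {I : Type} m (D : set I) a b : bnd m D a -> bnd m D b ->
  bnd m D (fun i k => a i k + b i k).
Proof.
move=> [C h] [C' h']; exists (C + C'); apply: filterS2 h h' => k h h' i Di.
by apply: le_trans (ler_normD _ _) _; rewrite mulrDl lerD ?h ?h'.
Qed.

Lemma bnd_opp {I : Type} m (D : set I) a : bnd m D a ->
  bnd m D (fun i k => - a i k).
Proof.
by move=> [C h]; exists C; apply: filterS h => k h i Di; rewrite normrN h.
Qed.

Lemma bnd_mul {I : Type} m m' (D : set I) a b : bnd m D a -> bnd m' D b ->
  bnd (m + m') D (fun i k => a i k * b i k).
Proof.
move=> [C h] [C' h']; exists (C * C'); apply: filterS2 h h' => k h h' i Di.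
by rewrite normrM expfzDr ?w_ne0// mulrACA ler_pM ?h ?h'.
Qed.

Lemma sym_bnd {I : Type} n m (D : set I) a : sym n m D a -> bnd m D a.
Proof. by case: n => [|n] []. Qed.

Lemma sym_difS {I : Type} n m (D : set I) a j :
  sym n.+1 m D a -> sym n (m - 1) D (dif j a).
Proof. by move=> [_]; exact. Qed.

Lemma sym_ext {I : Type} n m (D : set I) a b :
  (\forall k \near F, forall i, D i -> a i k = b i k) ->
  sym n m D a -> sym n m D b.
Proof.
elim: n m a b => [|n IH] m a b ab [ha ha'] /=; split=> //;
  try exact: bnd_ext ab ha.
move=> j; apply: IH (ha' j); apply: filterS2 ab (hF j ab) => k h h' i Di.
by rewrite /dif h' ?h.
Qed.

Lemma sym_comp_param {I I' : Type} n m (D : set I) (D' : set I') (f : I' -> I) a :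
  (forall i, D' i -> D (f i)) -> sym n m D a -> sym n m D' (fun i => a (f i)).
Proof.
move=> DD; elim: n m a => [|n IH] m a [[C h] ha'] /=.
  by split=> //; exists C; apply: filterS h => k h i /DD; exact: h.
split=> [|j]; first by exists C; apply: filterS h => k h i /DD; exact: h.
exact: IH (ha' j).
Qed.

Lemma symW {I : Type} n n' m (D : set I) a : (n' <= n)%N ->
  sym n m D a -> sym n' m D a.
Proof.
elim: n n' m a => [|n IH] [|n'] m a //= nn' [ha ha']; split => // j.
exact: IH (ha' j).
Qed.

Lemma sym_le {I : Type} n m m' (D : set I) a : m <= m' ->
  sym n m D a -> sym n m' D a.
Proof.
elim: n m m' a => [|n IH] m m' a mm' [ha ha'] /=; split=> //;
  try exact: bnd_le ha.
by move=> j; apply: IH (ha' j); rewrite lerB.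
Qed.

Lemma sym_shf {I : Type} n m (D : set I) j a : sym n m D a -> sym n m D (shf j a).
Proof.
elim: n m a => [|n IH] m a [ha ha'] /=; split=> //; try exact: bnd_shf.
move=> j'.
apply: sym_ext (IH _ _ (ha' j')).
by apply: nearW => k i Di; rewrite /shf /dif addrAC.
Qed.

Lemma sym_add {I : Type} n m (D : set I) a b : sym n m D a -> sym n m D b ->
  sym n m D (fun i k => a i k + b i k).
Proof.
elim: n m a b => [|n IH] m a b [ha ha'] [hb hb'] /=;
  split=> //; try exact: bnd_add.
move=> j.
apply: sym_ext (IH _ _ _ (ha' j) (hb' j)); apply: nearW => k i Di.
by rewrite /dif; ring.
Qed.

Lemma sym_opp {I : Type} n m (D : set I) a : sym n m D a ->
  sym n m D (fun i k => - a i k).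
Proof.
elim: n m a => [|n IH] m a [ha ha'] /=; split=> //; try exact: bnd_opp.
move=> j.
apply: sym_ext (IH _ _ (ha' j)); apply: nearW => k i Di.
by rewrite /dif; ring.
Qed.

Lemma sym_dif {I : Type} n m (D : set I) j a : sym n m D a -> sym n m D (dif j a).
Proof. by move=> h; apply: sym_add (sym_shf j h) (sym_opp h). Qed.

(** One unit of order buys one more difference, since the last difference is bounded without any
    gain. The bootstrap in [sym_direction_length] rests on this exchange. *)
Lemma symS {I : Type} n m (D : set I) a : sym n m D a -> sym n.+1 (m + 1) D a.
Proof.
move=> h; split; first by apply: bnd_le (sym_bnd h); rewrite lerDl.
by move=> j; rewrite addrK; exact: sym_dif.
Qed.

Lemma sym_mul {I : Type} n m m' (D : set I) a b : sym n m D a -> sym n m' D b ->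
  sym n (m + m') D (fun i k => a i k * b i k).
Proof.
elim: n m m' a b => [|n IH] m m' a b ha hb; split=> //;
  try exact: bnd_mul (sym_bnd ha) (sym_bnd hb).
move=> j; have h1 := IH _ _ _ _ (ha.2 j) (sym_shf j (symW (leqnSn _) hb)).
have h2 := IH _ _ _ _ (symW (leqnSn _) ha) (hb.2 j).
rewrite addrAC in h1; rewrite addrA in h2.
apply: sym_ext (sym_add h1 h2); apply: nearW => k i Di.
by rewrite /dif /shf; ring.
Qed.

Lemma sym_cst {I : Type} n (D : set I) (c : I -> R) :
  (exists C, forall i, D i -> `|c i| <= C) -> sym n 0 D (fun i _ => c i).
Proof.
move=> [C hC].
have h0 m' : sym n m' D (fun _ _ => 0).
  elim: n m' => [|n IH] m' /=; (split; first by exists 0; apply: nearW => k i _;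
    rewrite normr0 mul0r) => // j.
  by apply: sym_ext (IH _); apply: nearW => k i _; rewrite /dif subrr.
have hb : bnd 0 D (fun i _ => c i).
  by exists C; apply: nearW => k i Di; rewrite mulr1; exact: hC.
case: n h0 => [|n] h0 //=; split=> // j.
have := h0 (0 - 1); move=> /(symW (leqnSn _)); apply: sym_ext.
by apply: nearW => k i _; rewrite /dif subrr.
Qed.

Lemma sym0 {I : Type} n m (D : set I) : sym n m D (fun _ _ => 0).
Proof.
elim: n m => [|n IH] m /=; (split; first by exists 0; apply: nearW => k i _;
  rewrite normr0 mul0r) => // j.
by apply: sym_ext (IH _); apply: nearW => k i _; rewrite /dif subrr.
Qed.

Lemma sym_scale {I : Type} n m (D : set I) (c : I -> R) a :
  (exists C, forall i, D i -> `|c i| <= C) -> sym n m D a ->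
  sym n m D (fun i k => c i * a i k).
Proof. by move=> /(@sym_cst _ n) h ha; rewrite -[m]add0r; exact: sym_mul. Qed.

Lemma sym_sum {I T : Type} (r : seq T) (P : pred T) n m (D : set I)
    (a : T -> I -> L -> R) : (forall t, P t -> sym n m D (a t)) ->
  sym n m D (fun i k => \sum_(t <- r | P t) a t i k).
Proof.
move=> h; elim: r => [|t r IH].
  by apply: sym_ext (sym0 n m D); apply: nearW => k i _; rewrite big_nil.
have [Pt|nPt] := boolP (P t).
  apply: sym_ext (sym_add (h t Pt) IH).
  by apply: nearW => k i _; rewrite big_cons Pt.
by apply: sym_ext IH; apply: nearW => k i _; rewrite big_cons (negbTE nPt).
Qed.

Lemma sym_prod {I T : Type} (r : seq T) (P : pred T) n (D : set I)
    (a : T -> I -> L -> R) : (forall t, P t -> sym n 0 D (a t)) ->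
  sym n 0 D (fun i k => \prod_(t <- r | P t) a t i k).
Proof.
move=> h; elim: r => [|t r IH].
  apply: sym_ext (@sym_cst _ n D (fun=> 1) _); last by exists 1 => i _; rewrite normr1.
  by apply: nearW => k i _; rewrite big_nil.
have [Pt|nPt] := boolP (P t).
  have := sym_mul (h t Pt) IH; rewrite addr0; apply: sym_ext.
  by apply: nearW => k i _; rewrite big_cons Pt.
by apply: sym_ext IH; apply: nearW => k i _; rewrite big_cons (negbTE nPt).
Qed.

Definition elliptic {I : Type} (m : int) (D : set I) (a : I -> L -> R) :=
  exists2 c, 0 < c & \forall k \near F, forall i, D i -> c * w k ^ m <= `|a i k|.

Lemma elliptic_ne0 {I : Type} m (D : set I) a : elliptic m D a ->
  \forall k \near F, forall i, D i -> a i k != 0.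
Proof.
move=> [c c0 h]; apply: filterS h => k h i Di; rewrite -normr_gt0.
by apply: lt_le_trans (h i Di); rewrite mulr_gt0// wz_gt0.
Qed.

(** Induction through [dif (1/a) = - dif a * (1/a) * shf (1/a)]: to control [n + 1] differences of
    the inverse, only [n] differences of it occur on the right, and [dif a] brings the gain of
    order. *)
Lemma sym_inv {I : Type} n m (D : set I) a : elliptic m D a ->
  sym n m D a -> sym n (- m) D (fun i k => (a i k)^-1).
Proof.
move=> ell; have a0 := elliptic_ne0 ell.
have hb : bnd (- m) D (fun i k => (a i k)^-1).
  case: ell => c c0 h; exists c^-1; apply: filterS2 a0 h => k a0 h i Di.
  rewrite normfV -invr_expz -invfM lef_pV2 ?posrE ?normr_gt0 ?a0 ?h//.
  by rewrite mulr_gt0// wz_gt0.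
elim: n => [|n IH] ha //=; split=> // j.
have h := IH (symW (leqnSn _) ha).
have := sym_opp (sym_mul (ha.2 j) (sym_mul h (sym_shf j h))).
have -> : m - 1 + (- m + - m) = - m - 1 by ring.
apply: sym_ext; apply: filterS2 a0 (hF j a0) => k a0 a0' i Di.
by rewrite /dif /shf; field; rewrite a0 ?a0'.
Qed.

(** Same induction, with [dif (sqrt a) = dif a / (sqrt a + shf (sqrt a))]; positivity of both roots
    makes the denominator elliptic of order [m]. *)
Lemma sym_sqrt {I : Type} n (m : int) (D : set I) a :
  (exists2 c, 0 < c & \forall k \near F, forall i, D i -> c * w k ^ (m + m) <= a i k) ->
  sym n (m + m) D a -> sym n m D (fun i k => Num.sqrt (a i k)).
Proof.
move=> [c c0 h].
have sE k : Num.sqrt (w k ^ (m + m)) = w k ^ m.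
  by rewrite expfzDr ?w_ne0// sqrtr_sqr// ger0_norm// ltW// wz_gt0.
have pos : \forall k \near F, forall i, D i -> 0 < a i k.
  by apply: filterS h => k h i Di; apply: lt_le_trans (h i Di); rewrite mulr_gt0// wz_gt0.
have low : \forall k \near F, forall i, D i ->
    Num.sqrt c * w k ^ m <= Num.sqrt (a i k).
  apply: filterS h => k h i Di; rewrite -sE -sqrtrM ?(ltW c0)//; apply: ler_wsqrtr; exact: h.
have hb : bnd (m + m) D a -> bnd m D (fun i k => Num.sqrt (a i k)).
  move=> /bnd_ex[C C0 hC]; exists (Num.sqrt C).
  apply: filterS2 pos hC => k pos hC i Di.
  rewrite ger0_norm ?sqrtr_ge0// -sE -sqrtrM ?(ltW C0)//; apply: ler_wsqrtr.
  by apply: le_trans (hC i Di); rewrite ler_norm.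
elim: n => [|n IH] ha; first by split=> //; apply: hb; exact: sym_bnd ha.
split=> [|j]; first by apply: hb; exact: sym_bnd ha.
have hs := IH (symW (leqnSn _) ha).
have hs2 := sym_add hs (sym_shf j hs).
have ell : elliptic m D (fun i k => Num.sqrt (a i k) + shf j (fun i k => Num.sqrt (a i k)) i k).
  exists (Num.sqrt c); first by rewrite sqrtr_gt0.
  apply: filterS low => k low i Di.
  rewrite ger0_norm; last by rewrite addr_ge0// sqrtr_ge0.
  by apply: le_trans (low i Di) _; rewrite lerDl sqrtr_ge0.
have := sym_mul (ha.2 j) (sym_inv ell hs2).
have -> : m + m - 1 - m = m - 1 by ring.
apply: sym_ext; apply: filterS2 pos (hF j pos) => k pos pos' i Di.
rewrite /dif /shf.
have : 0 < Num.sqrt (a i k) by rewrite sqrtr_gt0 pos.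
have : 0 < Num.sqrt (a i (k + e j)) by rewrite sqrtr_gt0 pos'.
have : Num.sqrt (a i k) ^+ 2 = a i k by rewrite sqr_sqrtr// ltW// pos.
have : Num.sqrt (a i (k + e j)) ^+ 2 = a i (k + e j).
  by rewrite sqr_sqrtr// ltW// pos'.
move: (Num.sqrt _) (Num.sqrt _) => v u <- <- v0 u0.
by field; rewrite gt_eqF// addr_gt0.
Qed.

(** A difference in [k] commutes with the increment from [t = 0] to [t = 1], so the mean value bound
    applies to differences of every order. This is why symbols are families: the parameter [t]
    becomes one more index. *)
Lemma sym_mvt {I : Type} n m (D : set I) (G G' : I -> R -> L -> R) :
  (\forall k \near F, forall i (t : R), D i -> 0 <= t <= 1 ->
     is_derive t 1 (fun t => G i t k) (G' i t k)) ->
  sym n m [set p : I * R | D p.1 /\ 0 <= p.2 <= 1] (fun p k => G' p.1 p.2 k) ->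
  sym n m D (fun i k => G i 1 k - G i 0 k).
Proof.
have hb m' (H H' : I -> R -> L -> R) :
  (\forall k \near F, forall i (t : R), D i -> 0 <= t <= 1 ->
     is_derive t 1 (fun t => H i t k) (H' i t k)) ->
  bnd m' [set p : I * R | D p.1 /\ 0 <= p.2 <= 1] (fun p k => H' p.1 p.2 k) ->
  bnd m' D (fun i k => H i 1 k - H i 0 k).
  move=> dH [C h]; exists C; apply: filterS2 dH h => k dH h i Di.
  apply: (@mvt_bound R (fun t => H i t k) (fun t => H' i t k)) => t t01.
    exact: dH.
  exact: (h (i, t)).
elim: n m G G' => [|n IH] m G G' dG [h h']; (split; first exact: hb dG h) => //.
move=> j; apply: sym_ext (IH _ (fun i t k => G i t (k + e j) - G i t k)
  (fun i t k => G' i t (k + e j) - G' i t k) _ (h' j)).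
  by apply: nearW => k i Di; rewrite /dif; ring.
apply: filterS2 dG (hF j dG) => k d1 d2 i t Di t01.
by apply: is_deriveB; [exact: d2|exact: d1].
Qed.

End Symbol.

(** * Trigonometric functions of symbols *)

Section Trig.
Context {R : realType} {L : zmodType} {J : Type}.
Variables (e : J -> L) (w : L -> R) (F : set_system L).
Hypothesis hS : symbol_setting e w F.

#[local] Instance symbol_filter' : Filter F. Proof. by case: hS. Qed.

(** The induction ranges over all families at once: the difference of [cos s] is an increment of the
    cosine along the segment from [s k] to [s (k + e j)], a family with one more parameter and one
    difference fewer to control. *)
Lemma sym_trig {I : Type} n (D : set I) (s : I -> L -> R) :
  sym e w F n 0 D s ->
  sym e w F n 0 D (fun i k => cos (s i k)) /\
  sym e w F n 0 D (fun i k => sin (s i k)).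
Proof.
have bc (I' : Type) (D' : set I') (s' : I' -> L -> R) :
    bnd w F 0 D' (fun i k => cos (s' i k)).
  by exists 1; apply: nearW => k i _; rewrite mulr1 ler_norml cos_geN1 cos_le1.
have bs (I' : Type) (D' : set I') (s' : I' -> L -> R) :
    bnd w F 0 D' (fun i k => sin (s' i k)).
  by exists 1; apply: nearW => k i _; rewrite mulr1 ler_norml sin_geN1 sin_le1.
elim: n I D s => [|n IH] I D s hs; first by split; split.
suff H j : sym e w F n (0 - 1) D (dif e j (fun i k => cos (s i k))) /\
           sym e w F n (0 - 1) D (dif e j (fun i k => sin (s i k))).
  by split; split=> // j; have [] := H j.
pose st (p : I * R) k := s p.1 k + p.2 * dif e j s p.1 k.
pose D' := [set p : I * R | D p.1 /\ 0 <= p.2 <= 1].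
have hd : sym e w F n (0 - 1) D' (fun p k => dif e j s p.1 k).
  by apply: (sym_comp_param hS (f := @fst I R) _ (hs.2 j)) => p [].
have hst : sym e w F n 0 D' st.
  apply: (sym_add hS).
    by apply: (sym_comp_param hS (f := @fst I R) _ (symW hS (leqnSn n) hs)) => p [].
  apply: (sym_scale hS (c := @snd I R)).
    by exists 1 => -[i t] [_ /= /andP[t0 t1]]; rewrite ger0_norm.
  by apply: (sym_le hS _ hd).
have [hc hsn] := IH _ _ _ hst.
have dst i k (t : R) : is_derive t 1 (fun t => st (i, t) k) (dif e j s i k).
  rewrite /st /=; apply: is_derive_eq. by rewrite scaler0 !add0r mul1r [_%:A]mulr1.
have st0 i k : st (i, 0) k = s i k by rewrite /st mul0r addr0.
have st1 i k : st (i, 1) k = s i (k + e j).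
  by rewrite /st /dif /= mul1r addrC subrK.
split.
  apply: (sym_ext hS _ (sym_mvt hS (G := fun i t k => cos (st (i, t) k))
      (G' := fun i t k => dif e j s i k * - sin (st (i, t) k)) _ _)).
  - by apply: nearW => k i _; rewrite st0 st1.
  - by apply: nearW => k i *; apply: is_derive_eq; rewrite mulrC.
  - have := sym_mul hS hd (sym_opp hS hsn); rewrite addr0.
    by apply: (sym_ext hS); apply: nearW => k [i t].
apply: (sym_ext hS _ (sym_mvt hS (G := fun i t k => sin (st (i, t) k))
    (G' := fun i t k => dif e j s i k * cos (st (i, t) k)) _ _)).
- by apply: nearW => k i _; rewrite st0 st1.
- by apply: nearW => k i *; apply: is_derive_eq; rewrite mulrC.
- have := sym_mul hS hd hc; rewrite addr0.
  by apply: (sym_ext hS); apply: nearW => k [i t].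
Qed.

End Trig.

(** * Functions of several variables *)

Section Line.
Context {R : realType} {d : nat}.
Implicit Types (x u v : 'rV[R]_d).

Lemma coord_le x i : `|x 0 i| <= `|x|.
Proof.
rewrite [leRHS]/(Num.norm _)/= mx_normrE.
by apply: (le_trans _ (le_bigmax _ _ (0, i))).
Qed.

Lemma rV_norm_le x c : 0 <= c -> (forall i, `|x 0 i| <= c) -> `|x| <= c.
Proof.
move=> c0 h; rewrite [leLHS]/(Num.norm _)/= mx_normrE.
by apply: bigmax_le => // -[i j] _; rewrite (ord1 i); exact: h.
Qed.

End Line.

Section Directional.
Context {R : realType} {V : normedModType R}.
Implicit Types (x v : V) (f : V -> R).

Lemma is_derive_eps f x v (l : R) :
  (forall eps, 0 < eps -> exists2 dlt, 0 < dlt & forall h, `|h| < dlt ->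
    `|f (x + h *: v) - f x - h * l| <= eps * `|h|) -> is_derive x v f l.
Proof.
move=> H; suff C : h^-1 *: ((f \o shift x) (h *: v) - f x) @[h --> 0^'] --> l.
  by apply: DeriveDef; [apply/cvg_ex; exists l|exact/cvg_lim].
apply/cvgrPdist_le => eps eps0; have [dl dl0 h] := H _ eps0.
near=> t; have t0 : t != 0 by near: t; exact: nbhs_dnbhs_neq.
have -> : l - t^-1 *: ((f \o shift x) (t *: v) - f x) =
    - (t^-1 * (f (x + t *: v) - f x - t * l)).
  by rewrite /= /shift addrC [t *: v + x]addrC mulrBr mulKf// opprB addrC.
rewrite normrN normrM normfV ler_pdivrMl ?normr_gt0// [leRHS]mulrC; apply: h.
near: t; apply: nbhs_dnbhs; exists dl => //= y /=.
by rewrite sub0r normrN.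
Unshelve. all: by end_near. Qed.

Lemma is_derive_line f x v (t l : R) : is_derive (x + t *: v) v f l ->
  is_derive t 1 (fun s : R => f (x + s *: v)) l.
Proof.
move=> [df <-].
suff E : (fun h => h^-1 *: (((fun s : R => f (x + s *: v)) \o shift t) (h *: 1) -
    f (x + t *: v))) =
  (fun h => h^-1 *: ((f \o shift (x + t *: v)) (h *: v) - f (x + t *: v))).
  by apply: DeriveDef; rewrite /derivable /derive /= E.
apply/funext => h /=; rewrite /shift [h *: 1]mulr1 scalerDl.
by rewrite addrCA.
Qed.

End Directional.

Section C1.
Context {R : realType} {d : nat}.
Implicit Types (x u v : 'rV[R]_d) (f : 'rV[R]_d -> R).

(* The increment is telescoped along the coordinate axes. *)
Lemma C1_expansion f x (r : R) : 0 < r ->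
  (forall y, `|y - x| < r -> forall i, derivable f y (delta_mx 0 i)) ->
  (forall i, {for x, continuous (partial i f)}) ->
  forall eps, 0 < eps -> exists2 dlt, 0 < dlt & forall u, `|u| < dlt ->
    `|f (x + u) - f x - \sum_i u 0 i * partial i f x| <= eps * `|u|.
Proof.
move=> r0 fd fc eps eps0.
pose ep := eps / (d%:R + 1).
have ep0 : 0 < ep by rewrite divr_gt0// ltr_wpDl.
have [dl dl0 hdl] : exists2 dl, 0 < dl & forall y, `|y - x| < dl ->
    forall i, `|partial i f y - partial i f x| <= ep.
  have H i : \forall y \near x, `|partial i f y - partial i f x| <= ep.
    have /cvgrPdist_le /(_ _ ep0) := fc i.
    by apply: filterS => y; rewrite distrC.
  have : \forall y \near x, forall i, `|partial i f y - partial i f x| <= ep.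
    exact: (@filter_forall _ 'I_d (fun i y => `|partial i f y - partial i f x| <= ep) (nbhs x) _ H).
  move=> /nbhs_ballP[dl /= dl0 h]; exists dl => // y yx; apply: h.
  by rewrite -ball_normE /= distrC.
exists (Num.min r dl) => [|u]; first by rewrite lt_min r0.
rewrite lt_min => /andP[ur udl].
pose um m : 'rV[R]_d := \row_i (if (i < m)%N then u 0 i else 0).
have step m : (m <= d)%N ->
    `|f (x + um m) - f x - \sum_(i < d | (i < m)%N) u 0 i * partial i f x|
      <= m%:R * (ep * `|u|).
  elim: m => [|m IH] md.
    have -> : um 0%N = 0 by apply/rowP => i; rewrite !mxE ltn0.
    by rewrite addr0 subrr sub0r big_pred0// mul0r oppr0 normr0.
  pose j := Ordinal md.
  have umS : um m.+1 = um m + u 0 j *: delta_mx 0 j.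
    apply/rowP => i; rewrite !mxE /= ltnS leq_eqVlt.
    rewrite -(inj_eq val_inj)/= ; case: eqVneq => [im|_] /=; last by rewrite mulr0 addr0.
    by rewrite im ltnn mulr1 add0r; congr (u 0 _); apply: val_inj.
  rewrite (bigD1 j) /= ?ltnSn// (eq_bigl (fun i : 'I_d => (i < m)%N)); last first.
    move=> i; rewrite ltnS leq_eqVlt -(inj_eq val_inj)/=.
    by case: ltngtP.
  pose g (t : R) := f (x + um m + (t * u 0 j) *: delta_mx 0 j) - t * (u 0 j * partial j f x).
  pose g' (t : R) := u 0 j * (partial j f (x + um m + (t * u 0 j) *: delta_mx 0 j) - partial j f x).
  have near_t (t : R) : 0 <= t <= 1 -> `|um m + (t * u 0 j) *: delta_mx 0 j| <= `|u|.
    move=> /andP[t0 t1]; apply: rV_norm_le => // i.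
    rewrite !mxE /=; case: eqVneq => [ij|_] /=.
      rewrite ij ltnn add0r mulr1 normrM ger0_norm//.
      by rewrite (le_trans _ (coord_le u j))// ler_piMl.
    by rewrite mulr0 addr0; case: ifP => _; rewrite ?normr0// coord_le.
  have gd (t : R) : 0 <= t <= 1 -> is_derive t 1 g (g' t).
    move=> t01.
    have yx : `|x + um m + (t * u 0 j) *: delta_mx 0 j - x| < r.
      by rewrite addrAC [x + _]addrC addrK; exact: le_lt_trans (near_t t t01) ur.
    have := @is_derive_line _ _ f (x + um m) (delta_mx 0 j) (t * u 0 j) _
      (derivableP (fd _ yx j)) => ?.
    have dm : is_derive t 1 (fun t0 : R => t0 * u 0 j) (u 0 j).
      by apply: is_derive_eq; rewrite scaler0 add0r [_%:A]mulr1.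
    have := @is_derive1_comp _ (fun s => f (x + um m + s *: delta_mx 0 j))
      (fun t0 : R => t0 * u 0 j) _ _ _ _ dm.
    move=> /(_ _ _) dc.
    rewrite /g /g'.
    by apply: is_derive_eq; rewrite scaler0 add0r [_%:A]mulr1 mulrBr [X in X - _]mulrC.
  have gM (t : R) : 0 <= t <= 1 -> `|g' t| <= ep * `|u|.
    move=> t01; rewrite normrM mulrC ler_pM// ?coord_le//; apply: hdl.
    rewrite addrAC [x + _]addrC addrK; exact: le_lt_trans (near_t t t01) udl.
  have := mvt_bound gd gM.
  rewrite /g mul1r mul0r scale0r addr0 mul0r subr0 mul1r -[x + _ + _]addrA -umS => h.
  have -> : f (x + um m.+1) - f x - (u 0 j * partial j f x +
      \sum_(i < d | (i < m)%N) u 0 i * partial i f x) =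
    (f (x + um m.+1) - u 0 j * partial j f x - f (x + um m)) +
    (f (x + um m) - f x - \sum_(i < d | (i < m)%N) u 0 i * partial i f x) by ring.
  apply: le_trans (ler_normD _ _) _; rewrite -natr1 mulrDl mul1r addrC lerD//.
  exact: IH (ltnW md).
have := step d (leqnn d).
have -> : um d = u by apply/rowP => i; rewrite mxE ltn_ord.
rewrite (eq_bigl predT); last by move=> i; rewrite ltn_ord.
move=> /le_trans; apply; rewrite mulrA ler_wpM2r//.
rewrite /ep mulrA ler_pdivrMr ?ltr_wpDl// mulrDr mulr1 mulrC lerDl; exact: ltW.
Qed.

End C1.

Section Smooth.
Context {R : realType} {d : nat}.
Implicit Types (x u v : 'rV[R]_d) (f : 'rV[R]_d -> R) (U : set 'rV[R]_d).

Lemma open_norm_ball U x : open U -> U x ->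
  exists2 r : R, 0 < r & forall y, `|y - x| < r -> U y.
Proof.
move=> oU Ux; have /nbhs_ballP[r /= r0 h] : nbhs x U by exact: open_nbhs_nbhs.
by exists r => // y yx; apply: h; rewrite -ball_normE /= distrC.
Qed.

Lemma smooth_on_iter U f s : smooth_on U f -> smooth_on U (iter_partial s f).
Proof.
move=> h s' x Ux; have := h (s' ++ s) x Ux.
by rewrite /iter_partial foldr_cat.
Qed.

Lemma smooth_on_expansion U f x : open U -> smooth_on U f -> U x ->
  forall eps, 0 < eps -> exists2 dlt, 0 < dlt & forall u, `|u| < dlt ->
    `|f (x + u) - f x - \sum_i u 0 i * partial i f x| <= eps * `|u|.
Proof.
move=> oU fU Ux; have [r r0 hr] := open_norm_ball oU Ux.
apply: (C1_expansion r0) => [y /hr Uy i|i].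
  exact: (fU [::] y Uy).2.
exact: (fU [:: i] x Ux).1.
Qed.

Lemma smooth_on_derive U f x v : open U -> smooth_on U f -> U x ->
  is_derive x v f (\sum_i v 0 i * partial i f x).
Proof.
move=> oU fU Ux; apply: is_derive_eps => eps eps0.
have v1 : 0 < `|v| + 1 by rewrite ltr_wpDl.
have [dl dl0 h] := smooth_on_expansion oU fU Ux (divr_gt0 eps0 v1).
exists (dl / (`|v| + 1)) => [|t]; first exact: divr_gt0.
rewrite ltr_pdivlMr// => td.
have /h : `|t *: v| < dl.
  by rewrite normrZ; apply: le_lt_trans td; rewrite ler_wpM2l// lerDl.
rewrite mulr_sumr.
under eq_bigr do rewrite mxE -mulrA.
move=> /le_trans; apply; rewrite normrZ mulrCA mulrC ler_wpM2r//.
by rewrite mulrAC ler_pdivrMr// ler_pM2l// lerDl.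
Qed.

Lemma smooth_on_derive_line U f x v (t : R) : open U -> smooth_on U f ->
  U (x + t *: v) ->
  is_derive t 1 (fun s : R => f (x + s *: v))
    (\sum_i v 0 i * partial i f (x + t *: v)).
Proof. by move=> oU fU Ux; apply/is_derive_line/(smooth_on_derive _ oU fU). Qed.

Definition bounded_partials f x0 (r : R) :=
  forall s, exists C, forall x, `|x - x0| <= r -> `|iter_partial s f x| <= C.

Lemma smooth_on_bounded U f x0 : open U -> smooth_on U f -> U x0 ->
  exists r, [/\ 0 < r, forall x, `|x - x0| <= r -> U x & bounded_partials f x0 r].
Proof.
move=> oU fU Ux; have [r r0 hr] := open_norm_ball oU Ux.
have hr2 x : `|x - x0| <= r / 2 -> U x.
  by move=> h; apply: hr; apply: le_lt_trans h _; lra.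
exists (r / 2); split => //; first by rewrite divr_gt0.
move=> s.
pose K : set 'rV[R]_d := [set x | `|x - x0| <= r / 2].
have cK : compact K.
  apply: bounded_closed_compact.
    exists (`|x0| + r / 2); split; first exact: num_real.
    move=> M hM x /= Kx; rewrite -[x](subrK x0); apply: le_trans (ler_normD _ _) _.
    by rewrite addrC (le_trans _ (ltW hM))// lerD2l.
  rewrite (_ : K = closed_ball_ Num.norm x0 (r / 2)); first exact: closed_closed_ball_.
  by apply/seteqP; split => x; rewrite /K /closed_ball_ /= distrC.
have cf : {within K, continuous (fun x => iter_partial s f x)}.
  apply: continuous_in_subspaceT => x /set_mem /hr2 Ux'.
  exact: (fU s x Ux').1.
have := compact_bounded (continuous_compact cf cK).
move=> [M [_ hM]]; exists (M + 1) => x Kx.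
by apply: (hM (M + 1)); [rewrite ltrDl|exists x].
Qed.

End Smooth.

(** * Symbols composed with smooth functions *)

Section Composition.
Context {R : realType} {d : nat} {L : zmodType} {J : Type}.
Variables (e : J -> L) (w : L -> R) (F : set_system L).
Hypothesis hS : symbol_setting e w F.
#[local] Instance symbol_filter3 : Filter F. Proof. by case: hS. Qed.
Variables (U : set 'rV[R]_d) (f : 'rV[R]_d -> R) (x0 : 'rV[R]_d) (r : R).
Hypotheses (oU : open U) (fU : smooth_on U f).
Hypothesis (BU : forall x, `|x - x0| <= r -> U x).
Hypothesis (fB : bounded_partials f x0 r).

Definition sym_vec {I : Type} n m (D : set I) (z : I -> L -> 'rV[R]_d) :=
  forall l, sym e w F n m D (fun i k => z i k 0 l).

Lemma norm_segment (x y : 'rV[R]_d) (t : R) : 0 <= t <= 1 ->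
  `|x - x0| <= r -> `|y - x0| <= r -> `|x + t *: (y - x) - x0| <= r.
Proof.
move=> /andP[t0 t1] xr yr.
have -> : x + t *: (y - x) - x0 = (1 - t) *: (x - x0) + t *: (y - x0).
  by apply/rowP => i; rewrite !mxE; ring.
apply: le_trans (ler_normD _ _) _; rewrite !normrZ !ger0_norm ?subr_ge0//.
have : (1 - t) * `|x - x0| <= (1 - t) * r by rewrite ler_wpM2l// subr_ge0.
have : t * `|y - x0| <= t * r by rewrite ler_wpM2l.
lra.
Qed.

(** Same scheme as for [sym_trig], with all iterated partials treated together since each difference
    brings in one more partial. Convexity of the ball keeps the segment where the partials are
    bounded. *)
Lemma sym_smooth_comp {I : Type} n (D : set I) (z : I -> L -> 'rV[R]_d) s :
  (\forall k \near F, forall i, D i -> `|z i k - x0| <= r) ->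
  sym_vec n 0 D z ->
  sym e w F n 0 D (fun i k => iter_partial s f (z i k)).
Proof.
have hb (I' : Type) (D' : set I') (z' : I' -> L -> 'rV[R]_d) s' :
  (\forall k \near F, forall i, D' i -> `|z' i k - x0| <= r) ->
  bnd w F 0 D' (fun i k => iter_partial s' f (z' i k)).
  move=> hz; have [C hC] := fB s'; exists C; apply: filterS hz => k hz i Di.
  by rewrite mulr1; apply: hC; exact: hz.
elim: n I D z s => [|n IH] I D z s hz hzs; split=> //; try exact: hb.
move=> j.
pose v (i : I) k := z i (k + e j) - z i k.
pose zt (p : I * R) k := z p.1 k + p.2 *: v p.1 k.
pose D' := [set p : I * R | D p.1 /\ 0 <= p.2 <= 1].
have hzt : \forall k \near F, forall p, D' p -> `|zt p k - x0| <= r.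
  have [_ _ hF] := hS.
  apply: filterS2 hz (hF j _ hz) => k h h' [i t] [/= Di t01].
  by apply: norm_segment => //; [exact: h|exact: h'].
have hv l : sym e w F n (0 - 1) D' (fun p k => v p.1 k 0 l).
  apply: (sym_comp_param hS (D := D) (f := @fst I R) (a := fun i k => v i k 0 l)) => [p []//|].
  apply: (sym_ext hS _ ((hzs l).2 j)).
  by apply: nearW => k i _; rewrite /dif /v !mxE.
have hzts : sym_vec n 0 D' zt.
  move=> l.
  have h1 : sym e w F n 0 D' (fun p k => z p.1 k 0 l).
    by apply: (sym_comp_param hS (f := @fst I R) _ (symW hS (leqnSn n) (hzs l))) => p [].
  have h2 : sym e w F n 0 D' (fun p k => p.2 * v p.1 k 0 l).
    apply: (sym_scale hS (c := @snd I R)).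
      by exists 1 => -[i t] [_ /= /andP[t0 t1]]; rewrite ger0_norm.
    exact: (sym_le hS _ (hv l)).
  apply: (sym_ext hS _ (sym_add hS h1 h2)).
  by apply: nearW => k p _; rewrite /zt !mxE.
apply: (sym_ext hS _ (sym_mvt hS (G := fun i t k => iter_partial s f (zt (i, t) k))
  (G' := fun i t k => \sum_l v i k 0 l * iter_partial (l :: s) f (zt (i, t) k)) _ _)).
- apply: nearW => k i _; rewrite /zt /dif /v /= scale1r scale0r addr0.
  by rewrite [z i k + _]addrC subrK.
- apply: filterS hzt => k h i t Di t01.
  have Uz : U (z i k + t *: v i k) by apply: BU; exact: (h (i, t)).
  exact: (smooth_on_derive_line oU (smooth_on_iter s fU) Uz).
- apply: (sym_sum hS) => l _.
  have := sym_mul hS (hv l) (IH _ _ _ (l :: s) hzt hzts); rewrite addr0.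
  by apply: (sym_ext hS); apply: nearW => k [i t].
Qed.

End Composition.

(** * Euclidean geometry and convex bodies *)

Section Dot.
Context {R : realType} {d : nat}.
Implicit Types (u v x y : 'rV[R]_d) (c : R).

Lemma dotvC u v : dotv u v = dotv v u.
Proof. by apply: eq_bigr => i _; rewrite mulrC. Qed.

Lemma dotvDr u v x : dotv u (v + x) = dotv u v + dotv u x.
Proof. by rewrite -big_split; apply: eq_bigr => i _; rewrite mxE mulrDr. Qed.

Lemma dotvZr c u v : dotv u (c *: v) = c * dotv u v.
Proof. by rewrite mulr_sumr; apply: eq_bigr => i _; rewrite mxE mulrCA. Qed.

Lemma dotvNr u v : dotv u (- v) = - dotv u v.
Proof. by rewrite -scaleN1r dotvZr mulN1r. Qed.

Lemma dotvBr u v x : dotv u (v - x) = dotv u v - dotv u x.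
Proof. by rewrite dotvDr dotvNr. Qed.

Lemma dotvDl u v x : dotv (v + x) u = dotv v u + dotv x u.
Proof. by rewrite dotvC dotvDr ![dotv u _]dotvC. Qed.

Lemma dotvZl c u v : dotv (c *: u) v = c * dotv u v.
Proof. by rewrite dotvC dotvZr dotvC. Qed.

Lemma dotvNl u v : dotv (- u) v = - dotv u v.
Proof. by rewrite dotvC dotvNr dotvC. Qed.

Lemma dotvBl u v x : dotv (v - x) u = dotv v u - dotv x u.
Proof. by rewrite dotvDl dotvNl. Qed.

Lemma dotv0 u : dotv u 0 = 0.
Proof. by rewrite -(scale0r 0) dotvZr mul0r. Qed.

Lemma dotv_ge0 u : 0 <= dotv u u.
Proof. by apply: sumr_ge0 => i _; rewrite -expr2 sqr_ge0. Qed.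

Lemma dotv_eq0 u : (dotv u u == 0) = (u == 0).
Proof.
apply/eqP/eqP => [h|->]; last by rewrite dotv0.
apply/rowP => i; rewrite mxE; apply/eqP; rewrite -sqrf_eq0 expr2.
move/eqP: h; rewrite /dotv psumr_eq0; last by move=> j _; rewrite -expr2 sqr_ge0.
by move=> /allP /(_ i); rewrite mem_index_enum => /(_ isT).
Qed.

Lemma dotv_gt0 u : u != 0 -> 0 < dotv u u.
Proof. by rewrite lt0r dotv_ge0 dotv_eq0 andbT. Qed.

Lemma dotv_delta u i : dotv u (delta_mx 0 i) = u 0 i.
Proof.
rewrite /dotv (bigD1 i)//= mxE !eqxx mulr1 big1 ?addr0// => j ji.
by rewrite mxE (negbTE ji) mulr0.
Qed.

Lemma enorm_sqr u : enorm u ^+ 2 = dotv u u.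
Proof. by rewrite sqr_sqrtr// dotv_ge0. Qed.

Lemma enorm_ge0 u : 0 <= enorm u. Proof. exact: sqrtr_ge0. Qed.

Lemma enorm_eq0 u : (enorm u == 0) = (u == 0).
Proof. by rewrite -sqrf_eq0 enorm_sqr dotv_eq0. Qed.

Lemma enorm_gt0 u : u != 0 -> 0 < enorm u.
Proof. by rewrite lt0r enorm_ge0 enorm_eq0 andbT. Qed.

Lemma enorm1 u : enorm u = 1 <-> dotv u u = 1.
Proof.
split=> h; first by rewrite -enorm_sqr h expr1n.
by rewrite /enorm h sqrtr1.
Qed.

Lemma enormZ c u : enorm (c *: u) = `|c| * enorm u.
Proof.
by rewrite /enorm dotvZl dotvZr mulrA -expr2 sqrtrM ?sqr_ge0// sqrtr_sqr.
Qed.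

Lemma enormN u : enorm (- u) = enorm u.
Proof. by rewrite -scaleN1r enormZ normrN1 mul1r. Qed.

Lemma cauchy_schwarz u v : `|dotv u v| <= enorm u * enorm v.
Proof.
have [->|u0] := eqVneq u 0; first by rewrite dotvC dotv0 normr0 mulr_ge0 ?enorm_ge0.
rewrite -ler_sqr ?nnegrE ?mulr_ge0 ?enorm_ge0// real_normK ?num_real// exprMn !enorm_sqr.
have := dotv_ge0 (dotv u u *: v - dotv u v *: u).
rewrite !(dotvBr, dotvBl, dotvZr, dotvZl) (dotvC v u).
have : 0 < dotv u u by exact: dotv_gt0.
move: (dotv u u) (dotv u v) (dotv v v) => a b c a0 h.
rewrite -(ler_pM2l a0) -subr_ge0; apply: le_trans h _.
by rewrite le_eqVlt; apply/orP; left; apply/eqP; ring.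
Qed.

Lemma enormD u v : enorm (u + v) <= enorm u + enorm v.
Proof.
rewrite -ler_sqr ?nnegrE ?addr_ge0 ?enorm_ge0// enorm_sqr sqrrD !enorm_sqr.
rewrite dotvDl !dotvDr (dotvC v u).
have := le_trans (ler_norm _) (cauchy_schwarz u v); lra.
Qed.

Lemma norm_le_enorm u : `|u| <= enorm u.
Proof.
apply: rV_norm_le (enorm_ge0 u) _ => i.
rewrite -ler_sqr ?nnegrE ?enorm_ge0// real_normK ?num_real// enorm_sqr.
rewrite /dotv (bigD1 i)//= -expr2 lerDl; apply: sumr_ge0 => j _.
by rewrite -expr2 sqr_ge0.
Qed.

Lemma enorm_le_norm u : enorm u <= d%:R * `|u|.
Proof.
rewrite -ler_sqr ?nnegrE ?enorm_ge0 ?mulr_ge0// enorm_sqr exprMn.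
apply: (@le_trans _ _ (\sum_(i < d) `|u| ^+ 2)).
  apply: ler_sum => i _; rewrite -expr2 -(real_normK (num_real (u 0 i))).
  by rewrite ler_sqr ?nnegrE// coord_le.
rewrite sumr_const card_ord -[_ *+ d]mulr_natl ler_wpM2r ?sqr_ge0//.
by rewrite -natrX ler_nat; case: (d) => // n; rewrite leq_pmull.
Qed.

Lemma dotv_le u v : `|dotv u v| <= d%:R * (`|u| * `|v|).
Proof.
apply: le_trans (ler_norm_sum _ _ _) _.
apply: (@le_trans _ _ (\sum_(i < d) `|u| * `|v|)).
  by apply: ler_sum => i _; rewrite normrM ler_pM// coord_le.
by rewrite sumr_const card_ord -[_ *+ d]mulr_natl.
Qed.

Definition sphere : set 'rV[R]_d := [set u | enorm u = 1].

Lemma sphere_norm u : sphere u -> `|u| <= 1.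
Proof. by move=> <-; exact: norm_le_enorm. Qed.

Lemma near_norm x (eps : R) : 0 < eps -> \forall y \near x, `|x - y| <= eps.
Proof.
move=> eps0; apply/nbhs_ballP; exists eps => //= y.
by rewrite -ball_normE /= => /ltW.
Qed.

Lemma lipschitz_continuous (f : 'rV[R]_d -> R) (C : R) : 0 <= C ->
  (forall x y, `|f x - f y| <= C * `|x - y|) -> continuous f.
Proof.
move=> C0 fC x; apply/(@cvgrPdist_le _ _ _ (nbhs x) (nbhs_filter x)) => eps eps0.
have c0 : 0 < C + 1 by rewrite ltr_wpDl.
apply: filterS (near_norm x (divr_gt0 eps0 c0)) => y xy.
apply: le_trans (fC _ _) _; apply: (@le_trans _ _ ((C + 1) * `|x - y|)).
  by rewrite ler_wpM2r// lerDl.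
by rewrite -ler_pdivlMl// mulrC.
Qed.

Lemma dotv_continuous u : continuous (dotv u).
Proof.
apply: (@lipschitz_continuous _ (d%:R * `|u|)) => [|x y]; first exact: mulr_ge0.
by rewrite -dotvBr; apply: le_trans (dotv_le _ _) _; rewrite mulrA.
Qed.

Lemma enorm_continuous : continuous (@enorm R d).
Proof.
apply: (@lipschitz_continuous _ d%:R) => // x y.
apply: le_trans _ (enorm_le_norm _).
rewrite ler_distl; apply/andP; split.
  rewrite lerBlDr -[enorm (x - y)]enormN opprB.
  by apply: le_trans _ (enormD _ _); rewrite addrC subrK.
by apply: le_trans _ (enormD _ _); rewrite addrC subrK.
Qed.

Lemma sphere_compact : compact sphere.
Proof.
apply: bounded_closed_compact.
  exists 1; split; first exact: num_real.
  by move=> M M1 x /sphere_norm /le_trans; apply; exact: ltW.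
apply: (@closed_comp _ _ (@enorm R d) [set 1]).
  by move=> x _; exact: enorm_continuous.
exact: closed_eq.
Qed.

End Dot.

(** * Support points of convex bodies *)

Section Body.
Context {R : realType} {d : nat}.
Implicit Types (u v x y th : 'rV[R]_d) (rho f : 'rV[R]_d -> R).
Implicit Types (K U : set 'rV[R]_d).

Lemma dotv_grad v f x : \sum_i v 0 i * partial i f x = dotv (grad f x) v.
Proof. by apply: eq_bigr => i _; rewrite mxE mulrC. Qed.

Lemma directional_expansion U f x v : open U -> smooth_on U f -> U x ->
  forall eta, 0 < eta -> exists2 dl, 0 < dl & forall t, 0 < t < dl ->
    U (x + t *: v) /\ `|f (x + t *: v) - f x - t * dotv (grad f x) v| <= eta * t.
Proof.
move=> oU fU Ux eta eta0.
have v1 : 0 < `|v| + 1 by rewrite ltr_wpDl.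
have [dl dl0 h] := smooth_on_expansion oU fU Ux (divr_gt0 eta0 v1).
have [r r0 hr] := open_norm_ball oU Ux.
exists (Num.min dl r / (`|v| + 1)); first by rewrite divr_gt0// lt_min dl0.
move=> t /andP[t0]; rewrite ltr_pdivlMr// => tm.
have tv : `|t *: v| < Num.min dl r.
  rewrite normrZ gtr0_norm//; apply: le_lt_trans tm.
  by rewrite ler_pM2l// lerDl.
move: tv; rewrite lt_min => /andP[/h tdl tr]; split.
  by apply: hr; rewrite addrC addKr.
move: tdl; rewrite dotv_grad dotvZr => /le_trans; apply.
rewrite normrZ gtr0_norm// [t * _]mulrC mulrA ler_pM2r//.
by rewrite mulrAC ler_pdivrMr// ler_pM2l// lerDl.
Qed.

Definition is_support K th x := K x /\ forall y, K y -> dotv th y <= dotv th x.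

Lemma support_exists K th : compact K -> K !=set0 -> exists x, is_support K th x.
Proof.
move=> cK K0.
have cf : {within K, continuous (dotv th)}.
  by apply: continuous_subspaceT; exact: dotv_continuous.
have [x /set_mem Kx hx] := EVT_max_rV K0 cK cf.
by exists x; split=> // y /mem_set; exact: hx.
Qed.

Lemma convex_segment K x y (t : R) : convex_set K -> K x -> K y -> 0 <= t <= 1 ->
  K (x + t *: (y - x)).
Proof.
move=> cK Kx Ky /andP[t0 t1].
have := cK y x (Itv01 t0 t1) (mem_set Ky) (mem_set Kx).
rewrite inE; congr K.
rewrite /conv /= /unstable.onem /=.
by apply/rowP => i; rewrite !mxE; ring.
Qed.

Lemma boundary_zero K U rho x : closed K -> local_defining_function K U rho ->
  U x -> boundary K x -> K x /\ rho x = 0.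
Proof.
move=> clK [oU rU gU KU] Ux [cx nix].
have Kx : K x by rewrite ((closure_id K).1 clK).
split => //; apply/eqP; rewrite eq_le (KU x Ux).1//= leNgt; apply/negP => r0.
apply: nix; have crho := (rU [::] x Ux).1.
have h1 : \forall y \near x, rho y < 0.
  have n0 : 0 < - rho x by rewrite oppr_gt0.
  move/(@cvgrPdist_lt _ _ _ (nbhs x) (nbhs_filter x)) : crho => /(_ _ n0).
  by apply: filterS => y /=; rewrite ltr_distl => /andP[+ _]; rewrite /iter_partial/=; lra.
have h2 : \forall y \near x, U y by exact: open_nbhs_nbhs.
rewrite /interior /=; apply: filterS2 h1 h2 => y ry Uy.
by apply/(KU y Uy); exact: ltW.
Qed.

(** If [rho] increased from [x] towards [y], the points of the segment close to [x], which belong to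
    [K] by convexity, would have [rho > 0]. *)
Lemma supporting_hyperplane K U rho x y : closed K -> convex_set K ->
  local_defining_function K U rho -> U x -> boundary K x -> K y ->
  dotv (grad rho x) (y - x) <= 0.
Proof.
move=> clK cK ld Ux bx Ky; have [Kx rx] := boundary_zero clK ld Ux bx.
have [oU rU gU KU] := ld.
rewrite leNgt; apply/negP => a0; set a := dotv _ _ in a0.
have [dl dl0 h] := directional_expansion (y - x) oU rU Ux (divr_gt0 a0 (ltr0n _ 2)).
pose t := Num.min (dl / 2) 1.
have t0 : 0 < t by rewrite lt_min ltr01 divr_gt0.
have [|Ut] := h t.
  by rewrite t0 /= gt_min; apply/orP; left; lra.
have : rho (x + t *: (y - x)) <= 0.
  apply/(KU _ Ut); apply: convex_segment => //. by rewrite (ltW t0)/= ge_min lexx orbT.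
rewrite rx subr0 => r1; rewrite -/a ler_distl => /andP[r2 _].
have := mulr_gt0 t0 a0; lra.
Qed.

Lemma support_of_normal K U rho x : closed K -> convex_set K ->
  local_defining_function K U rho -> U x -> boundary K x ->
  is_support K (outward_normal rho x) x.
Proof.
move=> clK cK ld Ux bx; have [Kx rx] := boundary_zero clK ld Ux bx.
split=> // y Ky; rewrite -subr_le0 -dotvBr dotvZl.
rewrite mulr_ge0_le0 ?invr_ge0 ?enorm_ge0//.
exact: (supporting_hyperplane clK cK ld).
Qed.

Lemma support_boundary K th x : th != 0 -> is_support K th x -> boundary K x.
Proof.
move=> th0 [Kx hx]; split; first exact: subset_closure.
move=> /nbhs_ballP[r /= r0 h].
pose s := r / 2 / (`|th| + 1).
have t1 : 0 < `|th| + 1 by rewrite ltr_wpDl.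
have s0 : 0 < s by rewrite !divr_gt0.
have /h/hx : ball x r (x + s *: th).
  rewrite -ball_normE /= opprD addrA subrr add0r normrN normrZ gtr0_norm//.
  rewrite /s -!mulrA mulrA; apply: (@le_lt_trans _ _ (r / 2 * 1)); last by lra.
  rewrite ler_wpM2l ?divr_ge0 ?(ltW r0)// mulrC ler_pdivrMr//.
  by rewrite mul1r lerDl.
rewrite dotvDr dotvZr gerDl leNgt mulr_gt0//; exact: dotv_gt0.
Qed.

(** Every direction in which [rho] decreases enters [K], hence does not increase [dotv th]. A
    half-space [<grad, v> < 0] contained in [<th, v> <= 0] forces [th] to be a nonnegative multiple
    of the gradient. *)
Lemma support_grad K U rho th x : local_defining_function K U rho -> U x ->
  closed K -> sphere th -> is_support K th x ->
  grad rho x = enorm (grad rho x) *: th /\ rho x = 0.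
Proof.
move=> ld Ux clK sth sx.
have th0 : th != 0.
  by apply/eqP => h; move: sth; rewrite /sphere /= h /enorm dotv0 sqrtr0 => /eqP; rewrite eq_sym oner_eq0.
have bx := support_boundary th0 sx.
have [Kx rx] := boundary_zero clK ld Ux bx.
split => //.
have [oU rU gU KU] := ld.
have down v : dotv (grad rho x) v < 0 -> dotv th v <= 0.
  move=> a0; set a := dotv _ _ in a0; have na0 : 0 < - a by rewrite oppr_gt0.
  have [dl dl0 h] := directional_expansion v oU rU Ux na0.
  have [|Ut] := h (dl / 2); first by rewrite divr_gt0//=; lra.
  rewrite rx subr0 -/a ler_distl => /andP[_ r2].
  have /sx.2 : K (x + (dl / 2) *: v) by apply/(KU _ Ut); lra.
  rewrite dotvDr dotvZr gerDl; apply: contraTT; rewrite -!ltNge => hv.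
  by rewrite mulr_gt0// divr_gt0.
set g := grad rho x in down *.
have g0 : g != 0 by exact: gU.
have gg := dotv_gt0 g0.
pose c := dotv th g / dotv g g.
pose p := th - c *: g.
have gp : dotv g p = 0.
  by rewrite /p dotvBr dotvZr /c divfK ?gt_eqF// dotvC subrr.
have c0 : 0 <= c.
  have : dotv th (- g) <= 0 by apply: down; rewrite dotvNr oppr_lt0.
  by rewrite dotvNr oppr_le0 => h; rewrite /c divr_ge0// ltW.
(* [p] is the part of [th] orthogonal to the gradient. The vector [p - s *: g] is a descent
   direction for every [s > 0]; let [s] tend to 0. *)
have pp : dotv p p <= 0.
  apply/ler_addgt0Pl => eps eps0; rewrite addr0.
  pose s := eps / (`|dotv th g| + 1).
  have t1 : 0 < `|dotv th g| + 1 by rewrite ltr_wpDl.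
  have s0 : 0 < s by rewrite divr_gt0.
  have : dotv th (p - s *: g) <= 0.
    by apply: down; rewrite dotvBr gp dotvZr sub0r oppr_lt0 mulr_gt0.
  have -> : dotv th (p - s *: g) = dotv p p - s * dotv th g.
    rewrite dotvBr dotvZr; congr (_ - _).
    by rewrite -{1}(subrK (c *: g) th) -/p dotvDl dotvZl gp mulr0 addr0.
  rewrite subr_le0 => /le_trans; apply.
  apply: (@le_trans _ _ (s * (`|dotv th g| + 1))).
    by rewrite ler_pM2l// (le_trans (ler_norm _))// lerDl.
  by rewrite /s divfK ?gt_eqF.
have thE : th = c *: g.
  by apply/eqP; rewrite -subr_eq0 -/p -dotv_eq0 eq_le pp dotv_ge0.
have cg : c * enorm g = 1 by rewrite -[RHS]sth thE enormZ ger0_norm.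
by rewrite -/g [in RHS]thE scalerA mulrC cg scale1r.
Qed.

Lemma normal_of_support K U rho th x : local_defining_function K U rho -> U x ->
  closed K -> sphere th -> is_support K th x -> outward_normal rho x = th.
Proof.
move=> ld Ux clK sth sx; have [gE _] := support_grad ld Ux clK sth sx.
rewrite /outward_normal [in X in _ *: X]gE scalerA mulVf ?scale1r//.
by rewrite enorm_eq0; have [_ _ gU _] := ld; exact: gU.
Qed.

End Body.

(** * Positive curvature and uniqueness of support points *)

Section Curvature.
Context {R : realType} {d : nat}.
Implicit Types (u v x y th : 'rV[R]_d) (rho f : 'rV[R]_d -> R).
Implicit Types (K U : set 'rV[R]_d).

Lemma cvg_sumr {T I : Type} (F : set_system T) {FF : Filter F} (r : seq I)
    (P : pred I) (g : I -> T -> R) (l : I -> R) :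
  (forall i, g i z @[z --> F] --> l i) ->
  (fun z => \sum_(i <- r | P i) g i z) @ F --> \sum_(i <- r | P i) l i.
Proof.
by move=> gl; apply: cvg_big => // z; exact: add_continuous.
Qed.

Lemma cvg_prodr {T I : Type} (F : set_system T) {FF : Filter F} (r : seq I)
    (P : pred I) (g : I -> T -> R) (l : I -> R) :
  (forall i, g i z @[z --> F] --> l i) ->
  (fun z => \prod_(i <- r | P i) g i z) @ F --> \prod_(i <- r | P i) l i.
Proof.
by move=> gl; apply: cvg_big => // z; exact: mul_continuous.
Qed.

Definition hess rho x (i j : 'I_d) : R := iter_partial [:: j; i] rho x.

Definition hess_form rho x v : R := \sum_i \sum_j v 0 i * v 0 j * hess rho x i j.

Lemma is_derive_of_line f x v (l : R) :
  is_derive (0 : R) 1 (fun s : R => f (x + s *: v)) l -> is_derive x v f l.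
Proof.
move=> [df <-].
suff E : (fun h => h^-1 *: (((fun s : R => f (x + s *: v)) \o shift 0) (h *: 1) -
    f (x + 0 *: v))) = (fun h => h^-1 *: ((f \o shift x) (h *: v) - f x)).
  by apply: DeriveDef; rewrite /derivable /derive /= -E.
apply/funext => h /=; rewrite /shift [h *: 1]mulr1 scale0r !addr0.
by rewrite [x + _]addrC.
Qed.

(** Differentiating the normalizing factor of the normal only contributes a multiple of the
    gradient, which is orthogonal to the tangent vector [v]. *)
Lemma second_fundamental_formE K U rho x v : local_defining_function K U rho ->
  U x -> tangent rho x v ->
  second_fundamental_form rho x v v = (enorm (grad rho x))^-1 * hess_form rho x v.
Proof.
move=> [oU rU gU _] Ux tv.
pose N (y : 'rV[R]_d) := (enorm (grad rho y))^-1.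
pose G (i : 'I_d) (s : R) := partial i rho (x + s *: v).
have x0 : x + 0 *: v = x by rewrite scale0r addr0.
have dG i : is_derive (0 : R) 1 (G i) (\sum_j v 0 j * hess rho x i j).
  have := @smooth_on_derive_line _ _ U (partial i rho) x v 0 oU
    (smooth_on_iter [:: i] rU).
  by rewrite x0 => /(_ Ux).
have dN : exists c, is_derive (0 : R) 1 (fun s => N (x + s *: v)) c.
  pose q (s : R) := \sum_i G i s * G i s.
  have dq : is_derive (0 : R) 1 q (\sum_i (G i 0 *: (\sum_j v 0 j * hess rho x i j) + G i 0 *: (\sum_j v 0 j * hess rho x i j))).
    rewrite (_ : q = \sum_i (G i * G i)); last by apply/funext => s; rewrite /q fct_sumE.
    exact: is_derive_sum.
  have q0 : 0 < q 0.
    rewrite /q (_ : \sum_i _ = dotv (grad rho x) (grad rho x)).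
      by apply: dotv_gt0; exact: gU.
    by apply: eq_bigr => i _; rewrite !mxE /G x0.
  have ds := is_derive1_sqrt q0.
  have dsq := is_derive1_comp ds dq.
  have s0 : (Num.sqrt \o q) 0 != 0 by rewrite /= gt_eqF// sqrtr_gt0.
  have dV := is_deriveV s0 dsq.
  eexists; move: dV; congr (is_derive _ _ _ _); apply/funext => s.
  rewrite /N /q /enorm /dotv /=; congr (Num.sqrt _)^-1.
  by apply: eq_bigr => i _; rewrite !mxE.
have [c dNc] := dN.
have dcomp i : is_derive x v (fun y => inward_normal rho y 0 i)
    (- (N x * (\sum_j v 0 j * hess rho x i j) + partial i rho x * c)).
  apply: is_derive_of_line.
  have -> : (fun s : R => inward_normal rho (x + s *: v) 0 i) =
      - ((fun s => N (x + s *: v)) * G i).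
    by apply/funext => s; rewrite !mxE.
  apply: is_deriveN; apply: is_derive_eq.
  by rewrite /G x0.
have dM : derivable (inward_normal rho) x v.
  by apply/derivable_mxP => i j; rewrite (ord1 i); have [] := dcomp j.
rewrite /second_fundamental_form (derive_mx dM).
rewrite -dotvNl /dotv.
under eq_bigr => i _.
  rewrite !mxE (@derive_val _ _ _ _ _ _ _ (dcomp i)) opprK mulrDl.
  over.
rewrite big_split /= [X in _ + X](_ : _ = c * dotv (grad rho x) v); last first.
  by rewrite mulr_sumr; apply: eq_bigr => i _; rewrite mxE; ring.
rewrite tv mulr0 addr0 /hess_form mulr_sumr; apply: eq_bigr => i _.
by rewrite -/(N x) -mulrA mulr_suml; congr (_ * _); apply: eq_bigr => j _; ring.
Qed.

Lemma mvt_pos (f df : R -> R) (t : R) : 0 < t -> f 0 = 0 ->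
  (forall s, 0 <= s <= t -> is_derive s 1 f (df s)) ->
  (forall s, 0 < s <= t -> 0 < df s) -> 0 < f t.
Proof.
move=> t0 f0 fd dp.
have [||c cI] := @MVT R f df 0 t t0.
- by move=> s; rewrite in_itv/= => /andP[s0 st]; apply: fd; rewrite !ltW.
- apply: derivable_within_continuous => s; rewrite in_itv/= => sI.
  by have [] := fd s sI.
rewrite f0 !subr0 => ->; move: cI; rewrite in_itv/= => /andP[c0 ct].
by rewrite mulr_gt0// dp// c0 ltW.
Qed.

(** The vector [v = y - x] is tangent at [x]. Along the segment, [rho] has value 0 and slope 0 at
    [x] and positive second derivative nearby, so it becomes positive, although convexity keeps the
    segment in [K]. *)
Lemma support_unique K th x y : closed K -> convex_set K ->
  smooth_positively_curved_boundary K -> sphere th ->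
  is_support K th x -> is_support K th y -> x = y.
Proof.
move=> clK cK curv sth sx sy; apply/eqP/negPn/negP => xy.
have th0 : th != 0.
  by apply/eqP => h; move: sth; rewrite /sphere /= h /enorm dotv0 sqrtr0 => /eqP; rewrite eq_sym oner_eq0.
have bx := support_boundary th0 sx.
have [U [rho [Ux ld pos]]] := curv x bx.
have [oU rU gU KU] := ld.
have [gE rx] := support_grad ld Ux clK sth sx.
pose v := y - x; have v0 : v != 0 by rewrite subr_eq0 eq_sym.
have tv : tangent rho x v.
  rewrite /tangent /= gE dotvZl dotvBr.
  have -> : dotv th y = dotv th x.
    by apply/eqP; rewrite eq_le (sx.2 _ sy.1) (sy.2 _ sx.1).
  by rewrite subrr mulr0.
have hpos : 0 < hess_form rho x v.
  have := pos v tv v0; rewrite (second_fundamental_formE ld Ux tv).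
  by rewrite pmulr_rgt0// invr_gt0; apply: enorm_gt0; exact: gU.
have ch : {for x, continuous (fun z => hess_form rho z v)}.
  have FF := nbhs_filter x.
  apply: (@cvg_sumr _ _ (nbhs x) FF) => i; apply: (@cvg_sumr _ _ (nbhs x) FF) => j.
  apply: (@cvgM _ _ (nbhs x) FF); first exact: cvg_cst.
  exact: (rU [:: j; i] x Ux).1.
have [r r0 hr] : exists2 r, 0 < r & forall z, `|z - x| < r -> U z /\ 0 < hess_form rho z v.
  have h1 : \forall z \near x, U z by exact: open_nbhs_nbhs.
  have h2 : \forall z \near x, 0 < hess_form rho z v.
    move/(@cvgrPdist_lt _ _ _ (nbhs x) (nbhs_filter x)) : ch => /(_ _ hpos).
    by apply: filterS => z /=; rewrite ltr_distl => /andP[_]; rewrite ltrDr.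
  have : \forall z \near x, U z /\ 0 < hess_form rho z v.
    exact: (@filterI _ (nbhs x) (nbhs_filter x) _ _ h1 h2).
  move=> /nbhs_ballP[r /= r0 h].
  exists r; first exact: r0.
  by move=> z zx; apply: (h z); rewrite -ball_normE /= distrC.
have v1 : 0 < `|v| + 1 by rewrite ltr_wpDl.
pose t := Num.min (r / 2 / (`|v| + 1)) 1.
have t0 : 0 < t by rewrite lt_min ltr01 !divr_gt0.
have near_t (s : R) : 0 <= s <= t -> `|x + s *: v - x| < r.
  move=> /andP[s0 st]; rewrite [x + _]addrC addrK normrZ ger0_norm//.
  have : s * `|v| <= r / 2.
    apply: (@le_trans _ _ (s * (`|v| + 1))); first by rewrite ler_wpM2l// lerDl.
    by rewrite -ler_pdivlMr//; apply: le_trans st _; rewrite ge_min lexx.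
  lra.
have dphi (s : R) : 0 <= s <= t -> is_derive s 1 (fun s => rho (x + s *: v))
    (\sum_i v 0 i * partial i rho (x + s *: v)).
  by move=> /near_t/hr[Us _]; exact: (smooth_on_derive_line oU rU Us).
have dpsi (s : R) : 0 <= s <= t ->
    is_derive s 1 (fun s => \sum_i v 0 i * partial i rho (x + s *: v))
      (hess_form rho (x + s *: v) v).
  move=> /near_t/hr[Us _].
  rewrite (_ : (fun s : R => _) = \sum_i (v 0 i \*: (fun s : R => partial i rho (x + s *: v))))//; last first.
    by apply/funext => z; rewrite fct_sumE.
  rewrite /hess_form.
  apply: is_derive_sum => i.
  have := @smooth_on_derive_line _ _ U (partial i rho) x v s oU (smooth_on_iter [:: i] rU) Us.
  move=> h; apply: is_derive_eq; rewrite /GRing.scale /= mulr_sumr.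
  by apply: eq_bigr => j _; rewrite mulrA.
have : 0 < rho (x + t *: v).
  apply: (mvt_pos (f := fun s => rho (x + s *: v)) t0 _ dphi) => [|s /andP[s0 st]].
    by rewrite scale0r addr0.
  apply: (mvt_pos (f := fun s => \sum_i v 0 i * partial i rho (x + s *: v))
    (df := fun s => hess_form rho (x + s *: v) v) s0).
  - by rewrite scale0r addr0 dotv_grad; exact: tv.
  - by move=> z /andP[z0 zs]; apply: dpsi; rewrite z0 (le_trans zs).
  - move=> z /andP[z0 zs]; apply: (hr _ _).2; apply: near_t.
    by rewrite (ltW z0) (le_trans zs).
have Ut : U (x + t *: v) by apply: (hr _ _).1; apply: near_t; rewrite lexx ltW.
apply/negP; rewrite -leNgt; apply/(KU _ Ut).
apply: convex_segment cK sx.1 sy.1 _.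
by rewrite (ltW t0) ge_min lexx orbT.
Qed.

End Curvature.

(** * Regularity of the inverse Gauss map *)

Section GaussMatrix.
Context {R : realType} {d : nat}.
Implicit Types (u v x y th : 'rV[R]_d) (rho f : 'rV[R]_d -> R).
Implicit Types (K U : set 'rV[R]_d).

Definition taylor_rem f x v : R :=
  f (x + v) - f x - \sum_l v 0 l * partial l f x.

(* The Hessian projected to the orthogonal complement of [th], plus [th grad^T]:
   it is invertible as soon as the Hessian is definite on tangent vectors. *)
Definition gauss_mx rho th x : 'M[R]_d := \matrix_(i, j)
  (hess rho x i j - th 0 i * (\sum_l th 0 l * hess rho x l j)
   + th 0 i * partial j rho x).

Definition hess_mul rho x v : 'rV[R]_d := \row_i \sum_j v 0 j * hess rho x i j.

Lemma gauss_mx_mul rho th x v : gauss_mx rho th x *m v^T =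
  (hess_mul rho x v - dotv th (hess_mul rho x v) *: th
   + dotv (grad rho x) v *: th)^T.
Proof.
apply/colP => i; rewrite mxE; under eq_bigr do rewrite !mxE.
rewrite 7!mxE /dotv; under [X in _ = _ - X * _ + _]eq_bigr do rewrite mxE mulr_sumr.
rewrite exchange_big /= !mulr_suml -sumrB -big_split /=.
apply: eq_bigr => j _; rewrite mulrDl mulrBl !mulr_suml mxE mulr_sumr mulr_suml.
rewrite [hess _ _ _ _ * _]mulrC; congr (_ - _ + _).
  by apply: eq_bigr => l _; ring.
by ring.
Qed.

(** Let [v] be in the kernel. Pairing the equation with [th] leaves [<grad, v> = 0], so [v] is
    tangent; pairing it with [v] then makes the Hessian form vanish, which positivity excludes. *)
Lemma gauss_mx_det rho th x (mu : R) : sphere th -> mu != 0 ->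
  grad rho x = mu *: th ->
  (forall v, tangent rho x v -> v != 0 -> 0 < hess_form rho x v) ->
  \det (gauss_mx rho th x) != 0.
Proof.
move=> /enorm1 sth mu0 gE pos; apply/negP; rewrite -det_tr => /det0P[v v0 vA].
have : gauss_mx rho th x *m v^T = 0.
  by have /(congr1 trmx) := vA; rewrite trmx_mul trmxK trmx0.
rewrite gauss_mx_mul => /(congr1 trmx); rewrite trmxK trmx0.
set Hv := hess_mul rho x v => E.
have tv : tangent rho x v.
  have /(congr1 (dotv th)) := E; rewrite dotv0 dotvDr dotvBr !dotvZr sth !mulr1.
  by rewrite subrr add0r.
have thv : dotv th v = 0.
  by move: tv; rewrite /tangent /= gE dotvZl => /eqP; rewrite mulf_eq0 (negbTE mu0) => /eqP.
have := pos v tv v0.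
have /(congr1 (dotv v)) := E; rewrite dotv0 dotvDr dotvBr !dotvZr [dotv v th]dotvC thv.
rewrite !mulr0 subr0 addr0 => hv.
rewrite (_ : hess_form _ _ _ = dotv v Hv); first by rewrite hv ltxx.
by apply: eq_bigr => i _; rewrite mxE mulr_sumr; apply: eq_bigr => j _; rewrite mulrA.
Qed.

(** With [mu' = <th', grad rho (x + v)>] and [P] the projection orthogonal to [th], this is
    [mu' P(th' - th) - P r - r0 th]. Expanding the gradient gives [Hess v = mu' th' - mu th - r],
    where [P] removes the unknown [mu]; expanding [rho] between two of its zeros gives
    [<grad, v> = - r0]. *)
Definition gauss_rhs rho th th' x v : 'rV[R]_d :=
  let r0 := taylor_rem rho x v in
  let r := \row_i taylor_rem (partial i rho) x v in
  dotv th' (grad rho (x + v)) *: ((th' - th) - dotv th (th' - th) *: th)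
  - r + (dotv th r - r0) *: th.

Lemma gauss_identity rho th th' x v (mu mu' : R) : sphere th -> sphere th' ->
  rho x = 0 -> rho (x + v) = 0 ->
  grad rho x = mu *: th -> grad rho (x + v) = mu' *: th' ->
  gauss_mx rho th x *m v^T = (gauss_rhs rho th th' x v)^T.
Proof.
move=> /enorm1 sth /enorm1 sth' rx rxv gE gE'.
rewrite gauss_mx_mul; congr trmx.
pose r := \row_i taylor_rem (partial i rho) x v.
have -> : hess_mul rho x v = mu' *: th' - mu *: th - r.
  rewrite -gE -gE'; apply/rowP => l; rewrite [LHS]mxE.
  by rewrite /grad !mxE /taylor_rem opprB addrC subrK.
have -> : dotv (grad rho x) v = - taylor_rem rho x v.
  by rewrite /taylor_rem rx rxv dotv_grad subrr sub0r opprK.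
rewrite /gauss_rhs -/r gE' !dotvBr !dotvZr sth sth' !mulr1.
move: (r) (taylor_rem rho x v) (dotv th r) (dotv th th') => r1 t0 t1 t2.
by apply/rowP => l; rewrite !mxE; ring.
Qed.

(** Cramer's rule: determinant and cofactors are polynomials in the entries, so they stay within the
    symbol calculus. *)
Lemma gauss_solve rho th th' x v : 
  gauss_mx rho th x *m v^T = (gauss_rhs rho th th' x v)^T ->
  forall i, \det (gauss_mx rho th x) * v 0 i =
    \sum_j (\adj (gauss_mx rho th x)) i j * gauss_rhs rho th th' x v 0 j.
Proof.
move=> E i; have /(congr1 (fun z => (\adj (gauss_mx rho th x) *m z) i 0)) := E.
rewrite mulmxA mul_adj_mx mul_scalar_mx !mxE => ->.
by apply: eq_bigr => j _; rewrite !mxE.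
Qed.

End GaussMatrix.

Lemma ex2_ex {T : Type} (P Q : T -> Prop) :
  (exists2 x, P x & Q x) -> exists x, P x /\ Q x.
Proof. by case=> x Px Qx; exists x. Qed.

(** * Bounds for Taylor remainders *)

Section Remainder.
Context {R : realType} {d : nat}.
Variables (U : set 'rV[R]_d) (f : 'rV[R]_d -> R) (x0 : 'rV[R]_d) (r : R).
Hypotheses (oU : open U) (fU : smooth_on U f).
Hypothesis (BU : forall x, `|x - x0| <= r -> U x).
Hypothesis (fB : bounded_partials f x0 r).

Lemma bounded_partials_uniform (T : finType) (S : T -> seq 'I_d) :
  exists2 C, 0 <= C & forall t x, `|x - x0| <= r -> `|iter_partial (S t) f x| <= C.
Proof.
have [C hC] := choice (fun t => fB (S t)).
exists (\sum_t `|C t|) => [|t x xr]; first exact: sumr_ge0.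
apply: le_trans (hC t x xr) _; apply: le_trans (ler_norm _) _.
by rewrite (bigD1 t)//= lerDl sumr_ge0.
Qed.

Lemma norm_coord_sum (v : 'rV[R]_d) (a : 'I_d -> R) (C : R) :
  (forall l, `|a l| <= C) -> `|\sum_l v 0 l * a l| <= d%:R * C * `|v|.
Proof.
move=> ha; apply: le_trans (ler_norm_sum _ _ _) _.
apply: (@le_trans _ _ (\sum_(l < d) C * `|v|)).
  by apply: ler_sum => l _; rewrite normrM mulrC ler_pM// coord_le.
by rewrite sumr_const card_ord -[_ *+ d]mulr_natl mulrA.
Qed.

Lemma partial_lipschitz s : exists2 C, 0 <= C & forall x y,
  `|x - x0| <= r -> `|y - x0| <= r ->
  `|iter_partial s f y - iter_partial s f x| <= C * `|y - x|.
Proof.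
have [C C0 hC] := bounded_partials_uniform (fun l : 'I_d => l :: s).
exists (d%:R * C) => [|x y xr yr]; first exact: mulr_ge0.
have := @mvt_bound R (fun t => iter_partial s f (x + t *: (y - x)))
  (fun t => \sum_l (y - x) 0 l * iter_partial (l :: s) f (x + t *: (y - x))).
move=> /(_ (d%:R * C * `|y - x|)).
rewrite scale1r scale0r addr0 [x + _]addrC subrK; apply => t t01.
  apply: (smooth_on_derive_line oU (smooth_on_iter s fU)).
  by apply: BU; exact: norm_segment.
by apply: norm_coord_sum => l; apply: hC; exact: norm_segment.
Qed.

Lemma taylor_rem_bound s : exists2 C, 0 <= C & forall x v,
  `|x - x0| <= r -> `|x + v - x0| <= r ->
  `|taylor_rem (iter_partial s f) x v| <= C * `|v| ^+ 2.
Proof.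
have [C hC] := choice (fun l : 'I_d => ex2_ex (partial_lipschitz (l :: s))).
pose M := \sum_l `|C l|.
have M0 : 0 <= M by exact: sumr_ge0.
have CM l : C l <= M.
  by apply: le_trans (ler_norm _) _; rewrite /M (bigD1 l)//= lerDl sumr_ge0.
exists (d%:R * M) => [|x v xr yr]; first exact: mulr_ge0.
have seg (t : R) : 0 <= t <= 1 -> `|x + t *: v - x0| <= r.
  move=> t01; have := norm_segment t01 xr yr.
  by rewrite [x + v]addrC addrK.
pose g (t : R) := iter_partial s f (x + t *: v) - t * \sum_l v 0 l * iter_partial (l :: s) f x.
pose dg (t : R) := \sum_l v 0 l * (iter_partial (l :: s) f (x + t *: v) - iter_partial (l :: s) f x).
have := @mvt_bound R g dg (d%:R * M * `|v| ^+ 2).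
have -> : g 1 - g 0 = taylor_rem (iter_partial s f) x v.
  by rewrite /g scale1r scale0r addr0 mul1r mul0r subr0 addrAC.
apply => t t01.
  have := smooth_on_derive_line oU (smooth_on_iter s fU) (BU (seg t t01)).
  move=> h; rewrite /g; apply: is_derive_eq.
  rewrite scaler0 add0r [_%:A]mulr1 /dg -sumrB.
  by apply: eq_bigr => l _; rewrite mulrBr.
rewrite expr2 mulrA -[d%:R * M * _]mulrA; apply: norm_coord_sum => l.
have [Cl0 h] := hC l; apply: le_trans (h _ _ xr (seg t t01)) _.
rewrite addrC addKr normrZ; case/andP: t01 => t0 t1; rewrite ger0_norm//.
by apply: ler_pM => //; rewrite ?mulr_ge0// ler_piMl.
Qed.

End Remainder.

Lemma cvg_det (R : realType) (n : nat) {T : Type} (F : set_system T)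
    {FF : Filter F} (A : T -> 'M[R]_n) (B : 'M[R]_n) :
  (forall i j, A z i j @[z --> F] --> B i j) -> \det (A z) @[z --> F] --> \det B.
Proof.
move=> AB; apply: cvg_sumr => s; apply: (@cvgM _ _ F FF); first exact: cvg_cst.
by apply: cvg_prodr => i; exact: AB.
Qed.

Lemma det_bound (R : realType) (n : nat) (M : R) : exists2 C, 0 <= C &
  forall A : 'M[R]_n, (forall i j, `|A i j| <= M) -> `|\det A| <= C.
Proof.
exists (\sum_(s : 'S_n) \prod_(i < n) `|M|) => [|A AM].
  by apply: sumr_ge0 => s _; exact: prodr_ge0.
apply: le_trans (ler_norm_sum _ _ _) _; apply: ler_sum => s _.
rewrite normrM normrX normrN1 expr1n mul1r normr_prod.
by apply: ler_prod => i _; rewrite normr_ge0 (le_trans (AM _ _))// ler_norm.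
Qed.

Lemma adj_bound (R : realType) (n : nat) (M : R) : exists2 C, 0 <= C &
  forall A : 'M[R]_n, (forall i j, `|A i j| <= M) -> forall i j, `|(\adj A) i j| <= C.
Proof.
have [C C0 hC] := det_bound n.-1 M; exists C => // A AM i j.
rewrite mxE /cofactor normrM normrX normrN1 expr1n mul1r; apply: hC => i' j'.
by rewrite !mxE.
Qed.

(** * Continuity of the support map *)

Section SupportMap.
Context {R : realType} {d : nat}.
Variables (K : set 'rV[R]_d) (X : 'rV[R]_d -> 'rV[R]_d).
Hypotheses (cK : compact K) (vK : convex_set K).
Hypothesis (curv : smooth_positively_curved_boundary K).
Hypothesis (hX : forall th, sphere th -> is_support K th (X th)).

Let clK : closed K.
Proof. exact: (compact_closed (@norm_hausdorff _ _) cK). Qed.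

Lemma compact_norm_bound : exists2 M : R, 0 <= M & forall y, K y -> `|y| <= M.
Proof.
have [M [_ hM]] := compact_bounded cK; exists (`|M| + 1) => [|y Ky].
  by rewrite addr_ge0.
by apply: hM => //; rewrite (le_lt_trans (ler_norm M))// ltrDl.
Qed.

(** Outside a ball around [X th0], uniqueness of the support point keeps the maximum of [dotv th0]
    on [K] strictly below its value at [X th0]. A direction close to [th0] cannot make up for that
    gap. *)
Lemma support_map_continuous th0 (eps : R) : sphere th0 -> 0 < eps ->
  exists2 dl, 0 < dl & forall th, sphere th -> `|th - th0| < dl ->
    `|X th - X th0| < eps.
Proof.
move=> s0 eps0; pose x0 := X th0.
pose K' := K `&` ~` (ball x0 eps).
have cK' : compact K'.
  apply: (@subclosed_compact _ _ K) => //; last by move=> y [].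
  by apply: closedI => //; apply: open_closedC; exact: ball_open.
have [M M0 hM] := compact_norm_bound.
have inK' th : sphere th -> ~ `|X th - X th0| < eps -> K' (X th).
  move=> sth h; split; first exact: (hX sth).1.
  by rewrite -ball_normE /= distrC.
have [K'0|nK'] := pselect (K' !=set0); last first.
  exists 1 => // th sth _; apply: contrapT => /(inK' _ sth) h.
  by apply: nK'; exists (X th).
have cf : {within K', continuous (dotv th0)}.
  by apply: continuous_subspaceT; exact: dotv_continuous.
have [c /set_mem [Kc cx] hc] := EVT_max_rV K'0 cK' cf.
have eta0 : 0 < dotv th0 x0 - dotv th0 c.
  rewrite subr_gt0 lt_neqAle ((hX s0).2 _ Kc) andbT; apply/negP => /eqP E.
  apply: cx; suff -> : c = x0 by exact: ballxx.
  apply: (support_unique clK vK curv s0 _ (hX s0)); split=> // y Ky.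
  by rewrite E; exact: (hX s0).2.
set eta := _ - _ in eta0.
have D0 : 0 < 2 * d%:R * M + 1 by rewrite ltr_wpDl// !mulr_ge0.
(* Replacing [th0] by [th] moves each value of [dotv] on [K] by at most [d * |th - th0| * M]; two
   points are compared, whence the factor 2. *)
exists (eta / (2 * d%:R * M + 1)) => [|th sth]; first exact: divr_gt0.
rewrite ltr_pdivlMr// => hth; apply: contrapT => /(inK' _ sth) hy.
have h1 : dotv th0 (X th) <= dotv th0 c by apply: hc; exact: mem_set.
have h2 : dotv th x0 <= dotv th (X th) by apply: (hX sth).2; exact: (hX s0).1.
have b y : K y -> `|dotv (th - th0) y| <= d%:R * (`|th - th0| * M).
  move=> Ky; apply: le_trans (dotv_le _ _) _.
  by rewrite ler_wpM2l// ler_wpM2l// hM.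
have := b _ (hX s0).1; have := b _ (hX sth).1.
rewrite !dotvBl !ler_norml => /andP[b1 b2] /andP[b3 b4].
have : 0 <= `|th - th0| by [].
move: hth; rewrite mulrDr mulr1 => hth.
have E : `|th - th0| * (2 * d%:R * M) = 2 * (d%:R * (`|th - th0| * M)) by ring.
rewrite E in hth; rewrite /eta /x0 in hth h2 *; lra.
Qed.

(** The bound [c] on the determinant is uniform over the chart and later serves as ellipticity. The
    multiplier [mu] may stay anonymous because [gauss_identity] eliminates it. *)
Definition support_chart th0 (U : set 'rV[R]_d) (rho : 'rV[R]_d -> R) (r c dl : R) :=
  [/\ open U, smooth_on U rho, forall x, `|x - X th0| <= r -> U x,
      bounded_partials rho (X th0) r &
      [/\ 0 < r, 0 < c, 0 < dl & forall th, sphere th -> `|th - th0| < dl ->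
        [/\ `|X th - X th0| <= r, rho (X th) = 0,
            exists mu, grad rho (X th) = mu *: th &
            c <= `|\det (gauss_mx rho th (X th))|]]].

Lemma support_chart_exists th0 : sphere th0 ->
  exists U rho r c dl, support_chart th0 U rho r c dl.
Proof.
move=> s0; have th00 : th0 != 0.
  by apply/eqP => h; move: s0; rewrite /sphere /= h /enorm dotv0 sqrtr0 => /eqP; rewrite eq_sym oner_eq0.
have bx := support_boundary th00 (hX s0).
have [U [rho [Ux ld pos]]] := curv bx; have [oU rU gU KU] := ld.
have [r [r0 BU fB]] := smooth_on_bounded oU rU Ux.
have [gE _] := support_grad ld Ux clK s0 (hX s0).
have g0 : grad rho (X th0) != 0 by exact: gU.
have det0 : \det (gauss_mx rho th0 (X th0)) != 0.
  apply: (gauss_mx_det s0 _ gE); first by rewrite enorm_eq0.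
  move=> v tv v0; have := pos v tv v0; rewrite (second_fundamental_formE ld Ux tv).
  by rewrite pmulr_rgt0// invr_gt0 enorm_gt0.
pose c := `|\det (gauss_mx rho th0 (X th0))| / 2.
have c0 : 0 < c by rewrite divr_gt0// normr_gt0.
pose G := within sphere (nbhs th0).
have FG : Filter G by apply: within_filter; exact: nbhs_filter.
have toG (P : set 'rV[R]_d) : (exists2 dl, 0 < dl & forall th, sphere th ->
    `|th - th0| < dl -> P th) -> \forall th \near G, P th.
  move=> [dl dl0 h]; apply/nbhs_ballP; exists dl => //= th.
  by rewrite -ball_normE /= distrC => hth sth; exact: h.
have ofG (P : set 'rV[R]_d) : (\forall th \near G, P th) ->
    exists2 dl, 0 < dl & forall th, sphere th -> `|th - th0| < dl -> P th.
  move=> /nbhs_ballP[dl /= dl0 h]; exists dl => // th sth hth; apply: h => //.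
  by rewrite -ball_normE /= distrC.
have thG i : (fun z : 'rV[R]_d => z 0 i) @ G --> th0 0 i.
  apply/(@cvgrPdist_lt _ _ _ G FG) => eps eps0; apply: toG; exists eps => // z _.
  by apply: le_lt_trans; have := coord_le (th0 - z) i; rewrite distrC !mxE.
have XG s : (fun z => iter_partial s rho (X z)) @ G --> iter_partial s rho (X th0).
  apply/(@cvgrPdist_lt _ _ _ G FG) => eps eps0; apply: toG.
  have /(@cvgrPdist_lt _ _ _ (nbhs (X th0)) (nbhs_filter _)) := (rU s _ Ux).1.
  move=> /(_ _ eps0) /nbhs_ballP[e /= e0 he].
  have [dl dl0 h] := support_map_continuous s0 e0; exists dl => // z sz hz.
  by apply: he; rewrite -ball_normE /= distrC; exact: h.
have dG : (fun z => \det (gauss_mx rho z (X z))) @ G --> \det (gauss_mx rho th0 (X th0)).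
  apply: cvg_det => i j; under eq_cvg do rewrite mxE.
  rewrite mxE; apply: (@cvgD _ _ _ G FG); last first.
    by apply: (@cvgM _ _ G FG); [exact: thG|exact: (XG [:: j])].
  apply: (@cvgB _ _ _ G FG); first exact: (XG [:: j; i]).
  apply: (@cvgM _ _ G FG); first exact: thG.
  apply: (@cvg_sumr _ _ _ G FG) => l.
  by apply: (@cvgM _ _ G FG); [exact: thG|exact: (XG [:: j; l])].
have [dl1 dl10 h1] := support_map_continuous s0 r0.
have [dl2 dl20 h2] : exists2 dl, 0 < dl & forall th, sphere th ->
    `|th - th0| < dl -> c <= `|\det (gauss_mx rho th (X th))|.
  apply: ofG; move/(@cvgrPdist_lt _ _ _ G FG) : dG => /(_ _ c0).
  apply: filterS => z /ltW hz; rewrite /c in hz *; move: hz.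
  move: (\det (gauss_mx rho th0 (X th0))) (\det (gauss_mx rho z (X z))) => a b hz.
  by have := ler_normD (a - b) b; rewrite subrK; lra.
exists U, rho, r, c, (Num.min dl1 dl2); split=> //; split=> //.
  by rewrite lt_min dl10.
move=> th sth; rewrite lt_min => /andP[hth1 hth2].
have Xr : `|X th - X th0| <= r by apply/ltW/h1.
have [gEth rth] := support_grad ld (BU _ Xr) clK sth (hX sth).
by split=> //; [exists (enorm (grad rho (X th)))|exact: h2].
Qed.

End SupportMap.

(** * Local Lipschitz bound for the support map *)

Section Lipschitz.
Context {R : realType} {d : nat}.
Variables (K : set 'rV[R]_d) (X : 'rV[R]_d -> 'rV[R]_d).
Hypotheses (cK : compact K) (vK : convex_set K).
Hypothesis (curv : smooth_positively_curved_boundary K).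
Hypothesis (hX : forall th, sphere th -> is_support K th (X th)).

Lemma gauss_rhs_bound (U : set 'rV[R]_d) rho (x0 : 'rV[R]_d) (r : R) : open U -> smooth_on U rho ->
  (forall x, `|x - x0| <= r -> U x) -> bounded_partials rho x0 r ->
  exists A B, [/\ 0 <= A, 0 <= B & forall th th' x v, sphere th -> sphere th' ->
    `|x - x0| <= r -> `|x + v - x0| <= r -> forall j,
    `|gauss_rhs rho th th' x v 0 j| <= A * `|th' - th| + B * `|v| ^+ 2].
Proof.
move=> oU rU BU fB.
have [Cp Cp0 hCp] := bounded_partials_uniform fB (fun i : 'I_d => [:: i]).
have [C0 C00 hC0] := taylor_rem_bound oU rU BU fB [::].
have [C1 hC1] := choice (fun l : 'I_d => ex2_ex (taylor_rem_bound oU rU BU fB [:: l])).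
pose Cr := \sum_l `|C1 l|.
have Cr0 : 0 <= Cr by exact: sumr_ge0.
have C1r l : C1 l <= Cr.
  by apply: le_trans (ler_norm _) _; rewrite /Cr (bigD1 l)//= lerDl sumr_ge0.
exists (d%:R * Cp * (1 + d%:R)), (Cr + (d%:R * Cr + C0)); split.
- by rewrite !mulr_ge0// addr_ge0.
- by rewrite !addr_ge0// mulr_ge0.
move=> th th' x v sth sth' xr xvr j.
pose rr := \row_i taylor_rem (partial i rho) x v.
have nr : `|rr| <= Cr * `|v| ^+ 2.
  apply: rV_norm_le => [|i]; first by rewrite mulr_ge0// sqr_ge0.
  rewrite mxE; have [_ h] := hC1 i; apply: le_trans (h _ _ xr xvr) _.
  by rewrite ler_wpM2r// sqr_ge0.
have nr0 : `|taylor_rem rho x v| <= C0 * `|v| ^+ 2 by exact: hC0.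
have nmu : `|dotv th' (grad rho (x + v))| <= d%:R * Cp.
  apply: le_trans (dotv_le _ _) _; rewrite ler_wpM2l//.
  rewrite -[leRHS]mul1r ler_pM ?sphere_norm//.
  by apply: rV_norm_le => // i; rewrite mxE; exact: hCp.
have ths := sphere_norm sth.
have ndr : `|dotv th rr| <= d%:R * (Cr * `|v| ^+ 2).
  apply: le_trans (dotv_le _ _) _; rewrite ler_wpM2l//.
  by rewrite -[leRHS]mul1r ler_pM.
have nd : `|dotv th (th' - th)| <= d%:R * `|th' - th|.
  apply: le_trans (dotv_le _ _) _; rewrite ler_wpM2l//.
  by rewrite -[leRHS]mul1r ler_pM.
apply: le_trans (coord_le _ _) _; rewrite /gauss_rhs -/rr.
apply: le_trans (ler_normD _ _) _; rewrite [leRHS](_ : _ =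
  (d%:R * Cp * ((1 + d%:R) * `|th' - th|) + Cr * `|v| ^+ 2) +
  (d%:R * (Cr * `|v| ^+ 2) + C0 * `|v| ^+ 2)); last by ring.
apply: lerD; last first.
  rewrite normrZ -[leRHS]mulr1 ler_pM//.
  by apply: le_trans (ler_normB _ _) _; exact: lerD.
apply: le_trans (ler_normB _ _) _; apply: lerD => //.
rewrite normrZ ler_pM//; apply: le_trans (ler_normB _ _) _.
rewrite mulrDl mul1r lerD2l normrZ -[leRHS]mulr1; exact: ler_pM.
Qed.

Lemma gauss_mx_bound (U : set 'rV[R]_d) rho (x0 : 'rV[R]_d) (r : R) :
  bounded_partials rho x0 r -> exists2 M, 0 <= M & forall th x, sphere th ->
    `|x - x0| <= r -> forall i j, `|gauss_mx rho th x i j| <= M.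
Proof.
move=> fB.
have [Cp Cp0 hCp] := bounded_partials_uniform fB (fun i : 'I_d => [:: i]).
have [Ch Ch0 hCh] := bounded_partials_uniform fB (fun p : 'I_d * 'I_d => [:: p.2; p.1]).
exists (Ch + d%:R * 1 * Ch + Cp) => [|th x sth xr i j].
  by rewrite !addr_ge0// !mulr_ge0.
have ths l : `|th 0 l| <= 1 by apply: le_trans (coord_le _ _) (sphere_norm sth).
rewrite mxE; apply: le_trans (ler_normD _ _) _; apply: lerD; last first.
  by rewrite normrM -[leRHS]mul1r ler_pM//; exact: hCp.
apply: le_trans (ler_normB _ _) _; apply: lerD; first exact: (hCh (i, j)).
rewrite normrM -[leRHS]mul1r ler_pM//.
rewrite mulr1; apply: le_trans (norm_coord_sum (a := fun l => hess rho x l j) (C := Ch) th _) _.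
  by move=> l; exact: (hCh (l, j)).
by rewrite -[leRHS]mulr1 ler_wpM2l ?mulr_ge0// sphere_norm.
Qed.

(** For [v = X th' - X th], Cramer's rule gives [c |v| <= d Ca (A |th' - th| + B |v|^2)].
    Continuity, already known, makes [|v|] so small that the quadratic term is absorbed by the left
    side. *)
Lemma support_map_lipschitz_loc th0 : sphere th0 ->
  exists C dl, [/\ 0 <= C, 0 < dl & forall th th', sphere th -> sphere th' ->
    `|th - th0| < dl -> `|th' - th0| < dl -> `|X th' - X th| <= C * `|th' - th|].
Proof.
move=> s0; have [U [rho [r [c [dl]]]]] := support_chart_exists cK vK curv hX s0.
move=> [oU rU BU fB [r0 c0 dl0 hdl]].
have [A [B [A0 B0 hAB]]] := gauss_rhs_bound oU rU BU fB.
have [M M0 hM] := gauss_mx_bound U fB.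
have [Ca Ca0 hCa] := adj_bound d M.
(* Chosen so that [|v| <= eta] implies [d Ca B |v|^2 <= (c / 2) |v|]; the added 1 keeps the
   denominator positive. *)
pose eta := c / (2 * (d%:R * Ca * B + 1)).
have DB : 0 < d%:R * Ca * B + 1 by rewrite ltr_wpDl// !mulr_ge0.
have eta0 : 0 < eta by rewrite divr_gt0// mulr_gt0.
have [dl2 dl20 h2] := support_map_continuous cK vK curv hX s0 (divr_gt0 eta0 (ltr0n _ 2)).
exists (2 / c * (d%:R * Ca * A)), (Num.min dl dl2); split.
- by rewrite !mulr_ge0// invr_ge0 ltW.
- by rewrite lt_min dl0.
move=> th th' sth sth'; rewrite !lt_min => /andP[t1 t2] /andP[t3 t4].
have [Xr rX [mu gE] cdet] := hdl th sth t1.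
have [Xr' rX' [mu' gE'] cdet'] := hdl th' sth' t3.
set v := X th' - X th; set D := `|th' - th|.
have xv : X th + v = X th' by rewrite /v addrC subrK.
have veta : `|v| <= eta.
  have := h2 th sth t2; have := h2 th' sth' t4.
  clear rX rX' gE gE' cdet cdet'.
  have := ler_distD (X th0) (X th') (X th); rewrite -/v [`|X th0 - _|]distrC; lra.
have E := gauss_identity (v := v) sth sth' rX.
rewrite xv in E; have {}E := E _ _ rX' gE gE'.
have hv i : c * `|v 0 i| <= d%:R * Ca * (A * D + B * `|v| ^+ 2).
  apply: (@le_trans _ _ `|\det (gauss_mx rho th (X th)) * v 0 i|).
    by rewrite normrM; exact: (ler_wpM2r (normr_ge0 _) cdet).
  rewrite (gauss_solve E); apply: le_trans (ler_norm_sum _ _ _) _.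
  apply: (@le_trans _ _ (\sum_(j < d) Ca * (A * D + B * `|v| ^+ 2))).
    apply: ler_sum => j _; rewrite normrM ler_pM//.
      by apply: hCa; exact: hM.
    by apply: hAB => //; rewrite xv.
  by rewrite sumr_const card_ord -[_ *+ d]mulr_natl mulrA.
have cv : c * `|v| <= d%:R * Ca * (A * D + B * `|v| ^+ 2).
  rewrite -ler_pdivlMl//; apply: rV_norm_le => [|i].
    rewrite mulr_ge0 ?invr_ge0 ?(ltW c0)// mulr_ge0 ?mulr_ge0//.
    by apply: addr_ge0; apply: mulr_ge0; rewrite ?sqr_ge0 ?normr_ge0.
  by rewrite ler_pdivlMl.
have q : d%:R * Ca * (B * `|v| ^+ 2) <= c / 2 * `|v|.
  rewrite expr2 !mulrA ler_wpM2r//.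
  apply: (@le_trans _ _ ((d%:R * Ca * B + 1) * eta)).
    by apply: ler_pM => //; rewrite ?mulr_ge0// lerDl.
  by rewrite /eta le_eqVlt; apply/orP; left; apply/eqP; field; rewrite gt_eqF.
rewrite mulrDr in cv; move: cv q; rewrite -/D.
rewrite (_ : 2 / c * (d%:R * Ca * A) * D = (2 * (d%:R * Ca * (A * D))) / c); last by ring.
rewrite ler_pdivlMr//; lra.
Qed.

End Lipschitz.

(** * Determinants and Taylor remainders as symbols *)

Section SymbolMatrix.
Context {R : realType} {L : zmodType} {J : Type}.
Variables (e : J -> L) (w : L -> R) (F : set_system L).
Hypothesis hS : symbol_setting e w F.
#[local] Instance symbol_filter10 : Filter F. Proof. by case: hS. Qed.

Lemma sym_det {I : Type} n d (D : set I) (A : I -> L -> 'M[R]_d) :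
  (forall i j, sym e w F n 0 D (fun t k => A t k i j)) ->
  sym e w F n 0 D (fun t k => \det (A t k)).
Proof.
move=> hA; apply: (sym_sum hS) => s _.
apply: (sym_scale hS (c := fun _ => (-1) ^+ s)).
  by exists 1 => i _; rewrite normrX normrN1 expr1n.
by apply: (sym_prod hS) => i _; exact: hA.
Qed.

Lemma sym_adj {I : Type} n d (D : set I) (A : I -> L -> 'M[R]_d) :
  (forall i j, sym e w F n 0 D (fun t k => A t k i j)) ->
  forall i j, sym e w F n 0 D (fun t k => (\adj (A t k)) i j).
Proof.
move=> hA i j.
have h : sym e w F n 0 D (fun t k => \det (row' j (col' i (A t k)))).
  apply: sym_det => a b; apply: (sym_ext hS _ (hA (lift j a) (lift i b))).
  by apply: nearW => k t _; rewrite !mxE.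
have := sym_scale hS (c := fun=> (-1) ^+ (j + i)) _ h.
move=> /(_ (ex_intro _ 1 (fun i' _ => _))) => /(_ _)/wrap[].
  by rewrite normrX normrN1 expr1n.
by move=> {}h; apply: (sym_ext hS _ h); apply: nearW => k t _; rewrite mxE.
Qed.

(** Each factor alone has order -1 with [n] differences only. In
    [dif (a b) = dif a * shf b + a * dif b] both terms are products of two factors of order -1, so
    the product has order -1 with one difference more. *)
Lemma sym_mul_gain {I : Type} n (D : set I) (a b : I -> L -> R) :
  sym e w F n.+1 0 D a -> sym e w F n (-1) D a ->
  sym e w F n.+1 0 D b -> sym e w F n (-1) D b ->
  sym e w F n.+1 (-1) D (fun i k => a i k * b i k).
Proof.
move=> a0 a1 b0 b1; split.
  apply: (bnd_le hS _ (bnd_mul hS (sym_bnd hS a1) (sym_bnd hS b1))).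
  by [].
move=> j.
have h1 := sym_mul hS (a0.2 j) (sym_shf hS j b1).
have h2 := sym_mul hS a1 (b0.2 j).
apply: (sym_ext hS _ (sym_add hS h1 h2)); apply: nearW => k i Di.
by rewrite /dif /shf; ring.
Qed.

Section Chart.
Context {d : nat}.
Variables (U : set 'rV[R]_d) (f : 'rV[R]_d -> R) (x0 : 'rV[R]_d) (r : R).
Hypotheses (oU : open U) (fU : smooth_on U f).
Hypothesis (BU : forall x, `|x - x0| <= r -> U x).
Hypothesis (fB : bounded_partials f x0 r).
Variables (x : L -> 'rV[R]_d) (n : nat) (j : J).
Hypothesis hr : \forall k \near F, `|x k - x0| <= r.
Hypothesis hx : sym_vec e w F n.+1 0 [set: unit] (fun=> x).

Let v k := x (k + e j) - x k.

Let sym_v l : sym e w F n.+1 0 [set: unit] (fun _ k => v k 0 l).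
Proof.
apply: (sym_ext hS _ (sym_dif hS j (hx l))).
by apply: nearW => k i _; rewrite /dif /v !mxE.
Qed.

Let sym_v1 l : sym e w F n (-1) [set: unit] (fun _ k => v k 0 l).
Proof.
apply: (sym_ext hS _ ((hx l).2 j)).
by apply: nearW => k i _; rewrite /dif /v !mxE.
Qed.

Let D01 : set R := [set s | 0 <= s <= 1].

Let near_seg : \forall k \near F, forall s, D01 s -> `|x k + s *: v k - x0| <= r.
Proof.
have [_ _ hF] := hS; apply: filterS2 hr (hF j _ hr) => k h1 h2 s Ds.
by apply: norm_segment.
Qed.

Let sym_seg s : sym e w F n.+1 0 D01 (fun t k => iter_partial s f (x k + t *: v k)).
Proof.
apply: (sym_smooth_comp hS oU fU BU fB (z := fun t k => x k + t *: v k)) => // l.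
have h1 : sym e w F n.+1 0 D01 (fun _ k => x k 0 l).
  by apply: (sym_comp_param hS (f := fun _ : R => tt) _ (hx l)).
have h2 : sym e w F n.+1 0 D01 (fun _ k => v k 0 l).
  by apply: (sym_comp_param hS (f := fun _ : R => tt) _ (sym_v l)).
have h3 : sym e w F n.+1 0 D01 (fun t k => t * v k 0 l).
  apply: (sym_scale hS (c := id)) h2.
  by exists 1 => t /andP[t0 t1]; rewrite ger0_norm.
apply: (sym_ext hS _ (sym_add hS h1 h3)).
by apply: nearW => k t _; rewrite !mxE.
Qed.

(** The step [v] is a difference of [x], hence of order -1 with [n] differences only. Two uses of
    [sym_mvt] express the remainder through products [v_l v_m] times partials of [f], and
    [sym_mul_gain] recovers the missing difference. *)
Lemma sym_taylor_rem s : sym e w F n.+1 (-1) [set: unit]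
  (fun _ k => taylor_rem (iter_partial s f) (x k) (v k)).
Proof.
pose D1 := [set p : unit * R | setT p.1 /\ 0 <= p.2 <= 1].
pose D2 := [set p : (unit * R) * R | D1 p.1 /\ 0 <= p.2 <= 1].
pose g l t k := iter_partial (l :: s) f (x k + t *: v k).
(* Inner use of the mean value theorem: the increment of the partial in direction [l] up to time
   [t], rescaled to the unit interval by [u * t], produces the second factor [v_m]. *)
have Q l : sym e w F n.+1 (-1) D1 (fun p k => v k 0 l * (g l p.2 k - g l 0 k)).
  have h m : sym e w F n.+1 (-1) D2
      (fun p k => p.1.2 * (v k 0 l * v k 0 m *
         iter_partial (m :: l :: s) f (x k + (p.2 * p.1.2) *: v k))).
    apply: (sym_scale hS (c := fun p => p.1.2)).
      by exists 1 => -[[[] t] u] [[_ /= /andP[t0 t1]] _]; rewrite ger0_norm.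
    have h1 := sym_mul_gain (sym_v l) (sym_v1 l) (sym_v m) (sym_v1 m).
    have h2 : sym e w F n.+1 (-1) D2 (fun _ k => v k 0 l * v k 0 m).
      by apply: (sym_comp_param hS (f := fun _ => tt) _ h1).
    have h3 : sym e w F n.+1 0 D2 (fun p k =>
        iter_partial (m :: l :: s) f (x k + (p.2 * p.1.2) *: v k)).
      apply: (sym_comp_param hS (f := fun p : unit * R * R => p.2 * p.1.2) _
        (sym_seg (m :: l :: s))).
      move=> [[[] t] u] [[_ /= /andP[t0 t1]] /= /andP[u0 u1]].
      by rewrite /D01 /= mulr_ge0//= mulr_ile1.
    by have := sym_mul hS h2 h3; rewrite addr0.
  have := sym_mvt hS (D := D1)
    (G := fun p u k => v k 0 l * iter_partial (l :: s) f (x k + (u * p.2) *: v k))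
    (G' := fun p u k => \sum_m p.2 * (v k 0 l * v k 0 m *
         iter_partial (m :: l :: s) f (x k + (u * p.2) *: v k))) _
    (sym_sum hS _ (fun m _ => h m)).
  move=> H; apply: (sym_ext hS _ (H _)).
    by apply: nearW => k [[] t] _; rewrite /g /= mul1r mul0r mulrBr.
  apply: filterS near_seg => k hk [[] t] u [_ /= t01] u01.
  have ut : D01 (u * t).
    by move: t01 u01 => /andP[t0 t1] /andP[u0 u1]; rewrite /D01 /= mulr_ge0//= mulr_ile1.
  have h1 := smooth_on_derive_line oU (smooth_on_iter (l :: s) fU) (BU (hk _ ut)).
  have dm : is_derive u 1 (fun u0 : R => u0 * t) t.
    by apply: is_derive_eq; rewrite scaler0 add0r [_%:A]mulr1.
  have h2 := @is_derive1_comp _ (fun z => iter_partial (l :: s) f (x k + z *: v k))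
      (fun u0 : R => u0 * t) _ _ _ h1 dm.
  have h3 := @is_deriveZ _ _ _ _ (v k 0 l) _ _ _ h2.
  apply: (@is_derive_eq _ _ _ _ _ _ _ _ h3).
  rewrite /GRing.scale /= mulr_suml mulr_sumr; apply: eq_bigr => m _.
  by rewrite /iter_partial/=; ring.
have := sym_mvt hS (D := [set: unit])
  (G := fun _ t k => iter_partial s f (x k + t *: v k) - t * \sum_l v k 0 l * g l 0 k)
  (G' := fun _ t k => \sum_l v k 0 l * (g l t k - g l 0 k)) _
  (sym_sum hS _ (fun l _ => Q l)).
move=> H; apply: (sym_ext hS _ (H _)).
  apply: nearW => k i _; rewrite /taylor_rem /g scale1r !scale0r !addr0 mul1r mul0r subr0.
  by rewrite addrAC.
apply: filterS near_seg => k hk [] t _ t01.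
have h := smooth_on_derive_line oU (smooth_on_iter s fU) (BU (hk _ t01)).
apply: is_derive_eq.
rewrite scaler0 add0r [_%:A]mulr1 -sumrB.
by apply: eq_bigr => l _; rewrite mulrBr.
Qed.

End Chart.

End SymbolMatrix.

(** One large real [M] plays both the threshold and the constant of an estimate, so that compactness
    of the sphere makes local estimates uniform in a single pass. *)
Lemma sphere_uniform (R : realType) (d : nat) (P : R -> 'rV[R]_d -> Prop) :
  (forall th0, sphere th0 -> exists M0 dl, 0 < dl /\
     forall M th, M0 <= M -> sphere th -> `|th - th0| < dl -> P M th) ->
  exists M0, forall M, M0 <= M -> forall th, sphere th -> P M th.
Proof.
move=> h.
have /compact_near_coveringP /(_ R +oo%R (fun M th => sphere th -> P M th) _) :=
  @sphere_compact R d.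
case=> [th0 sth0|M1 [M1r hM1]].
  have [M0 [dl [dl0 hP]]] := h _ sth0.
  exists ([set th | `|th - th0| < dl], [set M | M0 <= M]) => /=.
    split; last by apply: nbhs_pinfty_ge; exact: num_real.
    by apply/nbhs_ballP; exists dl => //= y; rewrite -ball_normE /= distrC.
  by move=> [th M] /= [h1 h2] sth; exact: hP.
exists (M1 + 1) => M hM th sth; apply: (hM1 M) => //.
by apply: lt_le_trans hM; rewrite ltrDl.
Qed.

Section Global.
Context {R : realType} {d : nat}.
Variables (K : set 'rV[R]_d) (X : 'rV[R]_d -> 'rV[R]_d).
Hypotheses (cK : compact K) (vK : convex_set K).
Hypothesis (curv : smooth_positively_curved_boundary K).
Hypothesis (hX : forall th, sphere th -> is_support K th (X th)).

(** [M] is at once a Lipschitz constant for nearby pairs and the inverse of a Lebesgue number; pairs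
    at distance at least [1 / M] are handled by boundedness of [K]. *)
Lemma support_map_lipschitz : exists2 C : R, 0 <= C &
  forall th th', sphere th -> sphere th' -> `|X th' - X th| <= C * `|th' - th|.
Proof.
have [B B0 hB] := compact_norm_bound cK.
have [|M0 hM0] := @sphere_uniform R d (fun M th => 0 < M -> forall th', sphere th' ->
  `|th' - th| < M^-1 -> `|X th' - X th| <= M * `|th' - th|).
  move=> th0 sth0; have [C [dl [C0 dl0 h]]] := support_map_lipschitz_loc cK vK curv hX sth0.
  exists (Num.max C (2 / dl)), (dl / 2); split=> [|M th]; first exact: divr_gt0.
  rewrite ge_max => /andP[CM dM] sth hth M0 th' sth' hth'.
  have Mdl : M^-1 <= dl / 2.
    by rewrite -[dl / 2]invrK lef_pV2 ?posrE ?invr_gt0 ?divr_gt0// invf_div.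
  apply: (@le_trans _ _ (C * `|th' - th|)); last by rewrite ler_wpM2r.
  apply: h => //; first by lra.
  by have := ler_distD th th' th0; lra.
set M := Num.max M0 1.
have M1 : 0 < M by rewrite lt_max ltr01 orbT.
have hM := hM0 M; rewrite le_max lexx in hM; have {}hM := hM isT.
exists (M + 2 * B * M) => [|th th' sth sth'].
  by rewrite addr_ge0 ?(ltW M1)// !mulr_ge0// ltW.
have [near|far] := ltP `|th' - th| M^-1.
  apply: le_trans (hM th sth M1 th' sth' near) _.
  by rewrite ler_wpM2r// lerDl !mulr_ge0// ltW.
have h : `|X th' - X th| <= 2 * B.
  apply: le_trans (ler_normB _ _) _.
  by have := hB _ (hX sth).1; have := hB _ (hX sth').1; lra.
apply: le_trans h _; rewrite mulrDl.
have : 2 * B * 1 <= 2 * B * (M * `|th' - th|).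
  by rewrite ler_wpM2l ?mulr_ge0// -ler_pdivrMl// mulr1.
have : 0 <= M * `|th' - th| by rewrite mulr_ge0// ltW.
rewrite mulr1 mulrA; lra.
Qed.

End Global.

(** * Localization at infinity and in a direction *)

Section Filters.
Context {R : realType} {L : zmodType} {J : Type} {d : nat}.
Variables (e : J -> L) (w : L -> R).
Hypothesis hw : lattice_weight e w.

Definition at_infinity : set_system L :=
  [set P | exists M : R, forall k, M <= w k -> P k].

Lemma at_infinity_setting : symbol_setting e w at_infinity.
Proof.
split=> //.
  split; first by exists 0.
    move=> P Q [M hM] [N hN]; exists (Num.max M N) => k.
    by rewrite ge_max => /andP[/hM ? /hN].
  by move=> P Q PQ [M hM]; exists M => k /hM /PQ.
move=> j P [M hM]; exists (2 * M) => k Mk; apply: hM.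
by have := (hw.2 j k).2; lra.
Qed.

Variable th : L -> 'rV[R]_d.

(** Defining functions of the boundary exist only locally, so estimates are first made for those
    large [k] whose direction [th k] is close to [th0]. *)
Definition at_direction (th0 : 'rV[R]_d) : set_system L :=
  [set P | exists M dl : R, 0 < dl /\
    forall k, M <= w k -> `|th k - th0| < dl -> P k].

Lemma at_direction_infinity th0 P : at_infinity P -> at_direction th0 P.
Proof. by move=> [M hM]; exists M, 1; split=> // k /hM. Qed.

(** A step [e j] moves [th k] by [O(1 / w k)]; for large [w k] it therefore leads from distance
    [dl / 2] of [th0] to distance less than [dl]. This uses one controlled difference of [th]. *)
Lemma at_direction_setting n th0 :
  sym_vec e w at_infinity n.+1 0 [set: unit] (fun=> th) ->
  symbol_setting e w (at_direction th0).
Proof.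
move=> hth; have hS := at_infinity_setting; split=> //.
  split; first by exists 0, 1.
    move=> P Q [M [dl [dl0 hM]]] [N [dl' [dl'0 hN]]].
    exists (Num.max M N), (Num.min dl dl'); split; first by rewrite lt_min dl0.
    move=> k; rewrite ge_max lt_min => /andP[Mk Nk] /andP[h1 h2].
    by split; [exact: hM|exact: hN].
  by move=> P Q PQ [M [dl [dl0 hM]]]; exists M, dl; split=> // k h1 h2; exact/PQ/hM.
move=> j P [M [dl [dl0 hM]]].
have H l : exists C M', forall k, M' <= w k -> `|th (k + e j) 0 l - th k 0 l| <= C / w k.
  have [C [M' hC]] := sym_bnd hS ((hth l).2 j).
  by exists C, M' => k /hC /(_ tt I).
have [C hC] := choice H; have [M' hM'] := choice hC.
pose S := \sum_l `|C l|; pose T := \sum_l `|M' l|.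
have S0 : 0 <= S by exact: sumr_ge0.
have CS l : C l <= S.
  by apply: le_trans (ler_norm _) _; rewrite /S (bigD1 l)//= lerDl sumr_ge0.
have MT l : M' l <= T.
  by apply: le_trans (ler_norm _) _; rewrite /T (bigD1 l)//= lerDl sumr_ge0.
exists (Num.max (2 * M) (Num.max T (2 * S / dl + 1))), (dl / 2); split; first exact: divr_gt0.
move=> k; rewrite !ge_max => /andP[h1 /andP[h2 h3]] h4.
have wk : 0 < w k by exact: (w_gt0 hS).
apply: hM; first by have := (hw.2 j k).2; lra.
have : `|th (k + e j) - th k| <= S / w k.
  apply: rV_norm_le => [|l]; first by rewrite divr_ge0// ltW.
  rewrite !mxE; apply: le_trans (hM' l k (le_trans (MT l) h2)) _.
  by rewrite ler_wpM2r// invr_ge0 ltW.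
have : S / w k < dl / 2.
  rewrite ltr_pdivrMr// mulrAC ltr_pdivlMr// mulrC.
  by rewrite -ltr_pdivrMl// [_^-1 * _]mulrC; lra.
by have := ler_distD (th k) (th (k + e j)) th0; lra.
Qed.

Lemma bnd_filter_le {I : Type} (F G : set_system L) m (D : set I) a :
  (forall P, F P -> G P) -> bnd w F m D a -> bnd w G m D a.
Proof. by move=> FG [C h]; exists C; exact: FG. Qed.

Lemma sym_filter_le {I : Type} (F G : set_system L) n m (D : set I) a :
  (forall P, F P -> G P) -> sym e w F n m D a -> sym e w G n m D a.
Proof.
move=> FG; elim: n m a => [|n IH] m a [ha ha'] /=; split=> //;
  try exact: bnd_filter_le ha.
by move=> j; exact: IH (ha' j).
Qed.

Lemma sym_glue n m a : at_infinity (sphere \o th) ->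
  (forall th0, sphere th0 -> sym e w (at_direction th0) n m [set: unit] a) ->
  sym e w at_infinity n m [set: unit] a.
Proof.
move=> [Ms hs]; have hb m' a' :
  (forall th0, sphere th0 -> bnd w (at_direction th0) m' [set: unit] a') ->
  bnd w at_infinity m' [set: unit] a'.
  move=> h.
  have [|M0 hM0] := @sphere_uniform R d (fun M th' => forall k, M <= w k -> th k = th' ->
      `|a' tt k| <= M * w k ^ m').
    move=> th0 sth0; have [C [N [dl [dl0 hC]]]] := h _ sth0.
    exists (Num.max C N), dl; split=> // M th'; rewrite ge_max => /andP[CM NM] sth' hth' k Mk E.
    apply: le_trans (hC k _ _ tt _) _ => //; [exact: le_trans Mk|by rewrite E|].
    by rewrite ler_wpM2r// ltW// (wz_gt0 at_infinity_setting).
  pose M := Num.max Ms M0; exists M; exists M => k Mk [] _.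
  apply: (hM0 M _ (th k)) => //; first by rewrite le_max lexx orbT.
  by apply: hs; apply: le_trans Mk; rewrite le_max lexx.
elim: n m a => [|n IH] m a h; split=> //; try by apply: hb => th0 sth0; exact: (h th0 sth0).1.
by move=> j; apply: IH => th0 sth0; exact: ((h th0 sth0).2 j).
Qed.

End Filters.

(** * The support map along a symbol of directions *)

Section Transport.
Context {R : realType} {L : zmodType} {J : Type} {d : nat}.
Variables (e : J -> L) (w : L -> R).
Hypothesis hw : lattice_weight e w.
Variables (K : set 'rV[R]_d) (X : 'rV[R]_d -> 'rV[R]_d).
Hypotheses (cK : compact K) (vK : convex_set K).
Hypothesis (curv : smooth_positively_curved_boundary K).
Hypothesis (hX : forall th, sphere th -> is_support K th (X th)).
Variable th : L -> 'rV[R]_d.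
Hypothesis th_sphere : at_infinity w (sphere \o th).

Let hS := at_infinity_setting hw.

Lemma sym_dotv {F} (hF : symbol_setting e w F) {I : Type} n m m' (D : set I)
    (a b : I -> L -> 'rV[R]_d) :
  sym_vec e w F n m D a -> sym_vec e w F n m' D b ->
  sym e w F n (m + m') D (fun i k => dotv (a i k) (b i k)).
Proof. by move=> ha hb; apply: (sym_sum hF) => l _; exact: sym_mul. Qed.

(** The Lipschitz bound gives the first difference. Afterwards Cramer's rule expresses the
    difference of [X (th k)] through that of [th], through coefficients known with the differences
    of the induction hypothesis, and through Taylor remainders, which [sym_taylor_rem] controls
    equally far; since the left side is already a difference, one more is won. *)
Lemma support_map_sym_loc n th0 : sphere th0 ->
  sym_vec e w (at_infinity w) n.+1 0 [set: unit] (fun=> th) ->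
  sym_vec e w (at_direction w th th0) n.+1 0 [set: unit] (fun=> X \o th).
Proof.
move=> sth0 hth.
have hF : symbol_setting e w (at_direction w th th0) by exact: at_direction_setting hth.
have FF := symbol_filter hF.
have [U [rho [r [c [dl]]]]] := support_chart_exists cK vK curv hX sth0.
move=> [oU rU BU fB [r0 c0 dl0 hdl]].
have [B B0 hB] := compact_norm_bound cK.
have [Ms hMs] := th_sphere.
have near_chart : \forall k \near at_direction w th th0, sphere (th k) /\ `|th k - th0| < dl.
  by exists Ms, dl; split=> // k /hMs.
have near_r : \forall k \near at_direction w th th0, `|(X \o th) k - X th0| <= r.
  by apply: filterS near_chart => k [sk hk]; have [] := hdl _ sk hk.
have bX : forall l, bnd w (at_direction w th th0) 0 [set: unit] (fun _ k => X (th k) 0 l).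
  move=> l; exists B; apply: filterS near_chart => k [sk _] _ _; rewrite mulr1.
  by apply: le_trans (coord_le _ _) _; apply/hB/(hX sk).1.
elim: n hth => [|n IH] hth l; split=> // j.
  have [C C0 hC] := support_map_lipschitz cK vK curv hX.
  have hj := fun i => ((hth i).2 j).1.
  have [Ci hCi] := choice (fun i => ex2_ex (bnd_ex hS (hj i))).
  split=> //; exists (C * \sum_i Ci i).
  have [_ _ hshift] := hF.
  have hCn : \forall k \near at_direction w th th0, forall i,
      `|th (k + e j) 0 i - th k 0 i| <= Ci i * w k ^ (0 - 1).
    apply: (@filter_forall _ _ (fun i k => `|th (k + e j) 0 i - th k 0 i| <= Ci i * w k ^ (0 - 1)) _ FF) => i.
    by apply: at_direction_infinity; have [_ [M h]] := hCi i; exists M => k /h /(_ tt I).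
  apply: filterS3 near_chart (hshift j _ near_chart) hCn => k [sk _] [sk' _] hk [] _.
  rewrite /dif /= -[X in X - _]/(X _ 0 l).
  have -> : X (th (k + e j)) 0 l - X (th k) 0 l = (X (th (k + e j)) - X (th k)) 0 l.
    by rewrite !mxE.
  apply: le_trans (coord_le _ _) _; apply: le_trans (hC _ _ sk sk') _.
  rewrite -mulrA ler_wpM2l//.
  have Ci0 i : 0 <= Ci i by have [/ltW] := hCi i.
  apply: rV_norm_le => [|i].
    by rewrite mulr_ge0 ?sumr_ge0// ltW// (wz_gt0 hS).
  rewrite !mxE; apply: le_trans (hk i) _.
  rewrite ler_wpM2r ?(ltW (wz_gt0 hS _ _))// (bigD1 i)//= lerDl sumr_ge0//.
have hx : sym_vec e w (at_direction w th th0) n.+1 0 [set: unit] (fun=> X \o th).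
  by apply: IH => i; apply: (symW hS _ (hth i)).
have hthF m : (m <= n.+2)%N -> sym_vec e w (at_direction w th th0) m 0 [set: unit] (fun=> th).
  move=> mn i; apply: (@sym_filter_le _ _ _ _ _ _ (at_infinity w)).
    by move=> P; exact: at_direction_infinity.
  exact: (symW hS mn (hth i)).
have hthn := hthF n.+1 (leqnSn _).
pose dth k := th (k + e j) - th k.
have hdth : sym_vec e w (at_direction w th th0) n.+1 (-1) [set: unit] (fun=> dth).
  move=> i; apply: (sym_ext hF _ (sym_difS hF j (hthF n.+2 (leqnn _) i))).
  by apply: nearW => k [] _; rewrite /dif !mxE.
pose v k := X (th (k + e j)) - X (th k).
have hs s : sym e w (at_direction w th th0) n.+1 0 [set: unit]
    (fun _ k => iter_partial s rho (X (th k))).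
  by apply: (sym_smooth_comp hF oU rU BU fB (z := fun _ => X \o th)) => //;
    apply: filterS near_r => k h [] _.
have hrem s := sym_taylor_rem hF oU rU BU fB j near_r hx s.
have hA i i' : sym e w (at_direction w th th0) n.+1 0 [set: unit]
    (fun _ k => gauss_mx rho (th k) (X (th k)) i i').
  have h1 := hs [:: i'; i].
  have h2 := sym_sum hF (index_enum 'I_d) (P := xpredT) (fun l _ => sym_mul hF (hthn l) (hs [:: i'; l])).
  have h3 := sym_mul hF (hthn i) (hs [:: i']).
  rewrite addr0 in h2; rewrite addr0 in h3.
  have h4 := sym_mul hF (hthn i) h2; rewrite addr0 in h4.
  apply: (sym_ext hF _ (sym_add hF (sym_add hF h1 (sym_opp hF h4)) h3)).
  by apply: nearW => k [] _; rewrite mxE.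
have hdet := sym_det hF hA.
have ell : elliptic w (at_direction w th th0) 0 [set: unit]
    (fun _ k => \det (gauss_mx rho (th k) (X (th k)))).
  exists c => //; apply: filterS near_chart => k [sk hk] [] _.
  by rewrite mulr1; have [] := hdl _ sk hk.
have hinv := sym_inv hF ell hdet; rewrite oppr0 in hinv.
have hadj := sym_adj hF hA.
have hrhs i : sym e w (at_direction w th th0) n.+1 (-1) [set: unit]
    (fun _ k => gauss_rhs rho (th k) (th (k + e j)) (X (th k)) (v k) 0 i).
  have hgrad : sym_vec e w (at_direction w th th0) n.+1 0 [set: unit]
      (fun _ k => grad rho (X (th (k + e j)))).
    move=> p; apply: (sym_ext hF _ (sym_shf hF j (hs [:: p]))).
    by apply: nearW => k [] _; rewrite mxE.
  have hth' : sym_vec e w (at_direction w th th0) n.+1 0 [set: unit] (fun _ k => th (k + e j)).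
    by move=> p; exact: (sym_shf hF j (hthn p)).
  have hmu := sym_dotv hF hth' hgrad; rewrite addr0 in hmu.
  have hdd := sym_dotv hF hthn hdth; rewrite add0r in hdd.
  have t1 := sym_mul hF hdd (hthn i); rewrite addr0 in t1.
  have t2 := sym_mul hF hmu (sym_add hF (hdth i) (sym_opp hF t1)); rewrite add0r in t2.
  have hr : sym_vec e w (at_direction w th th0) n.+1 (-1) [set: unit]
      (fun _ k => \row_p taylor_rem (partial p rho) (X (th k)) (v k)).
    move=> p; apply: (sym_ext hF _ (hrem [:: p])).
    by apply: nearW => k [] _; rewrite mxE.
  have t3 := sym_dotv hF hthn hr; rewrite add0r in t3.
  have t4 := sym_mul hF (sym_add hF t3 (sym_opp hF (hrem [::]))) (hthn i).
  rewrite addr0 in t4.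
  apply: (sym_ext hF _ (sym_add hF (sym_add hF t2 (sym_opp hF (hr i))) t4)).
  apply: nearW => k [] _; rewrite /gauss_rhs /v [X (th k) + _]addrC subrK.
  rewrite [RHS]mxE; congr (_ + _); last by rewrite [RHS]mxE.
  by rewrite [RHS]mxE; congr (_ + _); rewrite ?mxE//; rewrite !mxE.
have hsum := sym_sum hF (index_enum 'I_d) (P := xpredT) (fun p _ => sym_mul hF (hadj l p) (hrhs p)).
rewrite add0r in hsum.
have := sym_mul hF hinv hsum; rewrite add0r.
apply: (sym_ext hF).
have [_ _ hshift] := hF.
apply: filterS2 near_chart (hshift j _ near_chart) => k [sk hk] [sk' hk'] [] _.
have [_ rX [mu gE] cdet] := hdl _ sk hk.
have [_ rX' [mu' gE'] _] := hdl _ sk' hk'.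
have xv : X (th k) + v k = X (th (k + e j)) by rewrite /v addrC subrK.
have E := gauss_identity (v := v k) sk sk' rX.
rewrite xv in E; have {}E := E _ _ rX' gE gE'.
rewrite -(gauss_solve E l) mulKf; first by rewrite /dif /v !mxE.
by rewrite -normr_gt0 (lt_le_trans c0).
Qed.

Lemma support_map_sym n :
  sym_vec e w (at_infinity w) n 0 [set: unit] (fun=> th) ->
  sym_vec e w (at_infinity w) n 0 [set: unit] (fun=> X \o th).
Proof.
case: n => [_ l|n hth l].
  have [B B0 hB] := compact_norm_bound cK; split=> //; exists B.
  have [Ms hMs] := th_sphere; exists Ms => k /hMs sk _ _; rewrite mulr1.
  by apply: le_trans (coord_le _ _) _; apply/hB/(hX sk).1.
apply: (sym_glue hw th_sphere) => th0 sth0.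
exact: support_map_sym_loc.
Qed.

End Transport.

(** * Boundary points with prescribed normal *)

Section NormalMap.
Context {R : realType} {d : nat}.
Implicit Types (K : set 'rV[R]_d) (o : orientation) (th : 'rV[R]_d).

(* [Y th] is the point of the boundary of [K] with chosen unit normal [th]. *)
Definition normal_map K o (Y : 'rV[R]_d -> 'rV[R]_d) :=
  [/\ forall (q : torus R d) th, sphere th -> normal_bundle K o (q, th) <-> q = Defs.proj (Y th),
      exists2 B, 0 <= B & forall th, sphere th -> `|Y th| <= B,
      exists2 C, 0 <= C & forall th th', sphere th -> sphere th' ->
        `|Y th' - Y th| <= C * `|th' - th| &
      forall (L : zmodType) (J : Type) (e : J -> L) (w : L -> R) (th : L -> 'rV[R]_d) n,
        lattice_weight e w -> at_infinity w (sphere \o th) ->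
        sym_vec e w (at_infinity w) n 0 [set: unit] (fun=> th) ->
        sym_vec e w (at_infinity w) n 0 [set: unit] (fun=> Y \o th)].

(** A small step against the gradient stays in the sublevel set, so the singleton would contain a
    second point. *)
Lemma singleton_no_defining_function (x y : 'rV[R]_d) U rho :
  boundary [set x] y -> U y -> local_defining_function [set x] U rho -> False.
Proof.
move=> [cy _] Uy [oU rU gU KU].
have yx : y = x.
  have cl1 : closed [set x].
    by apply: accessible_closed_set1; apply: hausdorff_accessible; exact: norm_hausdorff.
  by move: cy; rewrite -((closure_id _).1 cl1).
subst y.
have gg := dotv_gt0 (gU _ Uy).
have g0 : dotv (grad rho x) (- grad rho x) < 0 by rewrite dotvNr oppr_lt0.
have [dl dl0 h] := directional_expansion (- grad rho x) oU rU Uy gg.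
have [|Ut] := h (dl / 2); first by rewrite divr_gt0//=; lra.
rewrite dotvNr ler_distl => /andP[_ hle].
have /KU : [set x] x by []. 
move=> /(_ Uy) rx.
have : [set x] (x + (dl / 2) *: - grad rho x) by apply/(KU _ Ut); lra.
move=> /= /eqP; rewrite -subr_eq0 addrAC subrr add0r scaler_eq0 oppr_eq0.
by rewrite (negbTE (gU _ Uy)) orbF; lra.
Qed.

Definition orient o : R := match o with Outgoing => 1 | Ingoing => -1 end.

Lemma orient_sphere o th : sphere th -> sphere (orient o *: th).
Proof.
rewrite /sphere /= enormZ => ->; case: o => /=; first by rewrite normr1 mulr1.
by rewrite normrN1 mulr1.
Qed.

Lemma normal_map_exists K o : (0 < d)%N -> strictly_convex_compact K ->
  exists Y, normal_map K o Y.
Proof.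
move=> d0 [[x ->]|[cK vK [c0 ic0] curv]].
  exists (fun=> x); split.
  - move=> q th sth; split; last by move=> ->; left; exists x.
    case=> [[y [E /= -> _]]|[y [by1 _ [U [rho [Uy ld _]]]]]].
      have : [set y] x by rewrite -E.
      by move=> /= ->.
    by case: (singleton_no_defining_function by1 Uy ld).
  - by exists `|x|.
  - by exists 0 => // th th' _ _; rewrite subrr normr0 mul0r.
  - move=> L J e w th n hw _ _ l.
    apply: (@sym_cst _ _ _ _ _ _ (at_infinity_setting hw) _ n _ (fun=> x 0 l)).
    by exists `|x 0 l|.
have K0 : K !=set0 by exists c0; exact: interior_subset.
pose X th := xget 0 [set x | is_support K th x].
have hX th : sphere th -> is_support K th (X th).
  by move=> _; have [x hx] := support_exists th cK K0; apply: (@xgetPex _ 0 [set x | is_support K th x]); exists x.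
have clK : closed K by exact: (compact_closed (@norm_hausdorff _ _) cK).
(* The point with chosen normal [th] is the support point for the outward normal
   [orient o *: th]. *)
exists (fun th => X (orient o *: th)); split.
- move=> q th sth; have so := orient_sphere o sth.
  have so0 : orient o *: th != 0.
    by apply/eqP => h; move: so; rewrite h /sphere /= /enorm dotv0 sqrtr0 => /eqP; rewrite eq_sym oner_eq0.
  split.
    move=> [[x [Kx _ _]]|[x [bx /= -> [U [rho [Ux ld hth]]]]]].
      (* A set with an interior point is not a singleton: the point can be moved along the first
         coordinate, which exists because [d > 0]. *)
      exfalso; move: ic0 => /nbhs_ballP[r /= r0 h].
      have i0 : 'I_d by exists 0%N.
      have c0x : c0 = x.
        by have : K c0 by [apply: h; exact: ballxx]; rewrite Kx.
      have : K (c0 + (r / 2) *: delta_mx 0 i0).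
        apply: h; rewrite -ball_normE /= opprD addrA subrr add0r normrN normrZ.
        rewrite gtr0_norm ?divr_gt0// -[ltRHS](mulr1 r).
        apply: (@le_lt_trans _ _ (r / 2 * 1)); last by rewrite !mulr1; lra.
        rewrite ler_wpM2l ?divr_ge0 ?(ltW r0)//.
        by apply: rV_norm_le => // i; rewrite mxE; case: (_ && _); rewrite ?normr1 ?normr0.
      rewrite Kx -c0x /= => /eqP; rewrite -subr_eq0 addrAC subrr add0r scaler_eq0.
      case/orP => [|/eqP/rowP/(_ i0)]; first by rewrite mulf_eq0 gt_eqF//= invr_eq0 pnatr_eq0.
      by rewrite !mxE !eqxx => /eqP; rewrite oner_eq0.
    congr Defs.proj; apply: (support_unique clK vK curv so _ (hX _ so)).
    suff -> : orient o *: th = outward_normal rho x by exact: (support_of_normal clK vK ld Ux bx).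
    move: hth => /= ->; case: o {so so0} => /=; first by rewrite scale1r.
    by rewrite /inward_normal scaleN1r opprK.
  move=> ->; right; exists (X (orient o *: th)); split => //.
    exact: support_boundary so0 (hX _ so).
  have [U [rho [Ux ld _]]] := curv _ (support_boundary so0 (hX _ so)).
  exists U, rho; split=> //=.
  have := normal_of_support ld Ux clK so (hX _ so).
  rewrite /inward_normal => ->; case: (o) => /=; first by rewrite scale1r.
  by rewrite scaleN1r opprK.
- have [B B0 hB] := compact_norm_bound cK; exists B => // th sth.
  exact: hB (hX _ (orient_sphere o sth)).1.
- have [C C0 hC] := support_map_lipschitz cK vK curv hX; exists C => // th th' s s'.
  apply: le_trans (hC _ _ (orient_sphere o s) (orient_sphere o s')) _.
  rewrite -scalerBr normrZ (_ : `|orient o| = 1) ?mul1r//.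
  by case: (o) => /=; rewrite ?normr1 ?normrN1.
- move=> L J e w th n hw hs hth.
  have hS := at_infinity_setting hw.
  have hs' : at_infinity w (sphere \o (fun k => orient o *: th k)).
    by have [M hM] := hs; exists M => k /hM; exact: orient_sphere.
  apply: (support_map_sym hw cK vK curv hX hs') => l.
  apply: (sym_ext hS _ (sym_scale hS (c := fun=> orient o) _ (hth l))).
    by exists 0 => k _ i _; rewrite mxE.
  by exists `|orient o|.
Qed.

End NormalMap.

(** * Solutions indexed by the lattice *)

Section Lattice.
Context {R : realType} {d : nat}.

Definition emb (k : 'rV[int]_d) : 'rV[R]_d := (2 * pi) *: map_mx intr k.

(** Both signs of each coordinate direction, [true] being the negative one: summation by parts
    shifts phases forwards and amplitudes backwards. *)
Definition lat_dir (j : 'I_d * bool) : 'rV[int]_d := (-1) ^+ j.2 *: delta_mx 0 j.1.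

Definition lat_weight (k : 'rV[int]_d) : R := 1 + `|map_mx intr k : 'rV[R]_d|.

Lemma embD k l : emb (k + l) = emb k + emb l.
Proof. by rewrite /emb map_mxD scalerDr. Qed.

Lemma embB k l : emb (k - l) = emb k - emb l.
Proof. by rewrite /emb map_mxB scalerBr. Qed.

Lemma lat_weight_ge1 k : 1 <= lat_weight k.
Proof. by rewrite lerDl. Qed.

Lemma pi2_gt0 : 0 < 2 * pi :> R. Proof. by rewrite mulr_gt0// pi_gt0. Qed.

Lemma norm_emb k : `|emb k| = 2 * pi * (lat_weight k - 1).
Proof. by rewrite normrZ gtr0_norm ?pi2_gt0// /lat_weight addrC addKr. Qed.

Lemma norm_lat_dir j : `|map_mx intr (lat_dir j) : 'rV[R]_d| <= 1.
Proof.
apply: rV_norm_le => // i; rewrite !mxE /= intrM normrM rmorphXn /= rmorphN1.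
rewrite normrX normrN1 expr1n mul1r.
by case: (_ == _); rewrite /= ?normr1 ?normr0.
Qed.

Lemma lat_lattice_weight : lattice_weight lat_dir lat_weight.
Proof.
split; first exact: lat_weight_ge1.
move=> j k; have h := norm_lat_dir j.
have := lat_weight_ge1 k; have := lat_weight_ge1 (k + lat_dir j).
have h1 := ler_normD (map_mx intr k : 'rV[R]_d) (map_mx intr (lat_dir j)).
have h2 := ler_normB (map_mx intr (k + lat_dir j) : 'rV[R]_d) (map_mx intr (lat_dir j)).
rewrite map_mxD addrK in h2; rewrite /lat_weight map_mxD; split; lra.
Qed.

Lemma proj_eq (x y : 'rV[R]_d) : Defs.proj x = Defs.proj y <-> exists k, x = y + emb k.
Proof.
split=> [/eqP|[k ->]].
  by rewrite eqmodE => /asboolP[k xy]; exists k; rewrite /emb -xy addrC subrK.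
apply/eqP; rewrite eqmodE; apply/asboolP; exists k.
by rewrite addrC addKr.
Qed.

End Lattice.

(** * The implicit equation as a fixed point problem *)

Section Solutions.
Context {R : realType} {d : nat}.
Variables (Y1 Y2 : 'rV[R]_d -> 'rV[R]_d) (B C : R).
Hypotheses (d0 : (0 < d)%N) (B0 : 0 <= B) (C0 : 0 <= C).
Hypotheses (Y1B : forall th, sphere th -> `|Y1 th| <= B)
  (Y2B : forall th, sphere th -> `|Y2 th| <= B)
  (Y1C : forall th th', sphere th -> sphere th' -> `|Y1 th' - Y1 th| <= C * `|th' - th|)
  (Y2C : forall th th', sphere th -> sphere th' -> `|Y2 th' - Y2 th| <= C * `|th' - th|).

Definition sol (k : 'rV[int]_d) (th : 'rV[R]_d) (l : R) :=
  [/\ sphere th, 0 < l & Y1 th + l *: th = Y2 th + emb k].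

(** The equation in [sol] reads [sol_z k th = l *: th]: the direction is a fixed point of the
    normalized [sol_z k], and [l] is the Euclidean norm there. *)
Definition sol_z (k : 'rV[int]_d) (th : 'rV[R]_d) : 'rV[R]_d := emb k - (Y1 th - Y2 th).

Lemma sol_zE k th l : sol k th l -> sol_z k th = l *: th.
Proof.
move=> [_ _ E]; rewrite /sol_z; have -> : emb k = Y1 th + l *: th - Y2 th by rewrite E addrC addKr.
by apply/rowP => i; rewrite !mxE; ring.
Qed.

Lemma sol_len k th l : sol k th l -> l = enorm (sol_z k th).
Proof.
by move=> s; rewrite (sol_zE s) enormZ; case: s => -> l0 _; rewrite mulr1 gtr0_norm.
Qed.

Lemma sol_fixed k th l : sol k th l -> th = (enorm (sol_z k th))^-1 *: sol_z k th.
Proof.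
move=> s; rewrite -(sol_len s) (sol_zE s) scalerA mulVf ?scale1r//.
by case: s => _ l0 _; rewrite gt_eqF.
Qed.

Lemma fixed_sol k th : sphere th -> sol_z k th != 0 ->
  th = (enorm (sol_z k th))^-1 *: sol_z k th -> sol k th (enorm (sol_z k th)).
Proof.
move=> sth z0 E; split => //; first exact: enorm_gt0.
have -> : enorm (sol_z k th) *: th = sol_z k th.
  move: E z0; set z := sol_z k th => E z0.
  by rewrite E scalerA mulfV ?scale1r// enorm_eq0.
rewrite /sol_z.
by move: (emb k) => u; apply/rowP => i; rewrite !mxE; ring.
Qed.

Lemma sol_z_norm k th : sphere th -> `|emb k| - 2 * B <= `|sol_z k th| /\
  `|sol_z k th| <= `|emb k| + 2 * B.
Proof.
move=> sth; have := Y1B sth; have := Y2B sth.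
have := ler_normB (Y1 th) (Y2 th); have := ler_normB (emb k : 'rV[R]_d) (Y1 th - Y2 th).
have := ler_normD (sol_z k th) (Y1 th - Y2 th); rewrite /sol_z subrK.
by split; lra.
Qed.

Lemma sol_z_lipschitz k th th' : sphere th -> sphere th' ->
  `|sol_z k th' - sol_z k th| <= 2 * C * `|th' - th|.
Proof.
move=> s s'; have := Y1C s s'; have := Y2C s s'.
have -> : sol_z k th' - sol_z k th = (Y2 th' - Y2 th) - (Y1 th' - Y1 th).
  by apply/rowP => i; rewrite !mxE; ring.
have := ler_normB (Y2 th' - Y2 th) (Y1 th' - Y1 th); lra.
Qed.

Lemma normalize_lipschitz (z z' : 'rV[R]_d) : z != 0 -> z' != 0 ->
  enorm ((enorm z')^-1 *: z' - (enorm z)^-1 *: z) <= 2 * enorm (z' - z) / enorm z.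
Proof.
move=> z0 z'0; have e0 := enorm_gt0 z0; have e'0 := enorm_gt0 z'0.
have -> : (enorm z')^-1 *: z' - (enorm z)^-1 *: z =
    (enorm z)^-1 *: (z' - z) + ((enorm z')^-1 - (enorm z)^-1) *: z'.
  by apply/rowP => i; rewrite !mxE; ring.
apply: le_trans (enormD _ _) _; rewrite !enormZ.
rewrite [`|(enorm z)^-1|]gtr0_norm ?invr_gt0//.
have -> : (enorm z')^-1 - (enorm z)^-1 = (enorm z')^-1 * ((enorm z)^-1 * (enorm z - enorm z')).
  by field; rewrite !gt_eqF.
rewrite !normrM gtr0_norm ?invr_gt0// [`|(enorm z)^-1|]gtr0_norm ?invr_gt0//.
have h : `|enorm z - enorm z'| <= enorm (z' - z).
  rewrite ler_norml; apply/andP; split.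
    by have := enormD (z' - z) z; rewrite subrK; lra.
  by have := enormD (z - z') z'; rewrite subrK -[enorm (z - z')]enormN opprB; lra.
rewrite mulrAC mulVf ?gt_eqF// mul1r -mulrDr mulrC ler_pM2r ?invr_gt0//; lra.
Qed.

Lemma sphere_normalize (z : 'rV[R]_d) : z != 0 -> sphere ((enorm z)^-1 *: z).
Proof.
by move=> z0; rewrite /sphere /= enormZ gtr0_norm ?invr_gt0 ?enorm_gt0// mulVf// enorm_eq0.
Qed.

(* Beyond this radius, normalizing [sol_z k] is a contraction of the sphere. *)
Definition sol_radius : R := 2 * B + 8 * d%:R * C + 1.

Lemma sol_z_large k th : sphere th -> sol_radius <= `|emb k| ->
  8 * d%:R * C + 1 <= enorm (sol_z k th) /\ sol_z k th != 0.
Proof.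
move=> sth hk; have [h _] := sol_z_norm k sth.
have dC : 0 <= 8 * d%:R * C by rewrite !mulr_ge0.
have h1 : 8 * d%:R * C + 1 <= enorm (sol_z k th).
  apply: le_trans (norm_le_enorm _); rewrite /sol_radius in hk; lra.
by split=> //; rewrite -enorm_eq0 gt_eqF//; lra.
Qed.

(** The term [8 * d * C] of [sol_radius] comes from here: normalizing costs a factor 2 over the
    norm, [sol_z k] has Lipschitz constant [2 * C], and passing from the sup norm to the Euclidean
    one costs [d]. *)
Lemma sol_map_contraction k th th' : sphere th -> sphere th' -> sol_radius <= `|emb k| ->
  `|(enorm (sol_z k th'))^-1 *: sol_z k th' - (enorm (sol_z k th))^-1 *: sol_z k th|
    <= 2^-1 * `|th' - th|.
Proof.
move=> s s' hk; have [h1 z0] := sol_z_large s hk; have [_ z'0] := sol_z_large s' hk.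
apply: le_trans (norm_le_enorm _) _; apply: le_trans (normalize_lipschitz z0 z'0) _.
have e0 := enorm_gt0 z0.
rewrite ler_pdivrMr//.
have h2 := le_trans (enorm_le_norm _) (ler_wpM2l (ler0n R d) (sol_z_lipschitz k s s')).
have dC : 0 <= 8 * d%:R * C by rewrite !mulr_ge0.
have n0 : 0 <= `|th' - th| by [].
have h3 : (8 * d%:R * C) * `|th' - th| <= enorm (sol_z k th) * `|th' - th|.
  by rewrite ler_wpM2r//; lra.
have E : d%:R * (2 * C * `|th' - th|) = (2 / 8) * (8 * d%:R * C * `|th' - th|) by field.
rewrite E in h2; rewrite mulrAC -mulrA; lra.
Qed.

Lemma sol_unique k th th' l l' : sol_radius <= `|emb k| -> sol k th l -> sol k th' l' ->
  th = th' /\ l = l'.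
Proof.
move=> hk s s'; suff E : th = th' by split=> //; rewrite (sol_len s) (sol_len s') E.
have [sth _ _] := s; have [sth' _ _] := s'.
have := sol_map_contraction sth sth' hk; rewrite -(sol_fixed s) -(sol_fixed s') => h.
apply/eqP; rewrite eq_sym -subr_eq0 -normr_eq0; apply/eqP.
by have := normr_ge0 (th' - th); lra.
Qed.

(** The distance [|T th - th|] attains its minimum on the compact sphere, and replacing the
    minimizer by its image at least halves it; the minimum is therefore 0. *)
Lemma sol_exists k : sol_radius <= `|emb k| -> exists th l, sol k th l.
Proof.
move=> hk.
pose T (th : 'rV[R]_d) := (enorm (sol_z k th))^-1 *: sol_z k th.
have TS th : sphere th -> sphere (T th).
  by move=> sth; apply: sphere_normalize; have [] := sol_z_large sth hk.
have Tc th th' : sphere th -> sphere th' -> `|T th' - T th| <= 2^-1 * `|th' - th|.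
  by move=> s s'; exact: sol_map_contraction.
have S0 : (@sphere R d) !=set0.
  exists (delta_mx 0 (Ordinal d0)); apply/enorm1.
  by rewrite dotv_delta mxE !eqxx.
pose f th := `|T th - th|.
have cf : {within sphere, continuous f}.
  apply/subspace_continuousP => x sx.
  have FG : Filter (within sphere (nbhs x)) by apply: within_filter; exact: nbhs_filter.
  apply/(@cvgrPdist_le _ _ _ _ FG) => eps eps0.
  have e2 : 0 < eps / 2 by rewrite divr_gt0.
  have := near_norm x e2; rewrite /within /=; apply: filterS => y xy sy.
  apply: le_trans (ler_dist_dist _ _) _.
  have -> : T x - x - (T y - y) = (T x - T y) - (x - y).
    by apply/rowP => i; rewrite !mxE; ring.
  apply: le_trans (ler_normB _ _) _; have := Tc _ _ sy sx; lra.
have [th /set_mem sth hth] := EVT_min_rV S0 (@sphere_compact R d) cf.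
have E : th = T th.
  apply/eqP; rewrite eq_sym -subr_eq0 -normr_eq0; apply/eqP.
  have := hth _ (mem_set (TS _ sth)); have := Tc _ _ sth (TS _ sth); rewrite /f.
  have := normr_ge0 (T th - th); lra.
exists th, (enorm (sol_z k th)); apply: fixed_sol => //.
by have [] := sol_z_large sth hk.
Qed.

End Solutions.

(** * Direction and length as symbols *)

Section LengthSymbol.
Context {R : realType} {d : nat}.
Notation W := (@lat_weight R d).
Notation E := (@lat_dir d).
Notation Finf := (at_infinity W).
Let hW : lattice_weight E W := @lat_lattice_weight R d.
Let hS := at_infinity_setting hW.
Variables (K1 K2 : set 'rV[R]_d) (o1 o2 : orientation).
Variables (Y1 Y2 : 'rV[R]_d -> 'rV[R]_d) (B C : R).
Hypotheses (d0 : (0 < d)%N) (B0 : 0 <= B) (C0 : 0 <= C).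
Hypotheses (nY1 : normal_map K1 o1 Y1) (nY2 : normal_map K2 o2 Y2).
Hypotheses (Y1B : forall th, sphere th -> `|Y1 th| <= B)
  (Y2B : forall th, sphere th -> `|Y2 th| <= B)
  (Y1C : forall th th', sphere th -> sphere th' -> `|Y1 th' - Y1 th| <= C * `|th' - th|)
  (Y2C : forall th th', sphere th -> sphere th' -> `|Y2 th' - Y2 th| <= C * `|th' - th|).
Variables (th : 'rV[int]_d -> 'rV[R]_d) (l : 'rV[int]_d -> R).
Hypothesis thl : forall k, @sol_radius R d B C <= `|emb k : 'rV[R]_d| -> sol Y1 Y2 k (th k) (l k).

Let rad := @sol_radius R d B C.

Lemma near_sol : Finf (fun k => sol Y1 Y2 k (th k) (l k)).
Proof.
exists (rad / (2 * pi) + 1) => k hk; apply: thl; rewrite norm_emb.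
by rewrite -ler_pdivrMl ?pi2_gt0// mulrC lerBrDr.
Qed.

Lemma th_sphere : Finf (sphere \o th).
Proof. by have [M hM] := near_sol; exists M => k /hM[]. Qed.

Lemma sym_emb n i : sym E W Finf n 1 [set: unit] (fun _ k => emb k 0 i : R).
Proof.
have hb : bnd W Finf 1 [set: unit] (fun _ k => emb k 0 i : R).
  exists (2 * pi), 0 => k _ _ _; apply: le_trans (coord_le _ _) _.
  rewrite norm_emb expr1z ler_pM2l ?pi2_gt0//; lra.
case: n => [|n]; split=> // j.
rewrite subrr; apply: (sym_ext hS _ (@sym_cst _ _ _ _ _ _ hS _ n [set: unit] (fun=> emb (E j) 0 i) _)).
  by exists 0 => k _ u _; rewrite /dif embD [X in _ = X - _]mxE [RHS]addrC addKr.
by exists `|emb (E j) 0 i|.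
Qed.

Lemma length_bounds : exists2 c, 0 < c &
  Finf (fun k => c * W k <= l k /\ l k <= c^-1 * W k).
Proof.
have dp : 0 < d%:R * (2 * pi + 2 * B) + 1 :> R.
  by rewrite ltr_wpDl// mulr_ge0// addr_ge0 ?mulr_ge0// ltW// pi_gt0.
exists (Num.min 1 (d%:R * (2 * pi + 2 * B) + 1)^-1).
  by rewrite lt_min ltr01 invr_gt0.
(* For such [k] the norm of [sol_z] is at least [2 pi (W k - 1) - 2 B], hence at least [W k],
   because [pi >= 2]. *)
have [M hM] := near_sol; exists (Num.max M (2 * pi + 2 * B)) => k.
rewrite ge_max => /andP[/hM s hk]; have [sth _ _] := s.
have [h1 h2] := sol_z_norm Y1B Y2B k sth; rewrite norm_emb in h1 h2.
have pi1 : 2 <= pi :> R by exact: pi_ge2.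
have W1 : 1 <= W k := lat_weight_ge1 k.
have piW : 2 * W k <= pi * W k by rewrite ler_wpM2r//; lra.
rewrite (sol_len s); split.
  apply: (@le_trans _ _ (W k)); first by rewrite ler_piMl ?ge_min ?lexx//; lra.
  apply: le_trans (norm_le_enorm _); lra.
rewrite mulrC ler_pdivlMr; last by rewrite lt_min ltr01 invr_gt0.
apply: le_trans (ler_wpM2r _ (enorm_le_norm _)) _.
  by rewrite le_min ler01 invr_ge0 ltW.
apply: (@le_trans _ _ (d%:R * `|sol_z Y1 Y2 k (th k)| * (d%:R * (2 * pi + 2 * B) + 1)^-1)).
  by rewrite ler_wpM2l ?mulr_ge0// ge_min lexx orbT.
rewrite ler_pdivrMr// mulrDr mulr1 mulrC.
have h : `|sol_z Y1 Y2 k (th k)| <= (2 * pi + 2 * B) * W k.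
  apply: le_trans h2 _; have : 2 * B * 1 <= 2 * B * W k by rewrite ler_wpM2l// mulr_ge0.
  lra.
have := ler_wpM2l (ler0n R d) h; lra.
Qed.

(** Bootstrap: [n] differences of [th] give [n] differences of [Y1 (th k)] and [Y2 (th k)]. Counted
    as terms of order 1 in [sol_z], these have [n + 1] differences, which pass to [l] as the norm of
    [sol_z] and to [th] as the quotient [sol_z / l]. *)
Lemma sym_direction_length n : sym_vec E W Finf n 0 [set: unit] (fun=> th) /\
  sym E W Finf n 1 [set: unit] (fun=> l).
Proof.
have [Ms hMs] := th_sphere; have [Ml hMl] := near_sol.
elim: n => [|n [IH _]].
  split=> [i|].
    split=> //; exists 1, Ms => k /hMs sk _ _; rewrite mulr1.
    by apply: le_trans (coord_le _ _) (sphere_norm sk).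
  split=> //; have [c c0 [M hM]] := length_bounds; exists c^-1, (Num.max M Ml) => k.
  rewrite ge_max => /andP[/hM[h1 h2] /hMl [_ l0 _]] _ _.
  by rewrite expr1z ger0_norm// ltW.
have [_ _ _ tr1] := nY1; have [_ _ _ tr2] := nY2.
have h1 := tr1 _ _ _ _ _ _ hW th_sphere IH; have h2 := tr2 _ _ _ _ _ _ hW th_sphere IH.
have hz i : sym E W Finf n.+1 1 [set: unit] (fun _ k => sol_z Y1 Y2 k (th k) 0 i).
  have h := sym_add hS (h1 i) (sym_opp hS (h2 i)).
  apply: (sym_ext hS _ (sym_add hS (sym_emb n.+1 i) (sym_opp hS (symS hS h)))).
  by exists 0 => k _ u _; rewrite !mxE.
have hzz := sym_dotv hS hz hz.
have hl : sym E W Finf n.+1 1 [set: unit] (fun=> l).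
  have := @sym_sqrt _ _ _ _ _ _ hS _ n.+1 1 _ _ _ hzz.
  move=> H; apply: (sym_ext hS _ (H _)).
    by exists Ml => k /hMl s u _; rewrite (sol_len s).
  have [c c0 [M hM]] := length_bounds; exists (c ^+ 2); first exact: exprn_gt0.
  exists (Num.max M Ml) => k; rewrite ge_max => /andP[/hM[hc _] /hMl s] u _.
  rewrite -enorm_sqr -(sol_len s) -[1 + 1]/(Posz 2) -exprnP -exprMn lerXn2r// nnegrE.
    by rewrite mulr_ge0 ?(ltW c0)// ltW// (w_gt0 hS).
  by case: s => _ /ltW.
split=> // i.
have ell : elliptic W Finf 1 [set: unit] (fun=> l).
  have [c c0 [M hM]] := length_bounds; exists c => //.
  exists (Num.max M Ml) => k; rewrite ge_max => /andP[/hM[hc _] /hMl [_ l0 _]] u _.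
  by rewrite expr1z ger0_norm// ltW.
have := sym_mul hS (hz i) (sym_inv hS ell hl); rewrite subrr.
apply: (sym_ext hS); exists Ml => k /hMl s u _.
rewrite (sol_zE s) mxE mulrAC mulfV ?mul1r//.
by case: s => _ l0 _; rewrite gt_eqF.
Qed.

Lemma direction_increment : exists2 C', 0 <= C' & exists M, forall k j, M <= W k ->
  `|th (k + E j) - th k| <= C' / W k.
Proof.
have H (p : 'I_d * ('I_d * bool)) : exists q : R * R, 0 <= q.1 /\
    forall k, q.2 <= W k -> `|th (k + E p.2) 0 p.1 - th k 0 p.1| <= q.1 / W k.
  have hb := (((sym_direction_length 1).1 p.1).2 p.2).1.
  have [C' C'0 [M hM]] := bnd_ex hS hb.
  exists (C', M); split; first exact: ltW.
  by move=> k /hM /(_ tt I); rewrite sub0r exprN1.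
have [q hq] := choice H.
exists (\sum_p (q p).1); first by apply: sumr_ge0 => p _; have [] := hq p.
exists (\sum_p `|(q p).2|) => k j hk; have Wk := w_gt0 hS k.
apply: rV_norm_le => [|i].
  by rewrite divr_ge0 ?(ltW Wk)// sumr_ge0// => p _; have [] := hq p.
rewrite !mxE; have [_ h] := hq (i, j).
apply: le_trans (h k _) _.
  apply: le_trans hk; apply: le_trans (ler_norm _) _.
  by rewrite (bigD1 (i, j))//= lerDl sumr_ge0.
rewrite ler_wpM2r ?invr_ge0 ?(ltW Wk)// (bigD1 (i, j))//= lerDl sumr_ge0// => p _.
by have [] := hq p.
Qed.

(** Pair the difference of the equations at [k + E j] and [k] with [th k]. As both directions are
    unit vectors, [<th, th'> = 1 - |th' - th|^2 / 2], so the error is the increment of [Y1 - Y2], of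
    size [O(1 / W)], plus [l |th' - th|^2 / 2], of size [W * O(1 / W^2)]. *)
Lemma length_increment : exists2 C', 0 <= C' & exists M, forall k j, M <= W k ->
  `|l (k + E j) - l k - dotv (emb (E j)) (th k)| <= C' / W k.
Proof.
have [M1 hM1] := near_sol.
have [c c0 [M2 hM2]] := length_bounds.
have [C' C'0 [M3 hM3]] := direction_increment.
exists (d%:R * (2 * C * C') + c^-1 * 2 * (d%:R * C') ^+ 2).
  by rewrite addr_ge0 ?mulr_ge0 ?sqr_ge0// invr_ge0 ltW.
exists (2 * (`|M1| + `|M2| + `|M3|)) => k j hk.
have := normr_ge0 M1; have := normr_ge0 M2; have := normr_ge0 M3.
have := ler_norm M1; have := ler_norm M2; have := ler_norm M3.
move=> a1 a2 a3 b1 b2 b3; have [wu wl] := hW.2 j k; have Wk := w_gt0 hS k.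
have s : sol Y1 Y2 k (th k) (l k) by apply: hM1; lra.
have s' : sol Y1 Y2 (k + E j) (th (k + E j)) (l (k + E j)) by apply: hM1; lra.
have [_ l'u] : c * W (k + E j) <= l (k + E j) /\ l (k + E j) <= c^-1 * W (k + E j).
  by apply: hM2; lra.
have hdt : `|th (k + E j) - th k| <= C' / W k by apply: hM3; lra.
have [sth l0 _] := s; have [sth' l'0 _] := s'.
have {}sth1 : dotv (th k) (th k) = 1 by exact/enorm1.
have {}sth1' : dotv (th (k + E j)) (th (k + E j)) = 1 by exact/enorm1.
have hz := sol_zE s; have hz' := sol_zE s'.
pose dF := (Y1 (th (k + E j)) - Y1 (th k)) - (Y2 (th (k + E j)) - Y2 (th k)).
have dz : l (k + E j) *: th (k + E j) - l k *: th k = emb (E j) - dF.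
  rewrite -hz -hz' /sol_z /dF embD; move: (emb k) (emb (E j)) => u u'.
  by apply/rowP => i; rewrite !mxE; ring.
have ndF : `|dF| <= 2 * C * (C' / W k).
  apply: le_trans (ler_normB _ _) _.
  have := Y1C sth sth'; have := Y2C sth sth' => g1 g2.
  have : C * `|th (k + E j) - th k| <= C * (C' / W k) by rewrite ler_wpM2l.
  by rewrite -[2 * C * _]mulrA; lra.
clearbody dF.
set D := th (k + E j) - th k in hdt.
have dd : dotv D D = 2 * (1 - dotv (th k) (th (k + E j))).
  by rewrite /D dotvBr !dotvBl sth1 sth1' (dotvC (th (k + E j)) (th k)); ring.
clearbody D.
have eq1 : l (k + E j) - l k - dotv (emb (E j)) (th k) =
    - dotv (th k) dF + l (k + E j) * (dotv D D / 2).
  have := congr1 (dotv (th k)) dz; rewrite !dotvBr (dotvZr (l (k + E j))) (dotvZr (l k)) sth1.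
  rewrite dd [dotv (emb _) _]dotvC; move: (dotv _ dF) (dotv _ (emb _)) (dotv _ (th _)) => a b t. lra.
rewrite eq1 mulrDl; apply: le_trans (ler_normD _ _) _; apply: lerD.
  rewrite normrN; apply: le_trans (dotv_le _ _) _.
  rewrite -[leRHS]mulrA ler_wpM2l// -[leRHS]mul1r ler_pM ?sphere_norm//.
  by rewrite -[2 * C * C' / _]mulrA.
have hDD : dotv D D <= (d%:R * C') ^+ 2 / W k ^+ 2.
  rewrite -enorm_sqr -expr_div_n lerXn2r// ?nnegrE ?enorm_ge0 ?divr_ge0 ?mulr_ge0 ?(ltW Wk)//.
  by apply: le_trans (enorm_le_norm _) _; rewrite -mulrA ler_wpM2l.
have DD0 := dotv_ge0 D.
rewrite ger0_norm; last by rewrite mulr_ge0 ?divr_ge0// ltW.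
apply: (@le_trans _ _ (c^-1 * (2 * W k) * ((d%:R * C') ^+ 2 / W k ^+ 2))).
  apply: ler_pM => //; [exact: ltW|by rewrite divr_ge0| |by lra].
  by apply: le_trans l'u _; rewrite ler_wpM2l// invr_ge0 ltW.
rewrite le_eqVlt; apply/orP; left; apply/eqP; field.
by rewrite !gt_eqF.
Qed.

End LengthSymbol.

(** * Unordered sums *)

Section Tsum.
Context {R : realType} {L : eqType}.
Implicit Types (f g : L -> R) (s : seq L).

Definition ssum f s : R := \sum_(k <- s) f k.

Definition summable_bound g (S : R) :=
  (forall k, 0 <= g k) /\ forall s, uniq s -> ssum g s <= S.

(** Lists without repetition stand for finite subsets, so that no enumeration of the index set is
    chosen and sums can be reindexed by any bijection. *)
Definition nsum f : R := sup [set ssum f s | s in [set s | uniq s]].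

Definition tsum f : R :=
  nsum (fun k => Num.max (f k) 0) - nsum (fun k => Num.max (- f k) 0).

Lemma ssum_outside f s s0 : (forall k, 0 <= f k) -> uniq s -> uniq s0 ->
  ssum f s <= ssum f s0 + ssum f [seq k <- s | k \notin s0].
Proof.
move=> f0 us us0; rewrite /ssum (bigID (mem s0)) /= -big_filter -[X in _ + X]big_filter.
rewrite lerD2r.
have pb : perm_eq [seq i <- s | i \in s0] [seq i <- s0 | i \in s].
  by apply: uniq_perm; rewrite ?filter_uniq// => k; rewrite !mem_filter andbC.
rewrite (perm_big _ pb)/= big_filter [leRHS](bigID (mem s))/= lerDl.
exact: sumr_ge0.
Qed.

Lemma summable_tail g S : summable_bound g S -> forall eps, 0 < eps ->
  exists2 s0, uniq s0 & forall s, uniq s -> (forall k, k \in s -> k \notin s0) ->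
    ssum g s <= eps.
Proof.
move=> [g0 gS] eps eps0.
pose A := [set ssum g s | s in [set s | uniq s]].
have hA : has_sup A.
  split; first by exists 0; exists [::] => //; rewrite /ssum big_nil.
  by exists S => _ [s us <-]; exact: gS.
have [_ [s0 us0 <-] hs0] := sup_adherent eps0 hA.
exists s0 => // s us dis.
have us' : uniq (s0 ++ s).
  rewrite cat_uniq us0 us andbT /=; apply/hasPn => k /dis; exact.
have : ssum g (s0 ++ s) <= sup A.
  by apply: sup_ubound; [case: hA|exists (s0 ++ s)].
by rewrite /ssum big_cat /=; move: hs0; rewrite /ssum; lra.
Qed.

Lemma nsum_net g S : summable_bound g S -> forall eps, 0 < eps ->
  exists2 s0, uniq s0 & forall f, (forall k, 0 <= f k <= g k) ->
    forall s, uniq s -> {subset s0 <= s} -> ssum f s <= nsum f <= ssum f s + eps.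
Proof.
move=> hg eps eps0; have [s0 us0 h] := summable_tail hg eps0; exists s0 => // f fg s us sub.
have f0 k : 0 <= f k by case/andP: (fg k).
have hle s' : uniq s' -> ssum f s' <= ssum f s + eps.
  move=> us'; apply: le_trans (ssum_outside f0 us' us) _; rewrite lerD2l.
  apply: (@le_trans _ _ (ssum g [seq k <- s' | k \notin s])).
    by apply: ler_sum => k _; case/andP: (fg k).
  apply: h; first by rewrite filter_uniq.
  by move=> k; rewrite mem_filter => /andP[+ _]; apply: contraNN; exact: sub.
apply/andP; split.
  apply: sup_ubound; last by exists s.
  by exists (ssum f s + eps) => _ [s' us' <-]; exact: hle.
apply: ge_sup; first by exists (ssum f s); exists s.
by move=> _ [s' us' <-]; exact: hle.
Qed.

(** The finite set [s0] depends on the dominating [g] alone, so convergence is uniform over all [f]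
    that [g] dominates. The exchange of sum and integral relies on this. *)
Lemma tsum_net g S : summable_bound g S -> forall eps, 0 < eps ->
  exists2 s0, uniq s0 & forall f, (forall k, `|f k| <= g k) ->
    forall s, uniq s -> {subset s0 <= s} -> `|ssum f s - tsum f| <= eps.
Proof.
move=> hg eps eps0; have [s0 us0 h] := nsum_net hg eps0; exists s0 => // f fg s us sub.
have hp : forall k, 0 <= Num.max (f k) 0 <= g k.
  move=> k; rewrite le_max lexx orbT /= ge_max hg.1 andbT.
  exact: le_trans (ler_norm _) (fg k).
have hm : forall k, 0 <= Num.max (- f k) 0 <= g k.
  move=> k; rewrite le_max lexx orbT /= ge_max hg.1 andbT.
  by apply: le_trans (ler_norm _) _; rewrite normrN.
have E : ssum f s = ssum (fun k => Num.max (f k) 0) s - ssum (fun k => Num.max (- f k) 0) s.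
  rewrite /ssum -sumrB; apply: eq_bigr => k _.
  have [f0|f0] := leP 0 (f k).
    by rewrite max_r ?subr0// oppr_le0.
  by rewrite max_l ?sub0r ?opprK// oppr_ge0 ltW.
have := h _ hp s us sub; have := h _ hm s us sub.
rewrite E /tsum ler_norml => /andP[a1 a2] /andP[b1 b2].
move: (nsum _) (nsum _) (ssum _ _) (ssum _ _) a1 a2 b1 b2 => x y z t a1 a2 b1 b2.
apply/andP; split; lra.
Qed.

Lemma tsum_unique g S f v : summable_bound g S -> (forall k, `|f k| <= g k) ->
  (forall eps, 0 < eps -> exists s0, forall s, uniq s -> {subset s0 <= s} ->
    `|ssum f s - v| <= eps) -> tsum f = v.
Proof.
move=> hg fg h; apply/eqP; rewrite eq_sym -subr_eq0 -normr_eq0.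
apply/eqP/le_anti; rewrite normr_ge0 andbT.
apply/ler_addgt0Pl => eps eps0; rewrite addr0.
have e2 : 0 < eps / 2 by rewrite divr_gt0.
have [s0 us0 h0] := tsum_net hg e2; have [s1 h1] := h _ e2.
pose s := undup (s0 ++ s1).
have us : uniq s by exact: undup_uniq.
have h2 : `|ssum f s - tsum f| <= eps / 2.
  by apply: h0 => // k ks; rewrite mem_undup mem_cat ks.
have h3 : `|ssum f s - v| <= eps / 2.
  by apply: h1 => // k ks; rewrite mem_undup mem_cat ks orbT.
by have := ler_distD (ssum f s) v (tsum f); rewrite [`|v - ssum f s|]distrC; lra.
Qed.

Lemma summable_boundD g g' S S' : summable_bound g S -> summable_bound g' S' ->
  summable_bound (fun k => g k + g' k) (S + S').
Proof.
move=> [g0 gS] [g'0 g'S]; split=> [k|s us]; first by rewrite addr_ge0.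
by rewrite /ssum big_split lerD ?gS ?g'S.
Qed.

Lemma summable_boundZ g S c : 0 <= c -> summable_bound g S ->
  summable_bound (fun k => c * g k) (c * S).
Proof.
move=> c0 [g0 gS]; split=> [k|s us]; first by rewrite mulr_ge0.
by rewrite /ssum -mulr_sumr ler_wpM2l// gS.
Qed.

Lemma tsumD g S f f' : summable_bound g S -> (forall k, `|f k| <= g k) ->
  (forall k, `|f' k| <= g k) -> tsum (fun k => f k + f' k) = tsum f + tsum f'.
Proof.
move=> hg fg f'g; apply: (tsum_unique (summable_boundD hg hg)) => [k|eps eps0].
  by apply: le_trans (ler_normD _ _) _; exact: lerD.
have e2 : 0 < eps / 2 by rewrite divr_gt0.
have [s0 us0 h0] := tsum_net hg e2; exists s0 => s us sub.
have := h0 _ fg s us sub; have := h0 _ f'g s us sub.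
rewrite /ssum big_split /= => h1 h2.
rewrite opprD addrACA; apply: le_trans (ler_normD _ _) _; lra.
Qed.

Lemma tsumZ g S f c : summable_bound g S -> (forall k, `|f k| <= g k) ->
  tsum (fun k => c * f k) = c * tsum f.
Proof.
move=> hg fg; apply: (tsum_unique (summable_boundZ (normr_ge0 c) hg)) => [k|eps eps0].
  by rewrite normrM ler_wpM2l.
have c1 : 0 < `|c| + 1 by rewrite ltr_wpDl.
have [s0 us0 h0] := tsum_net hg (divr_gt0 eps0 c1); exists s0 => s us sub.
have := h0 _ fg s us sub; rewrite /ssum -mulr_sumr -mulrBr normrM => h.
apply: (@le_trans _ _ ((`|c| + 1) * `|ssum f s - tsum f|)).
  by rewrite ler_wpM2r// lerDl.
by rewrite mulrC -ler_pdivlMr.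
Qed.

Lemma tsumN g S f : summable_bound g S -> (forall k, `|f k| <= g k) ->
  tsum (fun k => - f k) = - tsum f.
Proof.
move=> hg fg; rewrite -mulN1r -(tsumZ _ hg fg); congr tsum.
by apply/funext => k; rewrite mulN1r.
Qed.

Lemma tsumB g S f f' : summable_bound g S -> (forall k, `|f k| <= g k) ->
  (forall k, `|f' k| <= g k) -> tsum (fun k => f k - f' k) = tsum f - tsum f'.
Proof.
move=> hg fg f'g; rewrite -(tsumN hg f'g); apply: (tsumD hg fg) => k.
by rewrite normrN.
Qed.

Lemma tsum_sum (I : Type) (r : seq I) g S (f : I -> L -> R) : summable_bound g S ->
  (forall i k, `|f i k| <= g k) ->
  tsum (fun k => \sum_(i <- r) f i k) = \sum_(i <- r) tsum (f i).
Proof.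
move=> hg fg; elim: r => [|i r IH].
  rewrite big_nil (_ : (fun=> _) = fun=> 0); last by apply/funext => k; rewrite big_nil.
  apply: (tsum_unique hg) => [k|eps eps0]; first by rewrite normr0 hg.1.
  by exists [::] => s _ _; rewrite /ssum big1// subrr normr0 ltW.
rewrite big_cons -IH.
have hr := summable_boundZ (ler0n R (size r).+1) hg.
have bnd k c : `|c| <= g k -> `|c| <= (size r).+1%:R * g k.
  by move=> /le_trans; apply; rewrite -[leLHS]mul1r ler_wpM2r ?hg.1// ler1n.
rewrite -(tsumD hr).
- by congr tsum; apply/funext => k; rewrite big_cons.
- by move=> k; exact: bnd.
- move=> k; apply: (@le_trans _ _ ((size r)%:R * g k)).
    elim: {IH hr bnd} r => [|j r IH]; first by rewrite big_nil normr0 mul0r.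
    rewrite big_cons; apply: le_trans (ler_normD _ _) _.
    by rewrite /= -natr1 mulrDl mul1r addrC lerD.
  by rewrite ler_wpM2r ?hg.1// ler_nat.
Qed.

Lemma tsum_bound g S f c : summable_bound g S -> 0 <= c ->
  (forall k, `|f k| <= c * g k) -> `|tsum f| <= c * S.
Proof.
move=> hg c0 fg; have hcg := summable_boundZ c0 hg.
apply/ler_addgt0Pl => eps eps0; have [s0 us0 h0] := tsum_net hcg eps0.
have := h0 _ fg s0 us0 (fun _ => id).
have : `|ssum f s0| <= c * S.
  apply: le_trans (hcg.2 _ us0); apply: le_trans (ler_norm_sum _ _ _) _.
  by apply: ler_sum => k _; exact: fg.
have := ler_distD (ssum f s0) (tsum f) 0; rewrite !subr0 [`|tsum f - _|]distrC; lra.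
Qed.

Lemma tsum_bij g S f (s : L -> L) : bijective s -> summable_bound g S ->
  (forall k, `|f k| <= g k) -> (forall k, `|f (s k)| <= g k) ->
  tsum (fun k => f (s k)) = tsum f.
Proof.
move=> [t st ts] hg fg fsg; apply: (tsum_unique hg fsg) => eps eps0.
have [s0 us0 h0] := tsum_net hg eps0; exists (map t s0) => r ur sub.
have := h0 _ fg (map s r); rewrite /ssum big_map; apply.
  by rewrite map_inj_uniq//; exact: can_inj st.
by move=> k ks0; rewrite -[k]ts; apply/map_f/sub/map_f.
Qed.

End Tsum.

(** * Summability over the lattice *)

Section Counting.
Context {R : realType} {d : nat}.
Notation W := (@lat_weight R d).

Lemma sum_inv_sqr n : \sum_(j < n) (1 + j%:R)^-2 <= 2 - 2 / (n%:R + 1) :> R.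
Proof.
elim: n => [|n IH]; first by rewrite big_ord0 add0r divr1 subrr.
rewrite big_ord_recr /=; apply: le_trans (lerD IH (lexx _)) _.
rewrite -[n.+1%:R]natr1; have : 0 <= n%:R :> R by [].
move: (n%:R : R) => x x0.
have -> : 2 - 2 / (x + 1 + 1) = 2 - 2 / (x + 1) + 2 / ((x + 1) * (x + 2)).
  by field; rewrite !gt_eqF//; lra.
rewrite lerD2l -[leLHS]mul1r ler_pdivrMr ?exprn_gt0//; last by lra.
rewrite mulrAC ler_pdivlMr; last by rewrite mulr_gt0//; lra.
by rewrite mul1r; nra.
Qed.

Definition inv_sqr (n : int) : R := (1 + `|n%:~R|)^-2.

Lemma sum_inv_sqr_int N : \sum_(j < N + N.+1) inv_sqr ((j : nat)%:Z - N%:Z) <= 4.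
Proof.
have b n : \sum_(j < n) (1 + j%:R)^-2 <= 2 :> R.
  by apply: le_trans (sum_inv_sqr n) _; rewrite gerBl divr_ge0// addr_ge0.
rewrite big_split_ord /= (_ : 4 = 2 + 2); last by ring.
apply: lerD.
  rewrite (reindex_inj rev_ord_inj)/=; apply: le_trans (b N); apply: ler_sum => j _.
  rewrite /inv_sqr lef_pV2 ?posrE ?exprn_gt0 ?ltr_wpDr//.
  rewrite lerXn2r ?nnegrE ?addr_ge0// lerD2l.
  have -> : ((N - j.+1)%N%:Z - N%:Z)%:~R = - (j.+1%:R) :> R.
    by rewrite -subzn ?ltn_ord// addrAC subrr add0r rmorphN.
  by rewrite normrN ger0_norm// ler_nat.
apply: le_trans (b N.+1); apply: ler_sum => j _.
by rewrite /inv_sqr PoszD [N%:Z + _]addrC addrK ger0_norm.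
Qed.

Lemma weight_prod (k : 'rV[int]_d) : W k ^- (2 * d) <= \prod_i inv_sqr (k 0 i).
Proof.
have Wk : 0 < W k by exact: lt_le_trans ltr01 (lat_weight_ge1 k).
have P0 : 0 < \prod_i (1 + `|(k 0 i)%:~R| : R) ^+ 2.
  by apply: prodr_gt0 => i _; rewrite exprn_gt0// ltr_wpDr.
rewrite /inv_sqr prodfV lef_pV2 ?posrE ?exprn_gt0//.
rewrite exprM -[X in _ ^+ X]card_ord -prodr_const; apply: ler_prod => i _.
rewrite exprn_ge0 ?addr_ge0//= lerXn2r ?nnegrE ?addr_ge0//.
by rewrite lerD2l; have := coord_le (map_mx intr k : 'rV[R]_d) i; rewrite mxE.
Qed.

(** The exponent [2 * d] lets [weight_prod] dominate the term by a product over the coordinates,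
    whose sum over a cube is the [d]-th power of a convergent one-dimensional sum. *)
Lemma lattice_summable : exists S, summable_bound (fun k => W k ^- (2 * d)) S.
Proof.
exists (\prod_(i < d) 4); split=> [k|s us].
  by rewrite invr_ge0 exprn_ge0// (le_trans ler01)// lat_weight_ge1.
apply: (@le_trans _ _ (ssum (fun k : 'rV[int]_d => \prod_i inv_sqr (k 0 i)) s)).
  by apply: ler_sum => k _; exact: weight_prod.
(* Any finite set of lattice points lies in a cube [[-N, N]^d], with [N + N.+1] integers on each
   edge. *)
pose N := (\max_(k <- s) \max_(i < d) `|(k : 'rV[int]_d) 0%R i|)%N.
have hN k i : k \in s -> (`|k 0%R i| <= N)%N.
  move=> ks; apply: (@leq_trans (\max_(i < d) `|k 0%R i|)%N).
    exact: (@leq_bigmax _ (fun i => `|k 0%R i|)%N).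
  by rewrite /N (big_rem k ks)/= leq_maxl.
pose pt (x : {ffun 'I_d -> 'I_(N + N.+1)}) : 'rV[int]_d := \row_i ((x i : nat)%:Z - N%:Z).
have pt_inj : injective pt.
  move=> x y /rowP E; apply/ffunP => i; apply/val_inj; have := E i; rewrite !mxE.
  by move=> /addIr [].
have f0 k : 0 <= \prod_i inv_sqr ((k : 'rV[int]_d) 0 i).
  by apply: prodr_ge0 => i _; rewrite invr_ge0 exprn_ge0// addr_ge0.
have ut : uniq (map pt (index_enum {ffun 'I_d -> 'I_(N + N.+1)})).
  by rewrite map_inj_uniq// index_enum_uniq.
apply: le_trans (ssum_outside f0 us ut) _.
rewrite (_ : [seq k <- s | _] = [::]); last first.
  apply/eqP; rewrite -size_eq0 size_filter -leqn0 leqNgt -has_count.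
  apply/hasPn => k ks; rewrite negbK; apply/mapP.
  have hlt i : (`|(k 0 i + N%:Z)%R| < N + N.+1)%N by have := hN k i ks; lia.
  exists [ffun i => Ordinal (hlt i)]; first by rewrite mem_index_enum.
  apply/rowP => i; rewrite mxE ffunE /=.
  move: (hN k i ks); move: (k 0 i) => z. lia.
rewrite {2}/ssum big_nil addr0 /ssum big_map.
under eq_bigr do under eq_bigr do rewrite mxE.
rewrite -(bigA_distr_bigA (fun (i : 'I_d) (j : 'I_(N + N.+1)) => inv_sqr ((j : nat)%:Z - N%:Z))).
apply: ler_prod => i _; rewrite sum_inv_sqr_int andbT.
by apply: sumr_ge0 => j _; rewrite invr_ge0 exprn_ge0// addr_ge0.
Qed.

Lemma weight_lt_finite (M : R) : exists s : seq 'rV[int]_d, forall k, W k < M -> k \in s.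
Proof.
pose N := `|Num.ceil M|%N.
pose pt (x : {ffun 'I_d -> 'I_(N + N.+1)}) : 'rV[int]_d := \row_i ((x i : nat)%:Z - N%:Z).
exists (map pt (index_enum {ffun 'I_d -> 'I_(N + N.+1)})) => k kM; apply/mapP.
have hN i : (`|k 0%R i| <= N)%N.
  have := coord_le (map_mx intr k : 'rV[R]_d) i; rewrite mxE => h.
  have : `|(k 0 i)%:~R| < M by apply: le_lt_trans h _; move: kM; rewrite /lat_weight; lra.
  move=> {h}; rewrite -intr_norm => h; have := lt_le_trans h (ceil_ge M).
  rewrite ltr_int /N; move: (Num.ceil M) (k 0 i) => c z. lia.
have hlt i : (`|(k 0 i + N%:Z)%R| < N + N.+1)%N by have := hN i; lia.
exists [ffun i => Ordinal (hlt i)]; first by rewrite mem_index_enum.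
apply/rowP => i; rewrite mxE ffunE /=.
by move: (hN i); move: (k 0 i) => z; lia.
Qed.

End Counting.

(** * Summation by parts *)

Section Everywhere.
Context {R : realType} {d : nat}.
Notation L := 'rV[int]_d.
Notation W := (@lat_weight R d).
Notation E := (@lat_dir d).

Definition everywhere : set_system L := [set P | forall k, P k].

Lemma everywhere_setting : symbol_setting E W everywhere.
Proof.
split; [|exact: lat_lattice_weight|by move=> j P h k; exact: h].
by split=> [//|P Q hP hQ k|P Q PQ hP k]; [split; [exact: hP|exact: hQ]|apply: PQ].
Qed.

Let hE := everywhere_setting.
Let hI := at_infinity_setting (@lat_lattice_weight R d).

(** The finitely many [k] below the threshold are absorbed by the constant. This works for a single
    function; for an infinite family the values at those [k] could be unbounded. *)
Lemma sym_everywhere n m (a : unit -> L -> R) :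
  sym E W (at_infinity W) n m [set: unit] a -> sym E W everywhere n m [set: unit] a.
Proof.
have hb m' (b : unit -> L -> R) :
    bnd W (at_infinity W) m' [set: unit] b -> bnd W everywhere m' [set: unit] b.
  move=> /(bnd_ex hI)[C C0 [M hM]]; have [s hs] := @weight_lt_finite R d M.
  exists (C + \sum_(k <- s) `|b tt k| / W k ^ m') => k [] _.
  have p k' : 0 <= `|b tt k'| / W k' ^ m'.
    by rewrite divr_ge0// ltW// (wz_gt0 hE).
  have S0 : 0 <= \sum_(k <- s) `|b tt k| / W k ^ m' by exact: sumr_ge0.
  have Wp := wz_gt0 hE k m'.
  have [/hM/(_ tt I) h|/hs ks] := leP M (W k).
    by apply: le_trans h _; rewrite ler_wpM2r ?(ltW Wp)// lerDl.
  rewrite -ler_pdivrMr// (big_rem k ks)/= addrCA lerDl addr_ge0 ?(ltW C0)//.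
  exact: sumr_ge0.
elim: n m a => [|n IH] m a [ha ha'] /=; split=> //; try exact: hb.
by move=> j; exact: IH (ha' j).
Qed.

Lemma sym_finite_support n m (a : L -> R) M : (forall k, M <= W k -> a k = 0) ->
  sym E W everywhere n m [set: unit] (fun=> a).
Proof.
move=> h; apply: sym_everywhere; apply: (sym_ext hI _ (sym0 hI n m [set: unit])).
by exists M => k Mk i _; rewrite h.
Qed.

Lemma sym_eventually_cst n (a : L -> R) M c : (forall k, M <= W k -> a k = c) ->
  sym E W everywhere n 0 [set: unit] (fun=> a).
Proof.
move=> h; apply: sym_everywhere.
apply: (sym_ext hI _ (@sym_cst _ _ _ _ _ _ hI _ n [set: unit] (fun=> c) _)).
  by exists M => k Mk i _; rewrite h.
by exists `|c|.
Qed.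

Section TauSymbol.
Variables (V : set R).
Hypothesis oV : open V.

Definition dtau (a : R -> L -> R) : R -> L -> R := fun t k => derive1 (fun u => a u k) t.

(** Amplitudes depending smoothly on [tau], whose [tau]-derivatives cost no order, in contrast with
    those of the oscillating factor. *)
Fixpoint tsymN (N : nat) (m : int) (a : R -> L -> R) : Prop :=
  (forall n, sym E W everywhere n m V a) /\
  match N with
  | 0 => True
  | N'.+1 => (forall k t, V t -> derivable (fun u => a u k) t 1) /\ tsymN N' m (dtau a)
  end.

Definition tsym m a := forall N, tsymN N m a.

Lemma near_V t (P : R -> Prop) : V t -> (forall u, V u -> P u) -> \forall u \near t, P u.
Proof.
move=> Vt h; have : nbhs t V by exact: open_nbhs_nbhs.
by apply: filterS => u /h.
Qed.

Lemma tsymN_ext N m a b : (forall t k, V t -> a t k = b t k) ->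
  tsymN N m a -> tsymN N m b.
Proof.
elim: N a b => [|N IH] a b ab [ha ha'] /=.
  by split=> // n; apply: (sym_ext hE _ (ha n)) => k t Vt; exact: ab.
have nE t k : V t -> \forall u \near t, a u k = b u k.
  by move=> Vt; apply: near_V => // u Vu; exact: ab.
split; first by move=> n; apply: (sym_ext hE _ (ha n)) => k t Vt; exact: ab.
split; last first.
  apply: IH ha'.2 => t k Vt; rewrite /dtau !derive1E.
  by apply: near_eq_derive; exact: nE.
move=> k t Vt; apply: (near_eq_derivable (nE _ _ Vt)).
exact: ha'.1.
Qed.

Lemma tsym_ext m a b : (forall t k, V t -> a t k = b t k) -> tsym m a -> tsym m b.
Proof. by move=> ab h N; exact: tsymN_ext ab (h N). Qed.

Lemma tsym_sym n m a : tsym m a -> sym E W everywhere n m V a.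
Proof. by move=> /(_ 0%N)[]. Qed.

Lemma tsym_derivable m (a : R -> L -> R) k (t : R) : tsym m a -> V t -> derivable (fun u => a u k) t 1.
Proof. by move=> /(_ 1%N)[_ [+ _]]; exact. Qed.

Lemma tsym_is_derive m (a : R -> L -> R) k (t : R) : tsym m a -> V t -> is_derive t 1 (fun u => a u k) (dtau a t k).
Proof.
by move=> ha Vt; rewrite /dtau derive1E; apply: derivableP; exact: tsym_derivable ha Vt.
Qed.

Lemma tsym_dtau m a : tsym m a -> tsym m (dtau a).
Proof. by move=> ha N; have [_ []] := ha N.+1. Qed.

Lemma tsymNW N m a : tsymN N.+1 m a -> tsymN N m a.
Proof.
by elim: N a => [|N IH] a [h1 [h2 h3]]; split=> //; split=> //; exact: IH.
Qed.

Lemma is_derive_dtau (a : R -> L -> R) k (t l : R) : is_derive t 1 (fun u => a u k) l -> dtau a t k = l.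
Proof. by move=> h; rewrite /dtau derive1E derive_val. Qed.

Lemma tsymN_step N m (a b : R -> L -> R) : (forall n, sym E W everywhere n m V a) ->
  (forall k (t : R), V t -> is_derive t 1 (fun u => a u k) (b t k)) ->
  tsymN N m b -> tsymN N.+1 m a.
Proof.
move=> ha hab hb; split=> //; split; first by move=> k t Vt; have [] := hab k t Vt.
by apply: tsymN_ext hb => t k Vt; rewrite (is_derive_dtau (hab k t Vt)).
Qed.

Lemma tsymN_derive N m (a : R -> L -> R) k (t : R) : tsymN N.+1 m a -> V t ->
  is_derive t 1 (fun u => a u k) (dtau a t k).
Proof. by move=> [_ [h _]] Vt; rewrite /dtau derive1E; apply: derivableP; exact: h. Qed.

Lemma tsymN_add N m a b : tsymN N m a -> tsymN N m b ->
  tsymN N m (fun t k => a t k + b t k).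
Proof.
elim: N a b => [|N IH] a b ha hb.
  by split=> // n; apply: (sym_add hE); [exact: ha.1|exact: hb.1].
apply: tsymN_step (IH _ _ ha.2.2 hb.2.2).
  by move=> n; apply: (sym_add hE); [exact: ha.1|exact: hb.1].
move=> k t Vt; have h1 := tsymN_derive k ha Vt; have h2 := tsymN_derive k hb Vt.
exact: is_deriveD.
Qed.

Lemma tsymN_le N m m' a : m <= m' -> tsymN N m a -> tsymN N m' a.
Proof.
move=> mm'; elim: N a => [|N IH] a [h1 h2].
  by split=> // n; exact: (sym_le hE mm' (h1 n)).
by split=> [n|]; [exact: (sym_le hE mm' (h1 n))|split; [exact: h2.1|exact: IH h2.2]].
Qed.

Lemma tsymN_mul N m m' a b : tsymN N m a -> tsymN N m' b ->
  tsymN N (m + m') (fun t k => a t k * b t k).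
Proof.
elim: N m m' a b => [|N IH] m m' a b ha hb.
  by split=> // n; apply: (sym_mul hE); [exact: ha.1|exact: hb.1].
apply: (@tsymN_step _ _ _ (fun t k => a t k * dtau b t k + b t k * dtau a t k)).
- by move=> n; apply: (sym_mul hE); [exact: ha.1|exact: hb.1].
- move=> k t Vt; have h1 := tsymN_derive k ha Vt; have h2 := tsymN_derive k hb Vt.
  exact: is_deriveM.
- apply: tsymN_add; first exact: IH (tsymNW ha) hb.2.2.
  by rewrite addrC; exact: IH (tsymNW hb) ha.2.2.
Qed.

Lemma tsym_add m a b : tsym m a -> tsym m b -> tsym m (fun t k => a t k + b t k).
Proof. by move=> ha hb N; exact: tsymN_add. Qed.

Lemma tsym_mul m m' a b : tsym m a -> tsym m' b ->
  tsym (m + m') (fun t k => a t k * b t k).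
Proof. by move=> ha hb N; exact: tsymN_mul. Qed.

Lemma tsym_le m m' a : m <= m' -> tsym m a -> tsym m' a.
Proof. by move=> mm' ha N; exact: tsymN_le mm' (ha N). Qed.

Lemma sym_cst_param n m (a : L -> R) : sym E W everywhere n m [set: unit] (fun=> a) ->
  sym E W everywhere n m V (fun _ => a).
Proof. exact: (sym_comp_param hE (f := fun _ : R => tt)). Qed.

Lemma tsym_cst m (a : L -> R) :
  (forall n, sym E W everywhere n m [set: unit] (fun=> a)) -> tsym m (fun=> a).
Proof.
move=> ha; have z N : tsymN N m (fun _ _ => 0).
  elim: N => [|N IH]; first by split=> // n; exact: sym0.
  by apply: tsymN_step IH => [n|k t Vt]; [exact: sym0|exact: is_derive_cst].
move=> [|N]; first by split=> // n; exact: sym_cst_param.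
apply: tsymN_step (z N) => [n|k t Vt]; first exact: sym_cst_param.
exact: is_derive_cst.
Qed.

Lemma tsym_opp m a : tsym m a -> tsym m (fun t k => - a t k).
Proof.
move=> ha; have := tsym_mul (@tsym_cst 0 (fun=> -1) _) ha; rewrite add0r => h.
apply: tsym_ext (h _); first by move=> t k _; rewrite mulN1r.
by move=> n; apply: (@sym_eventually_cst _ _ 0 (-1)).
Qed.

Lemma tsym_sum {I : Type} (r : seq I) m (a : I -> R -> L -> R) :
  (forall i, tsym m (a i)) -> tsym m (fun t k => \sum_(i <- r) a i t k).
Proof.
move=> ha; elim: r => [|i r IH].
  apply: tsym_ext (@tsym_cst m (fun=> 0) _) => [t k _|n]; first by rewrite big_nil.
  by apply: (@sym_finite_support _ _ _ 0).
by apply: tsym_ext (tsym_add (ha i) IH) => t k _; rewrite big_cons.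
Qed.

Lemma tsymN_shf N m j a : tsymN N m a -> tsymN N m (fun t k => a t (k + E j)).
Proof.
elim: N a => [|N IH] a ha.
  by split=> // n; exact: (sym_shf hE j (ha.1 n)).
apply: tsymN_step (IH _ ha.2.2).
  by move=> n; exact: (sym_shf hE j (ha.1 n)).
by move=> k t Vt; exact: (tsymN_derive (k + E j) ha Vt).
Qed.

Lemma tsymN_dif N m j a : tsymN N m a -> tsymN N (m - 1) (fun t k => a t (k + E j) - a t k).
Proof.
elim: N a => [|N IH] a ha.
  by split=> // n; exact: (sym_difS hE j (ha.1 n.+1)).
apply: tsymN_step (IH _ ha.2.2).
  by move=> n; exact: (sym_difS hE j (ha.1 n.+1)).
move=> k t Vt; have h1 := tsymN_derive (k + E j) ha Vt; have h2 := tsymN_derive k ha Vt.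
exact: is_deriveB.
Qed.

Lemma tsym_inv a c : 0 < c -> (forall t k, V t -> c <= `|a t k|) -> tsym 0 a ->
  tsym 0 (fun t k => (a t k)^-1).
Proof.
move=> c0 ac ha.
have ell : elliptic W everywhere 0 V a.
  by exists c => // k t Vt; rewrite mulr1; exact: ac.
have hs n : sym E W everywhere n 0 V (fun t k => (a t k)^-1).
  by have := sym_inv hE ell (tsym_sym n ha); rewrite oppr0.
elim=> [|N IH]; first by split.
apply: (@tsymN_step _ _ _ (fun t k => - dtau a t k * ((a t k)^-1 * (a t k)^-1))) => //.
  move=> k t Vt; have h1 := tsym_is_derive k ha Vt.
  have a0 : a t k != 0 by rewrite -normr_gt0; apply: lt_le_trans (ac t k Vt).
  have := is_deriveV a0 h1; move=> h; apply: (@is_derive_eq _ _ _ _ _ _ _ _ h).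
  by rewrite /GRing.scale /=; field.
have h1 := tsym_opp (tsym_dtau ha).
have h2 : tsymN N (0 + (0 + 0)) (fun t k => - dtau a t k * ((a t k)^-1 * (a t k)^-1)).
  by apply: tsymN_mul (h1 N) (tsymN_mul IH IH).
by move: h2; rewrite !addr0.
Qed.

Lemma tsym_trig (s : L -> R) (T : R) : (forall t, V t -> `|t| <= T) ->
  (forall n, sym E W everywhere n 0 [set: unit] (fun=> s)) ->
  tsym 0 (fun t k => cos (t * s k)) /\ tsym 0 (fun t k => sin (t * s k)).
Proof.
move=> VT hs.
have hsym n : sym E W everywhere n 0 V (fun t k => t * s k).
  by apply: (sym_scale hE (c := id)); [exists T|exact: sym_cst_param].
have H N : tsymN N 0 (fun t k => cos (t * s k)) /\ tsymN N 0 (fun t k => sin (t * s k)).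
  elim: N => [|N [IHc IHs]].
    by split; split=> // n; have [] := sym_trig hE (hsym n).
  have d1 k (t : R) : is_derive t 1 (fun u : R => u * s k) (s k).
    by apply: is_derive_eq; rewrite scaler0 add0r [_%:A]mulr1.
  have ms := tsym_cst hs N.
  split.
    apply: (@tsymN_step _ _ _ (fun t k => - s k * sin (t * s k))).
    - by move=> n; have [] := sym_trig hE (hsym n).
    - by move=> k t Vt; apply: is_derive_eq; rewrite mulNr mulrC mulNr.
    - have := tsymN_mul (tsym_opp (tsym_cst hs) N) IHs; rewrite addr0; exact.
  apply: (@tsymN_step _ _ _ (fun t k => s k * cos (t * s k))).
  - by move=> n; have [] := sym_trig hE (hsym n).
  - by move=> k t Vt; apply: is_derive_eq; rewrite mulrC.
  - have := tsymN_mul ms IHc; rewrite addr0; exact.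
by split=> N; have [] := H N.
Qed.

End TauSymbol.
End Everywhere.

Lemma taylor2_bound (R : realType) (u u' u'' : R -> R) (t h M : R) :
  (forall s, 0 <= s <= 1 -> is_derive (t + s * h) 1 u (u' (t + s * h))) ->
  (forall s, 0 <= s <= 1 -> is_derive (t + s * h) 1 u' (u'' (t + s * h))) ->
  (forall s, 0 <= s <= 1 -> `|u'' (t + s * h)| <= M) ->
  `|u (t + h) - u t - h * u' t| <= M * h ^+ 2.
Proof.
move=> du du' hM.
have daff c (s : R) : is_derive s 1 (fun s : R => t + s * c) c.
  by apply: is_derive_eq; rewrite scaler0 !add0r mul1r [_%:A]mulr1.
have M0 : 0 <= M.
  have H : 0 <= (0 : R) <= 1 by rewrite lexx ler01.
  exact: le_trans (normr_ge0 _) (hM 0 H).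
have h1 s : 0 <= s <= 1 -> `|u' (t + s * h) - u' t| <= M * `|h|.
  move=> /andP[s0 s1].
  have := @mvt_bound R (fun r => u' (t + r * (s * h))) (fun r => u'' (t + r * (s * h)) * (s * h)) (M * `|h|).
  rewrite mul1r mul0r addr0; apply => r /andP[r0 r1].
    have rs : 0 <= r * s <= 1 by rewrite mulr_ge0//= mulr_ile1.
    have := du' _ rs; rewrite -mulrA => d1.
    exact: (@is_derive1_comp _ u' (fun r => t + r * (s * h)) _ _ _ d1 (daff (s * h) r)).
  have rs : 0 <= r * s <= 1 by rewrite mulr_ge0//= mulr_ile1.
  have := hM _ rs; rewrite -mulrA => h2.
  rewrite normrM ler_pM// normrM ger0_norm// ler_piMl//.
have := @mvt_bound R (fun r => u (t + r * h) - r * (h * u' t))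
  (fun r => h * (u' (t + r * h) - u' t)) (M * h ^+ 2).
rewrite !mul1r !mul0r addr0 subr0 addrAC; apply => r r01.
  have dc := @is_derive1_comp _ u (fun r => t + r * h) _ _ _ (du _ r01) (daff h r).
  have dl : is_derive r 1 (fun r : R => r * (h * u' t)) (h * u' t).
    by apply: is_derive_eq; rewrite scaler0 add0r [_%:A]mulr1.
  have H := @is_deriveB _ _ _ _ _ _ _ _ _ dc dl; apply: (@is_derive_eq _ _ _ _ _ _ _ _ H).
  by rewrite mulrBr mulrC.
rewrite normrM -(real_normK (num_real h)) expr2 mulrCA.
by rewrite ler_wpM2l// h1.
Qed.

(** * One summation by parts *)

Section Oscillatory.
Context {R : realType} {d : nat}.
Notation L := 'rV[int]_d.
Notation W := (@lat_weight R d).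
Notation E := (@lat_dir d).
Let hE := @everywhere_setting R d.

Variables (t0 dl : R) (l : L -> R) (M0 c0 : R).
Hypothesis (c0_gt0 : 0 < c0).
Definition Vint : set R := [set t | `|t - t0| < dl].
Notation V := Vint.
Hypothesis hl : forall n, sym E W everywhere n 1 [set: unit] (fun=> l).

Definition incr (i : 'I_d) (k : L) : R := l (k + E (i, false)) - l k.

Hypothesis nonresonant : forall t k, V t -> M0 <= W k ->
  c0 <= \sum_i 2 * (1 - cos (t * incr i k)).

Lemma Vint_open : open V.
Proof.
rewrite (_ : V = ball t0 dl); first exact: ball_open.
by apply/seteqP; split=> t; rewrite /V /= -ball_normE /= distrC.
Qed.

Let oV := Vint_open.

Lemma Vint_bound t : V t -> `|t| <= `|t0| + dl.
Proof.
move=> Vt; rewrite -[t](subrK t0); apply: le_trans (ler_normD _ _) _.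
by rewrite addrC lerD2l ltW.
Qed.

(* The real part of (a1 + i a2) exp(- i t l). *)
Definition pair (a : (R -> L -> R) * (R -> L -> R)) t k : R :=
  a.1 t k * cos (t * l k) + a.2 t k * sin (t * l k).

Definition cutoff (k : L) : R := if M0 <= W k then 1 else 0.

(** Where the cutoff is 1 this is [sum_i |q_i - 1|^2] for [q_i = exp(- i t (incr i))], bounded below
    by nonresonance; elsewhere it is 1, so that it can be inverted everywhere. *)
Definition den t k : R :=
  cutoff k * (\sum_i 2 * (1 - cos (t * incr i k))) + (1 - cutoff k).

Definition beta i t k : R := cutoff k * (cos (t * incr i k) - 1) * (den t k)^-1.
Definition gamma i t k : R := cutoff k * sin (t * incr i k) * (den t k)^-1.

(* With q_i = exp(- i t (incr i)), beta_i + i gamma_i is the conjugate of q_i - 1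
   divided by sum_j |q_j - 1|^2, and the amplitude is multiplied by it. *)
Definition coef (a : (R -> L -> R) * (R -> L -> R)) i : (R -> L -> R) * (R -> L -> R) :=
  ((fun t k => a.1 t k * beta i t k - a.2 t k * gamma i t k),
   (fun t k => a.1 t k * gamma i t k + a.2 t k * beta i t k)).

Definition back i (g : R -> L -> R) : R -> L -> R := fun t k => g t (k + E (i, true)).

(** Moving the shift by [e_i] from the phase to the amplitude leaves backward differences of
    [coef a i], one order lower. The last term keeps the amplitude where the cutoff vanishes; having
    finite support, it belongs to every order. *)
Definition step (a : (R -> L -> R) * (R -> L -> R)) : (R -> L -> R) * (R -> L -> R) :=
  ((fun t k => (\sum_i (back i (coef a i).1 t k - (coef a i).1 t k)) + (1 - cutoff k) * a.1 t k),
   (fun t k => (\sum_i (back i (coef a i).2 t k - (coef a i).2 t k)) + (1 - cutoff k) * a.2 t k)).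

Definition tsym2 m (a : (R -> L -> R) * (R -> L -> R)) := tsym V m a.1 /\ tsym V m a.2.

Lemma cutoff_tsym : tsym V 0 (fun=> cutoff).
Proof.
apply: tsym_cst => // n; apply: (@sym_eventually_cst _ _ n cutoff M0 1) => k Mk.
by rewrite /cutoff Mk.
Qed.

Lemma cutoffC_tsym m : tsym V m (fun _ k => 1 - cutoff k).
Proof.
apply: tsym_cst => // n; apply: (@sym_finite_support _ _ n m _ M0) => k Mk.
by rewrite /cutoff Mk subrr.
Qed.

Lemma cst_tsym (c : R) : tsym V 0 (fun _ (_ : L) => c).
Proof. by apply: tsym_cst => // n; apply: (@sym_eventually_cst _ _ n _ 0 c). Qed.

Lemma incr_trig i : tsym V 0 (fun t k => cos (t * incr i k)) /\
  tsym V 0 (fun t k => sin (t * incr i k)).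
Proof.
apply: (tsym_trig oV Vint_bound) => n.
by have := sym_difS hE (i, false) (hl n.+1); rewrite subrr.
Qed.

Lemma den_ge t k : V t -> Num.min c0 1 <= den t k.
Proof.
move=> Vt; rewrite /den /cutoff; case: ifPn => Mk.
  by rewrite mul1r subrr addr0 ge_min nonresonant.
by rewrite mul0r subr0 add0r ge_min lexx orbT.
Qed.

Lemma den_gt0 t k : V t -> 0 < den t k.
Proof. by move=> Vt; apply: lt_le_trans (den_ge k Vt); rewrite lt_min c0_gt0 ltr01. Qed.

Lemma tsymM0 (a b : R -> L -> R) : tsym V 0 a -> tsym V 0 b -> tsym V 0 (fun t k => a t k * b t k).
Proof. by move=> ha hb; have := tsym_mul oV ha hb; rewrite addr0. Qed.

Lemma den_inv_tsym : tsym V 0 (fun t (k : L) => (den t k)^-1).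
Proof.
apply: (@tsym_inv _ _ _ oV _ (Num.min c0 1)); first by rewrite lt_min c0_gt0 ltr01.
  by move=> t k Vt; rewrite ger0_norm ?den_ge// ltW// den_gt0.
apply: (tsym_add oV) (cutoffC_tsym 0); apply: tsymM0 cutoff_tsym _.
apply: tsym_sum => // i; apply: tsymM0 (cst_tsym 2) _.
apply: (tsym_add oV (cst_tsym 1)); apply: (tsym_opp oV); exact: (incr_trig i).1.
Qed.

Lemma beta_tsym i : tsym V 0 (beta i).
Proof.
apply: tsymM0 den_inv_tsym; apply: tsymM0 cutoff_tsym _.
exact: (tsym_add oV (incr_trig i).1 (cst_tsym (-1))).
Qed.

Lemma gamma_tsym i : tsym V 0 (gamma i).
Proof. by apply: tsymM0 den_inv_tsym; exact: (tsymM0 cutoff_tsym (incr_trig i).2). Qed.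

Lemma coef_tsym m a i : tsym2 m a -> tsym2 m (coef a i).
Proof.
move=> [h1 h2]; have hb := beta_tsym i; have hg := gamma_tsym i.
have p1 := tsym_mul oV h1 hb; have p2 := tsym_mul oV h2 hg.
have p3 := tsym_mul oV h1 hg; have p4 := tsym_mul oV h2 hb.
rewrite !addr0 in p1 p2 p3 p4; split.
  exact: (tsym_add oV p1 (tsym_opp oV p2)).
exact: (tsym_add oV p3 p4).
Qed.

Lemma back_tsym m i a : tsym V m a -> tsym V m (back i a).
Proof. by move=> h N; apply: tsymN_shf => //; exact: h. Qed.

Lemma step_tsym m a : tsym2 m a -> tsym2 (m - 1) (step a).
Proof.
move=> ha; have hc i := coef_tsym i ha.
have S (f : 'I_d -> R -> L -> R) (g : R -> L -> R) : (forall i, tsym V m (f i)) ->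
    tsym V m g -> tsym V (m - 1)
      (fun t k => (\sum_i (back i (f i) t k - f i t k)) + (1 - cutoff k) * g t k).
  move=> hf hg; apply: (tsym_add oV).
    by apply: tsym_sum => // i N; apply: tsymN_dif => //; exact: hf.
  have := tsym_mul oV (cutoffC_tsym (-1)) hg; rewrite addrC; exact.
split; apply: S.
- by move=> i; exact: (hc i).1.
- exact: ha.1.
- by move=> i; exact: (hc i).2.
- exact: ha.2.
Qed.

Definition backs i (g : (R -> L -> R) * (R -> L -> R)) := (back i g.1, back i g.2).

Lemma lat_dirK i k : k + E (i, false) + E (i, true) = k.
Proof. by rewrite /E /= expr0 expr1 scale1r scaleN1r addrK. Qed.

(** The factor [q_i - 1] times the phase at [k] is the phase at [k + e_i] minus that at [k];
    weighting by the conjugate of [q_i - 1] over [sum_j |q_j - 1|^2] and adding over [i] restores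
    the amplitude on the cutoff. The right side consists of exact differences in [k], which
    disappear on summation over the lattice. *)
Lemma step_pair a t k : V t ->
  pair a t k - pair (step a) t k =
  \sum_i (pair (backs i (coef a i)) t (k + E (i, false)) - pair (backs i (coef a i)) t k).
Proof.
move=> Vt; have D0 := den_gt0 k Vt.
have key i : pair (coef a i) t k * 0 + ((coef a i).1 t k * cos (t * l (k + E (i, false)))
    + (coef a i).2 t k * sin (t * l (k + E (i, false)))) - pair (coef a i) t k =
  pair a t k * (cutoff k * (2 * (1 - cos (t * incr i k))) / den t k).
  have -> : t * l (k + E (i, false)) = t * l k + t * incr i k by rewrite /incr; ring.
  rewrite cosD sinD /pair /coef /= /beta /gamma.
  have := cos2Dsin2 (t * incr i k).
  move: (cos (t * incr i k)) (sin (t * incr i k)) (cos (t * l k)) (sin (t * l k)).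
  move: (cutoff k) (den t k) D0 (a.1 t k) (a.2 t k) => x D D0 a1 a2 c s C S cs.
  have -> : 2 * (1 - c) = (c - 1) ^+ 2 + s ^+ 2 by rewrite -[X in 2 * (X - c)]cs; nra.
  by field; rewrite gt_eqF.
have sumkey : \sum_i cutoff k * (2 * (1 - cos (t * incr i k))) / den t k = cutoff k.
  rewrite -mulr_suml -mulr_sumr; move: D0; rewrite /den /cutoff; case: ifP => _ D0.
    by rewrite !mul1r in D0 *; rewrite subrr addr0 in D0 *; rewrite mulfV// gt_eqF.
  by rewrite !mul0r.
have -> : pair (step a) t k = \sum_i (pair (backs i (coef a i)) t k - pair (coef a i) t k)
    + (1 - cutoff k) * pair a t k.
  rewrite /pair /step /= !mulrDl mulrDr !mulr_suml addrACA -big_split /=.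
  by congr (_ + _); [apply: eq_bigr => i _; rewrite /backs /=; ring|ring].
have -> : pair a t k = cutoff k * pair a t k + (1 - cutoff k) * pair a t k by ring.
rewrite -{1}sumkey mulr_suml opprD addrACA.
have -> : (1 - cutoff k) * pair a t k - (1 - cutoff k) * (cutoff k * pair a t k + (1 - cutoff k) * pair a t k) = 0.
  by ring.
rewrite addr0 -sumrB; apply: eq_bigr => i _.
rewrite [_ / _ * _]mulrC -key mulr0 add0r /pair /backs /= /back lat_dirK; ring.
Qed.

End Oscillatory.

Section DerivExt.
Context {R : realType}.
Implicit Types (f g : R -> R) (V : set R).

Lemma derive1n_ext V f g n : open V -> (forall t, V t -> f t = g t) ->
  forall t, V t -> derive1n n f t = derive1n n g t.
Proof.
move=> oV fg; elim: n => [|n IH] t Vt; first exact: fg.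
rewrite !derive1nS !derive1E; apply: near_eq_derive.
by apply: (near_V oV Vt) => u; exact: IH.
Qed.

Lemma derivable_ext V f g t : open V -> (forall t, V t -> f t = g t) -> V t ->
  derivable f t 1 -> derivable g t 1.
Proof. by move=> oV fg Vt; apply: near_eq_derivable; exact: (near_V oV Vt). Qed.

Lemma derivable_derive1n_ext V f g n t : open V -> (forall t, V t -> f t = g t) -> V t ->
  derivable (derive1n n f) t 1 -> derivable (derive1n n g) t 1.
Proof. by move=> oV fg; apply: (derivable_ext oV); exact: derive1n_ext. Qed.

End DerivExt.

(** * Differentiable sums of oscillating terms *)

Section OscSum.
Context {R : realType} {d : nat}.
Notation L := 'rV[int]_d.
Notation W := (@lat_weight R d).
Notation E := (@lat_dir d).
Notation sfun := ((R -> L -> R) * (R -> L -> R))%type.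
Let hE := @everywhere_setting R d.

Variables (t0 dl : R) (l : L -> R) (M0 c0 : R).
Hypothesis (c0_gt0 : 0 < c0).
Notation V := (Vint t0 dl).
Hypothesis hl : forall n, sym E W everywhere n 1 [set: unit] (fun=> l).
Hypothesis nonresonant : forall t k, V t -> M0 <= W k ->
  c0 <= \sum_i 2 * (1 - cos (t * incr l i k)).

Let oV : open V := @Vint_open R t0 dl.

Definition fsum (a : sfun) (t : R) : R := tsum (pair l a t).

(** Amplitude of the [tau]-derivative of the whole term; the factor [l] from the phase makes each
    derivative cost one order. *)
Definition dpair (a : sfun) : sfun :=
  ((fun t k => dtau a.1 t k + l k * a.2 t k), (fun t k => dtau a.2 t k - l k * a.1 t k)).

Lemma l_tsym : tsym V 1 (fun=> l).
Proof. exact: tsym_cst. Qed.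

Lemma dpair_tsym m a : tsym2 t0 dl m a -> tsym2 t0 dl (m + 1) (dpair a).
Proof.
move=> [h1 h2]; have le1 : m <= m + 1 by rewrite lerDl.
have p1 := tsym_mul oV l_tsym h1; have p2 := tsym_mul oV l_tsym h2.
rewrite addrC in p1; rewrite addrC in p2; split.
  exact: (tsym_add oV (tsym_le le1 (tsym_dtau h1)) p2).
exact: (tsym_add oV (tsym_le le1 (tsym_dtau h2)) (tsym_opp oV p1)).
Qed.

Lemma pair_is_derive m a k (t : R) : tsym2 t0 dl m a -> V t ->
  is_derive t 1 (fun u => pair l a u k) (pair l (dpair a) t k).
Proof.
move=> [h1 h2] Vt; have d1 := tsym_is_derive k h1 Vt; have d2 := tsym_is_derive k h2 Vt.
have dm : is_derive t 1 (fun u : R => u * l k) (l k).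
  by apply: is_derive_eq; rewrite scaler0 add0r [_%:A]mulr1.
rewrite /pair; apply: is_derive_eq; rewrite /GRing.scale /=; ring.
Qed.

Lemma pair_bound m a : tsym2 t0 dl m a -> exists2 C, 0 <= C &
  forall t k, V t -> `|pair l a t k| <= C * W k ^ m.
Proof.
move=> [h1 h2].
have [C1 C10 H1] := bnd_ex hE (sym_bnd hE (tsym_sym 0 h1)).
have [C2 C20 H2] := bnd_ex hE (sym_bnd hE (tsym_sym 0 h2)).
exists (C1 + C2) => [|t k Vt]; first by rewrite addr_ge0 ?ltW.
apply: le_trans (ler_normD _ _) _; rewrite !normrM mulrDl; apply: lerD.
  apply: le_trans (H1 k t Vt); rewrite ler_piMr// ler_norml cos_geN1 cos_le1//.
by apply: le_trans (H2 k t Vt); rewrite ler_piMr// ler_norml sin_geN1 sin_le1.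
Qed.

Lemma pair_bound_summable m a : m <= - (2 * d)%:Z -> tsym2 t0 dl m a ->
  exists2 C, 0 <= C & forall t k, V t -> `|pair l a t k| <= C * W k ^- (2 * d).
Proof.
move=> hm /pair_bound[C C0 h]; exists C => // t k Vt.
by apply: le_trans (h t k Vt) _; rewrite ler_wpM2l// exprnN; exact: (wz_le hE).
Qed.

(** Termwise differentiation: the second-order Taylor remainders add up to [O(h^2)] because the
    second derivatives, two orders higher, are still summable. Hence the bound on [m + 2]. *)
Lemma fsum_is_derive m a (t : R) : m + 2 <= - (2 * d)%:Z -> tsym2 t0 dl m a -> V t ->
  is_derive t 1 (fsum a) (fsum (dpair a) t).
Proof.
move=> hm ha Vt; have ha1 := dpair_tsym ha; have ha2 := dpair_tsym ha1.
have [S hS] := @lattice_summable R d.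
have m0 : m <= - (2 * d)%:Z by lia.
have m1 : m + 1 <= - (2 * d)%:Z by lia.
have m2 : m + 1 + 1 <= - (2 * d)%:Z by lia.
have [C C0 hC] := pair_bound_summable m0 ha.
have [C1 C10 hC1] := pair_bound_summable m1 ha1.
have [C2 C20 hC2] := pair_bound_summable m2 ha2.
have S0 : 0 <= S by have := hS.2 [::] isT; rewrite /ssum big_nil.
have CS : 0 < C2 * S + 1 by rewrite ltr_wpDl// mulr_ge0.
apply: is_derive_eps => eps eps0.
exists (Num.min (dl - `|t - t0|) (eps / (C2 * S + 1))).
  by rewrite lt_min subr_gt0 Vt divr_gt0.
move=> h; rewrite lt_min => /andP[h1 h2].
rewrite [h *: 1]mulr1.
have Vs (s : R) : 0 <= s <= 1 -> V (t + s * h).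
  move=> /andP[s0 s1]; rewrite /Vint /= addrAC; apply: le_lt_trans (ler_normD _ _) _.
  rewrite normrM ger0_norm//; have : s * `|h| <= `|h| by rewrite ler_piMl.
  by move: h1; lra.
have Vh : V (t + h) by have := Vs 1; rewrite mul1r; apply; rewrite ler01 lexx.
have hD := summable_boundD (summable_boundZ C0 hS) (summable_boundZ (normr_ge0 h) (summable_boundZ C10 hS)).
have le_l k x : `|x| <= C * W k ^- (2 * d) ->
    `|x| <= C * W k ^- (2 * d) + `|h| * (C1 * W k ^- (2 * d)).
  move=> /le_trans; apply; rewrite lerDl mulr_ge0//.
  exact: (summable_boundZ C10 hS).1.
have E1 : fsum a (t + h) - fsum a t - h * fsum (dpair a) t =
    tsum (fun k => pair l a (t + h) k - pair l a t k - h * pair l (dpair a) t k).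
  have hh k : `|h * pair l (dpair a) t k| <= C * W k ^- (2 * d) + `|h| * (C1 * W k ^- (2 * d)).
    rewrite normrM; apply: (@le_trans _ _ (`|h| * (C1 * W k ^- (2 * d)))).
      by rewrite ler_wpM2l// hC1.
    by rewrite lerDr (summable_boundZ C0 hS).1.
  have hCC := summable_boundD hD hD.
  rewrite (tsumB hCC).
  - rewrite (tsumB hD); last 2 first.
    + by move=> k; apply/le_l/hC.
    + by move=> k; apply/le_l/hC.
    by rewrite (tsumZ h (summable_boundZ C10 hS)) => // k; exact: hC1.
  - move=> k; apply: le_trans (ler_normB _ _) _.
    by apply: lerD; apply/le_l/hC.
  - by move=> k; apply: le_trans (hh k) _; rewrite lerDl hD.1.
rewrite E1; apply: (@le_trans _ _ (C2 * h ^+ 2 * S)).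
  apply: (tsum_bound hS) => [|k]; first by rewrite mulr_ge0// sqr_ge0.
  rewrite mulrAC; apply: (@taylor2_bound R (fun u => pair l a u k)
    (fun u => pair l (dpair a) u k) (fun u => pair l (dpair (dpair a)) u k)).
  - by move=> s /Vs Vs1; exact: (pair_is_derive k ha Vs1).
  - by move=> s /Vs Vs1; exact: (pair_is_derive k ha1 Vs1).
  - by move=> s /Vs Vs1; exact: hC2.
rewrite -(real_normK (num_real h)) expr2 mulrA mulrAC ler_wpM2r//.
apply: (@le_trans _ _ ((C2 * S + 1) * `|h|)); last first.
  by rewrite mulrC -ler_pdivlMr// ltW.
by rewrite mulrAC ler_wpM2r// lerDl.
Qed.

Lemma fsum_smooth n m a (t : R) : m + 2 + n%:Z <= - (2 * d)%:Z -> tsym2 t0 dl m a -> V t ->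
  derivable (derive1n n (fsum a)) t 1.
Proof.
elim: n m a => [|n IH] m a hm ha Vt.
  by have [] := @fsum_is_derive m a t _ ha Vt; rewrite ?addr0 in hm *.
rewrite /derive1n iterSr -/(derive1n n _).
apply: (@derivable_derive1n_ext _ V (fsum (dpair a))) => //.
  move=> u Vu; rewrite derive1E; have hm' : m + 2 <= - (2 * d)%:Z by lia.
  by have [_ ->] := fsum_is_derive hm' ha Vu.
by apply: IH (dpair_tsym ha) Vt; lia.
Qed.

Lemma lat_shift_bij j : bijective (fun k : L => k + E j).
Proof. by exists (fun k => k - E j) => k; rewrite ?addrK ?subrK. Qed.

Lemma fsum_step m a (t : R) : m <= - (2 * d)%:Z -> tsym2 t0 dl m a -> V t ->
  fsum a t = fsum (step l M0 a) t.
Proof.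
move=> hm ha Vt; have hs := step_tsym c0_gt0 hl nonresonant ha.
have [S hS] := @lattice_summable R d.
have [C C0 hC] := pair_bound_summable hm ha.
have hm1 : m - 1 <= - (2 * d)%:Z by lia.
have [C1 C10 hC1] := pair_bound_summable hm1 hs.
have hb i : tsym2 t0 dl m (backs i (coef l M0 a i)).
  by have [b1 b2] := coef_tsym c0_gt0 hl nonresonant i ha; split; exact: back_tsym.
have hbb (i : 'I_d) := pair_bound_summable hm (hb i).
have [D hD] := choice (fun i => ex2_ex (hbb i)).
pose g k := \sum_i (D i * W k ^- (2 * d)).
have hg i k u : V u -> `|pair l (backs i (coef l M0 a i)) u k| <= D i * W k ^- (2 * d).
  by move=> Vu; exact: (hD i).2.
apply/eqP; rewrite -subr_eq0; apply/eqP.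
rewrite /fsum -(tsumB (summable_boundD (summable_boundZ C0 hS) (summable_boundZ C10 hS))); last 2 first.
- by move=> k; apply: le_trans (hC _ _ Vt) _; rewrite lerDl; exact: (summable_boundZ C10 hS).1.
- by move=> k; apply: le_trans (hC1 _ _ Vt) _; rewrite lerDr; exact: (summable_boundZ C0 hS).1.
have -> : (fun k => pair l a t k - pair l (step l M0 a) t k) = (fun k =>
    \sum_i (pair l (backs i (coef l M0 a i)) t (k + E (i, false)) -
            pair l (backs i (coef l M0 a i)) t k)).
  by apply/funext => k; rewrite (step_pair c0_gt0 nonresonant).
have [K K0 hK] : exists2 K, 0 <= K & forall j (k : L), W (k + E j) ^- (2 * d) <= K * W k ^- (2 * d).
  have [K K0 hK] := wz_shift hE (- (2 * d)%:Z); exists K; first exact: ltW.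
  by move=> j k; rewrite !exprnN; exact: hK.
pose DD := \sum_i D i.
have D0 i : 0 <= D i by exact: (hD i).1.
have DDi i : D i <= DD by rewrite /DD (bigD1 i)//= lerDl sumr_ge0.
have DD0 : 0 <= DD by exact: sumr_ge0.
have hh := summable_boundZ (mulr_ge0 DD0 (addr_ge0 K0 ler01)) hS.
have W0 k : 0 <= W k ^- (2 * d) by exact: hS.1.
have b1 i k : `|pair l (backs i (coef l M0 a i)) t k| <= DD * (K + 1) * W k ^- (2 * d).
  apply: le_trans (hg _ _ _ Vt) _; rewrite ler_wpM2r//.
  by apply: le_trans (DDi i) _; rewrite mulrDr mulr1 lerDr mulr_ge0.
have b2 i k : `|pair l (backs i (coef l M0 a i)) t (k + E (i, false))| <=
    DD * (K + 1) * W k ^- (2 * d).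
  apply: le_trans (hg _ _ _ Vt) _; apply: (@le_trans _ _ (DD * (K * W k ^- (2 * d)))).
    by apply: ler_pM => //; exact: hK.
  by rewrite -mulrA ler_wpM2l// ler_wpM2r// lerDl.
rewrite (tsum_sum _ (summable_boundD hh hh)) => [|i k]; last first.
  by apply: le_trans (ler_normB _ _) _; rewrite lerD// ?b1 ?b2.
rewrite big1// => i _; rewrite (tsumB hh) => [|k|k]; [|exact: b2|exact: b1].
apply/eqP; rewrite subr_eq0; apply/eqP.
by apply: (tsum_bij (lat_shift_bij (i, false)) hh) => k; [exact: b1|exact: b2].
Qed.

Lemma iter_step_tsym n m a : tsym2 t0 dl m a ->
  tsym2 t0 dl (m - n%:Z) (iter n (step l M0) a).
Proof.
move=> ha; elim: n => [|n IH]; first by rewrite subr0.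
have := step_tsym c0_gt0 hl nonresonant IH; rewrite -addrA -opprD -[n.+1]addn1 PoszD.
by rewrite addn1.
Qed.

Lemma fsum_iter_step m a (t : R) n n' : (n <= n')%N -> m - n%:Z <= - (2 * d)%:Z ->
  tsym2 t0 dl m a -> V t ->
  fsum (iter n (step l M0) a) t = fsum (iter n' (step l M0) a) t.
Proof.
move=> /subnK <- hm ha Vt; elim: (n' - n)%N => [//|p IH].
rewrite IH addSn iterS; apply: (@fsum_step (m - (p + n)%:Z)) => //; first by lia.
exact: iter_step_tsym.
Qed.

(** Once the series converges absolutely, more steps do not alter its sum; for [p] derivatives the
    same function is represented with [p + 2] further steps. *)
Lemma fsum_csmooth m a n p (t : R) : m - n%:Z <= - (2 * d)%:Z -> tsym2 t0 dl m a -> V t ->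
  derivable (derive1n p (fsum (iter n (step l M0) a))) t 1.
Proof.
move=> hm ha Vt; pose q := (n + (p + 2))%N.
apply: (@derivable_derive1n_ext _ V (fsum (iter q (step l M0) a))) => //.
  by move=> u Vu; apply/esym/(@fsum_iter_step m) => //; rewrite leq_addr.
by apply: (@fsum_smooth _ (m - q%:Z)) => //; [rewrite /q; lia|exact: iter_step_tsym].
Qed.

End OscSum.

(** * Pairing with test functions *)

Section SegmentIntegral.
Context {R : realType}.
Variables (al be : R).
Hypothesis ab : al < be.
Implicit Types f g : R -> R.

Definition seg_int f : R := \int[lebesgue_measure]_(x in `[al, be]) f x.

Definition seg_continuous f := forall t, al <= t <= be -> {for t, continuous f}.

Let mI : measurable (`[al, be] : set (measurableTypeR R)). Proof. exact: measurable_itv. Qed.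

Lemma seg_continuous_within f : seg_continuous f -> {within `[al, be], continuous f}.
Proof.
move=> cf; apply: continuous_in_subspaceT => t /set_mem /=.
by rewrite in_itv /=; exact: cf.
Qed.

Lemma seg_integrable f : seg_continuous f -> lebesgue_measure.-integrable `[al, be] (EFin \o f).
Proof.
move=> cf; apply: continuous_compact_integrable; first exact: segment_compact.
exact: seg_continuous_within.
Qed.

Lemma seg_continuousD f g : seg_continuous f -> seg_continuous g ->
  seg_continuous (fun t => f t + g t).
Proof. by move=> cf cg t ht; apply: cvgD; [exact: cf|exact: cg]. Qed.

Lemma seg_continuousM f g : seg_continuous f -> seg_continuous g ->
  seg_continuous (fun t => f t * g t).
Proof. by move=> cf cg t ht; apply: cvgM; [exact: cf|exact: cg]. Qed.

Lemma seg_continuousN f : seg_continuous f -> seg_continuous (fun t => - f t).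
Proof. by move=> cf t ht; apply: cvgN; exact: cf. Qed.

Lemma seg_continuous_derivable f : (forall t, al <= t <= be -> derivable f t 1) ->
  seg_continuous f.
Proof.
by move=> df t /df ft; apply: differentiable_continuous; exact/derivable1_diffP.
Qed.

Lemma seg_continuous_cst c : seg_continuous (fun=> c).
Proof. by move=> t _; exact: cvg_cst. Qed.

Lemma seg_int_ext f g : (forall t, al <= t <= be -> f t = g t) -> seg_int f = seg_int g.
Proof.
by move=> fg; apply: eq_Rintegral => t /set_mem /=; rewrite in_itv/=; exact: fg.
Qed.

Lemma seg_intD f g : seg_continuous f -> seg_continuous g ->
  seg_int (fun t => f t + g t) = seg_int f + seg_int g.
Proof. by move=> cf cg; apply: RintegralD => //; exact: seg_integrable. Qed.

Lemma seg_intZ c f : seg_continuous f -> seg_int (fun t => c * f t) = c * seg_int f.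
Proof. by move=> cf; apply: RintegralZl => //; exact: seg_integrable. Qed.

Lemma seg_intN f : seg_continuous f -> seg_int (fun t => - f t) = - seg_int f.
Proof.
move=> cf; rewrite -mulN1r -seg_intZ//; apply: seg_int_ext => t _.
by rewrite mulN1r.
Qed.

Lemma seg_intB f g : seg_continuous f -> seg_continuous g ->
  seg_int (fun t => f t - g t) = seg_int f - seg_int g.
Proof.
by move=> cf cg; rewrite (seg_intD cf (seg_continuousN cg)) seg_intN.
Qed.

Lemma seg_continuous_sum (I : Type) (r : seq I) (f : I -> R -> R) :
  (forall i, seg_continuous (f i)) -> seg_continuous (fun t => \sum_(i <- r) f i t).
Proof.
move=> cf t ht; apply: (@cvg_sumr _ _ _ (nbhs t) (nbhs_filter t)) => i; exact: cf.
Qed.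

Lemma seg_int_sum (I : Type) (r : seq I) (f : I -> R -> R) :
  (forall i, seg_continuous (f i)) ->
  seg_int (fun t => \sum_(i <- r) f i t) = \sum_(i <- r) seg_int (f i).
Proof.
move=> cf; elim: r => [|i r IH].
  rewrite big_nil (@seg_int_ext _ (fun t => 0 * 0)) => [|t _]; last by rewrite big_nil mulr0.
  by rewrite (seg_intZ 0 (@seg_continuous_cst 0)) mul0r.
rewrite big_cons -IH -seg_intD//; last exact: seg_continuous_sum.
by apply: seg_int_ext => t _; rewrite big_cons.
Qed.

Lemma seg_int_bound f M : seg_continuous f -> (forall t, al <= t <= be -> `|f t| <= M) ->
  `|seg_int f| <= M * (be - al).
Proof.
move=> cf fM; apply: le_trans (le_normr_Rintegral mI (seg_integrable cf)) _.
have cn : seg_continuous (fun t => `|f t|) by move=> t ht; apply: cvg_norm; exact: cf.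
apply: (@le_trans _ _ (\int[lebesgue_measure]_(x in `[al, be]) M)).
  apply: (le_Rintegral mI (seg_integrable cn) (seg_integrable (@seg_continuous_cst M))).
  by move=> t /=; rewrite in_itv/=; exact: fM.
rewrite Rintegral_cst//= lebesgue_measure_itv /= lte_fin ab -EFinB /=.
by [].
Qed.

Lemma seg_bounded f : seg_continuous f -> exists2 M, 0 <= M &
  forall t, al <= t <= be -> `|f t| <= M.
Proof.
move=> cf; have := compact_bounded (continuous_compact (seg_continuous_within cf) (@segment_compact _ al be)).
move=> [M [_ hM]]; exists (`|M| + 1) => [|t ht]; first by rewrite addr_ge0.
apply: (hM (`|M| + 1)); first by rewrite (le_lt_trans (ler_norm M))// ltrDl.
by exists t => //=; rewrite in_itv.
Qed.

Lemma seg_int_derive f g : (forall t, al <= t <= be -> is_derive t 1 f (g t)) ->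
  seg_continuous g -> f al = 0 -> f be = 0 -> seg_int g = 0.
Proof.
move=> fg cg fa fb.
have cf : seg_continuous f by apply: seg_continuous_derivable => t /fg [].
have h := @continuous_FTC2 R g f al be ab (seg_continuous_within cg).
rewrite /seg_int /Rintegral h; first by rewrite -EFinB fa fb subrr.
- split.
  + by move=> t; rewrite in_itv/= => /andP[t1 t2]; have [] := fg t; rewrite ?ltW.
  + by apply: cvg_at_right_filter; apply: cf; rewrite lexx ltW.
  + by apply: cvg_at_left_filter; apply: cf; rewrite lexx ltW.
- move=> t; rewrite in_itv/= => /andP[t1 t2].
  by rewrite derive1E; have [_ ->] := fg t (introT andP (conj (ltW t1) (ltW t2))).
Qed.

(** Vanishing is required of every derivative, endpoints included: the class is stable under
    [derive1] and integration by parts has no boundary terms. *)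
Definition test_fun (phi : R -> R) := forall n,
  (forall t, derivable (derive1n n phi) t 1) /\
  (forall t, ~ (al < t < be) -> derive1n n phi t = 0).

Lemma test_fun_derive phi : test_fun phi -> test_fun (derive1 phi).
Proof. by move=> h n; have := h n.+1; rewrite /derive1n iterSr. Qed.

Lemma test_fun_out phi t : test_fun phi -> ~ (al < t < be) -> phi t = 0.
Proof. by move=> /(_ 0%N)[_]; exact. Qed.

Lemma test_fun_continuous phi : test_fun phi -> seg_continuous phi.
Proof. by move=> h; apply: seg_continuous_derivable => t _; exact: (h 0%N).1. Qed.

Lemma test_fun_is_derive phi (t : R) : test_fun phi -> is_derive t 1 phi (derive1 phi t).
Proof. by move=> h; rewrite derive1E; apply: derivableP; exact: (h 0%N).1. Qed.

End SegmentIntegral.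

(** * Decay of oscillatory integrals *)

Section OscIntegral.
Context {R : realType} {d : nat}.
Notation L := 'rV[int]_d.
Notation W := (@lat_weight R d).
Notation E := (@lat_dir d).
Notation sfun := ((R -> L -> R) * (R -> L -> R))%type.
Let hE := @everywhere_setting R d.
Let hI := at_infinity_setting (@lat_lattice_weight R d).

Variables (t0 dl : R) (l : L -> R) (M0 c0 : R).
Hypothesis (c0_gt0 : 0 < c0).
Notation V := (Vint t0 dl).
Hypothesis hl : forall n, sym E W everywhere n 1 [set: unit] (fun=> l).
Hypothesis nonresonant : forall t k, V t -> M0 <= W k ->
  c0 <= \sum_i 2 * (1 - cos (t * incr l i k)).
Variables (cl Ml : R).
Hypothesis (cl_gt0 : 0 < cl) (l_large : forall k, Ml <= W k -> cl * W k <= l k).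
Variables (al be : R).
Hypothesis ab : al < be.
Hypothesis abV : forall t, al <= t <= be -> V t.

Let oV : open V := @Vint_open R t0 dl.

Definition osc_int (a : sfun) (phi : R -> R) (k : L) : R :=
  seg_int al be (fun t => pair l a t k * phi t).

(** Multiplication of the amplitude [a1 + i a2] by [- i]. *)
Definition rot (a : sfun) : sfun := (a.2, fun t k => - a.1 t k).

Lemma rot_tsym m a : tsym2 t0 dl m a -> tsym2 t0 dl m (rot a).
Proof. by move=> [h1 h2]; split=> //; exact: tsym_opp. Qed.

Definition dtau2 (a : sfun) : sfun := (dtau a.1, dtau a.2).

Lemma dtau2_tsym m a : tsym2 t0 dl m a -> tsym2 t0 dl m (dtau2 a).
Proof. by move=> [h1 h2]; split; exact: tsym_dtau. Qed.

Lemma pair_continuous m a k : tsym2 t0 dl m a ->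
  seg_continuous al be (fun t => pair l a t k).
Proof.
move=> ha; apply: seg_continuous_derivable => t /abV Vt.
by have [] := pair_is_derive l k ha Vt.
Qed.

Lemma osc_continuous m a k phi : tsym2 t0 dl m a -> test_fun al be phi ->
  seg_continuous al be (fun t => pair l a t k * phi t).
Proof.
move=> ha hp; apply: seg_continuousM; first exact: pair_continuous ha.
exact: test_fun_continuous.
Qed.

Arguments osc_continuous {m a} k {phi} _ _.

Lemma osc_int_by_parts m a phi k : tsym2 t0 dl m a -> test_fun al be phi -> l k != 0 ->
  osc_int a phi k =
  (l k)^-1 * (osc_int (rot (dtau2 a)) phi k + osc_int (rot a) (derive1 phi) k).
Proof.
move=> ha hp lk; have hp' := test_fun_derive hp.
have hr := rot_tsym ha; have hrd := rot_tsym (dtau2_tsym ha).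
pose f t := (a.1 t k * sin (t * l k) - a.2 t k * cos (t * l k)) * phi t.
pose g t := l k * (pair l a t k * phi t) -
  (pair l (rot (dtau2 a)) t k * phi t + pair l (rot a) t k * derive1 phi t).
have c1 := osc_continuous k ha hp; have c2 := osc_continuous k hrd hp.
have c3 := osc_continuous k hr hp'.
have c4 : seg_continuous al be (fun t => l k * (pair l a t k * phi t)).
  by apply: seg_continuousM => //; exact: seg_continuous_cst.
have gE : seg_int al be g = l k * osc_int a phi k -
    (osc_int (rot (dtau2 a)) phi k + osc_int (rot a) (derive1 phi) k).
  by rewrite /g seg_intB ?seg_intZ ?seg_intD//; exact: seg_continuousD.
have g0 : seg_int al be g = 0.
  apply: (@seg_int_derive _ _ _ ab f).
  - move=> t /abV Vt; have d1 := tsym_is_derive k ha.1 Vt; have d2 := tsym_is_derive k ha.2 Vt.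
    have dp := test_fun_is_derive t hp.
    have dm : is_derive t 1 (fun u : R => u * l k) (l k).
      by apply: is_derive_eq; rewrite scaler0 add0r [_%:A]mulr1.
    rewrite /f; apply: is_derive_eq; rewrite /g /pair /rot /dtau2 /GRing.scale /=; ring.
  - by apply: seg_continuousD; [exact: c4|exact: (seg_continuousN (seg_continuousD c2 c3))].
  - by rewrite /f (test_fun_out hp) ?mulr0// ltxx.
  - by rewrite /f (test_fun_out hp) ?mulr0// ltxx andbF.
move/eqP: g0; rewrite gE subr_eq0 => /eqP <-.
by rewrite mulKf.
Qed.

(** Each integration by parts gains [1 / l k], at most [1 / (cl * W k)], and keeps the order of the
    amplitude, since neither [tau]-derivatives nor [rot] raise it. *)
Lemma osc_int_decay_inf p m a phi : tsym2 t0 dl m a -> test_fun al be phi ->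
  bnd W (at_infinity W) (m - p%:Z) [set: unit] (fun _ k => osc_int a phi k).
Proof.
elim: p m a phi => [|p IH] m a phi ha hp.
  have [C C0 hC] := pair_bound l ha.
  have [B B0 hB] := seg_bounded (test_fun_continuous hp).
  exists (C * B * (be - al)), 0 => k _ _ _; rewrite subr0.
  apply: le_trans (seg_int_bound ab (osc_continuous k ha hp) (M := C * W k ^ m * B) _) _.
    by move=> t ht; rewrite normrM ler_pM ?hB// hC//; exact: abV.
  by rewrite le_eqVlt; apply/orP; left; apply/eqP; ring.
have [C C0 [M hM]] := bnd_ex hI (IH _ _ _ (rot_tsym (dtau2_tsym ha)) hp).
have [C' C'0 [M' hM']] := bnd_ex hI (IH _ _ _ (rot_tsym ha) (test_fun_derive hp)).
exists (cl^-1 * (C + C')), (Num.max Ml (Num.max M M')) => k.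
rewrite !ge_max => /andP[/l_large hk /andP[/hM/(_ tt I) h1 /hM'/(_ tt I) h2]] _ _.
have Wk := w_gt0 hI k; have lk : 0 < l k by apply: lt_le_trans hk; exact: mulr_gt0.
rewrite (osc_int_by_parts ha hp) ?gt_eqF// normrM gtr0_norm ?invr_gt0//.
have -> : cl^-1 * (C + C') * W k ^ (m - p.+1%:Z) =
    (cl * W k)^-1 * ((C + C') * W k ^ (m - p%:Z)).
  have -> : m - p.+1%:Z = (m - p%:Z) + (-1) by rewrite -[p.+1]addn1 PoszD; ring.
  by rewrite expfzDr ?gt_eqF// exprN1; field; rewrite !gt_eqF.
apply: ler_pM => //; first by rewrite invr_ge0 ltW.
  by rewrite lef_pV2 ?posrE ?mulr_gt0.
by apply: le_trans (ler_normD _ _) _; rewrite mulrDl lerD.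
Qed.

Lemma osc_int_decay m a phi : tsym2 t0 dl m a -> test_fun al be phi ->
  exists2 C, 0 <= C & forall k, `|osc_int a phi k| <= C * W k ^- (2 * d).
Proof.
(* Enough integrations by parts for [m - p <= - 2 d], the summable order. *)
move=> ha hp; pose p := (`|m| + 2 * d)%N.
have h : sym E W (at_infinity W) 0 (m - p%:Z) [set: unit] (fun _ k => osc_int a phi k).
  by split=> //; exact: osc_int_decay_inf.
have [[C hC] _] := sym_everywhere h; exists `|C| => // k.
have Wm := wz_gt0 hE k (m - p%:Z).
apply: (@le_trans _ _ (`|C| * W k ^ (m - p%:Z))).
  apply: le_trans (hC k tt I) _; rewrite ler_wpM2r ?(ltW Wm)//; exact: ler_norm.
by rewrite ler_wpM2l// exprnN; apply: (wz_le hE); rewrite /p; lia.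
Qed.

End OscIntegral.

(** * From paired sums to a smooth density *)

Section OscTheorem.
Context {R : realType} {d : nat}.
Notation L := 'rV[int]_d.
Notation W := (@lat_weight R d).
Notation E := (@lat_dir d).
Notation sfun := ((R -> L -> R) * (R -> L -> R))%type.
Let hE := @everywhere_setting R d.

Variables (t0 dl : R) (l : L -> R) (M0 c0 : R).
Hypothesis (c0_gt0 : 0 < c0).
Notation V := (Vint t0 dl).
Hypothesis hl : forall n, sym E W everywhere n 1 [set: unit] (fun=> l).
Hypothesis nonresonant : forall t k, V t -> M0 <= W k ->
  c0 <= \sum_i 2 * (1 - cos (t * incr l i k)).
Variables (cl Ml : R).
Hypothesis (cl_gt0 : 0 < cl) (l_large : forall k, Ml <= W k -> cl * W k <= l k).

Let oV : open V := @Vint_open R t0 dl.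

Section OnSegment.
Variables (al be : R).
Hypothesis ab : al < be.
Hypothesis abV : forall t, al <= t <= be -> V t.

(** In contrast with [fsum_step], the order [m] is arbitrary: after pairing with [phi] the terms
    decay fast in any case, so summation by parts is legitimate while the unpaired series still
    diverges. *)
Lemma osc_tsum_step m a phi : tsym2 t0 dl m a -> test_fun al be phi ->
  tsum (osc_int l al be a phi) = tsum (osc_int l al be (step l M0 a) phi).
Proof.
move=> ha hp; have hs := step_tsym c0_gt0 hl nonresonant ha.
have [S hS] := @lattice_summable R d.
have decay m' a' (h : tsym2 t0 dl m' a') := osc_int_decay c0_gt0 cl_gt0 l_large ab abV h hp.
have [C C0 hC] := decay _ _ ha.
have [C1 C10 hC1] := decay _ _ hs.
pose b i := backs i (coef l M0 a i).
have hb i : tsym2 t0 dl m (b i).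
  by have [b1 b2] := coef_tsym c0_gt0 hl nonresonant i ha; split; exact: back_tsym.
have [D hD] := choice (fun i => ex2_ex (decay _ _ (hb i))).
have [K K0 hK] : exists2 K, 0 <= K & forall j (k : L), W (k + E j) ^- (2 * d) <= K * W k ^- (2 * d).
  have [K K0 hK] := wz_shift hE (- (2 * d)%:Z); exists K; first exact: ltW.
  by move=> j k; rewrite !exprnN; exact: hK.
pose DD := \sum_i D i.
have D0 i : 0 <= D i by exact: (hD i).1.
have DDi i : D i <= DD by rewrite /DD (bigD1 i)//= lerDl sumr_ge0.
have DD0 : 0 <= DD by exact: sumr_ge0.
have hh := summable_boundZ (mulr_ge0 DD0 (addr_ge0 K0 ler01)) hS.
have W0 k : 0 <= W k ^- (2 * d) by exact: hS.1.
have b1 i k : `|osc_int l al be (b i) phi k| <= DD * (K + 1) * W k ^- (2 * d).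
  apply: le_trans ((hD i).2 k) _; rewrite ler_wpM2r//.
  by apply: le_trans (DDi i) _; rewrite mulrDr mulr1 lerDr mulr_ge0.
have b2 i k : `|osc_int l al be (b i) phi (k + E (i, false))| <=
    DD * (K + 1) * W k ^- (2 * d).
  apply: le_trans ((hD i).2 _) _; apply: (@le_trans _ _ (DD * (K * W k ^- (2 * d)))).
    by apply: ler_pM => //; exact: hK.
  by rewrite -mulrA ler_wpM2l// ler_wpM2r// lerDl.
apply/eqP; rewrite -subr_eq0; apply/eqP.
rewrite -(tsumB (summable_boundD (summable_boundZ C0 hS) (summable_boundZ C10 hS))); last 2 first.
- by move=> k; apply: le_trans (hC _) _; rewrite lerDl; exact: (summable_boundZ C10 hS).1.
- by move=> k; apply: le_trans (hC1 _) _; rewrite lerDr; exact: (summable_boundZ C0 hS).1.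
have cont m' a' k' (h : tsym2 t0 dl m' a') := osc_continuous (l := l) abV (k := k') h hp.
have -> : (fun k => osc_int l al be a phi k - osc_int l al be (step l M0 a) phi k) = (fun k =>
    \sum_i (osc_int l al be (b i) phi (k + E (i, false)) - osc_int l al be (b i) phi k)).
  apply/funext => k; rewrite /osc_int -(seg_intB (cont _ _ k ha) (cont _ _ k hs)).
  under eq_bigr => i _ do rewrite -(seg_intB (cont _ _ (k + E (i, false)) (hb i)) (cont _ _ k (hb i))).
  rewrite -seg_int_sum; last first.
    by move=> i; apply: seg_continuousD; [exact: cont (hb i)|apply: seg_continuousN; exact: cont (hb i)].
  apply: seg_int_ext => t /abV Vt.
  rewrite -mulrBl (step_pair c0_gt0 nonresonant)// mulr_suml.
  by apply: eq_bigr => i _; rewrite mulrBl.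
rewrite (tsum_sum _ (summable_boundD hh hh)) => [|i k]; last first.
  by apply: le_trans (ler_normB _ _) _; rewrite lerD// ?b1 ?b2.
rewrite big1// => i _; rewrite (tsumB hh) => [|k|k]; [|exact: b2|exact: b1].
apply/eqP; rewrite subr_eq0; apply/eqP.
by apply: (tsum_bij (lat_shift_bij (i, false)) hh) => k; [exact: b1|exact: b2].
Qed.

Lemma osc_tsum_iter n m a phi : tsym2 t0 dl m a -> test_fun al be phi ->
  tsum (osc_int l al be a phi) = tsum (osc_int l al be (iter n (step l M0) a) phi).
Proof.
move=> ha hp; elim: n => [//|n ->]; rewrite iterS.
apply: (@osc_tsum_step (m - n%:Z)) hp.
exact: (iter_step_tsym c0_gt0 hl nonresonant).
Qed.

Lemma osc_tsum_fsum m a phi : m + 2 <= - (2 * d)%:Z -> tsym2 t0 dl m a ->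
  test_fun al be phi ->
  tsum (osc_int l al be a phi) = seg_int al be (fun t => fsum l a t * phi t).
Proof.
move=> hm ha hp; have [S hS] := @lattice_summable R d.
have m0 : m <= - (2 * d)%:Z by lia.
have [C C0 hC] := pair_bound_summable l m0 ha.
have [D D0 hD] := osc_int_decay c0_gt0 cl_gt0 l_large ab abV ha hp.
have [B B0 hB] := seg_bounded (test_fun_continuous hp).
have cfs : seg_continuous al be (fsum l a).
  apply: seg_continuous_derivable => t /abV Vt.
  by have [] := fsum_is_derive c0_gt0 hl hm ha Vt.
have cphi := test_fun_continuous hp.
apply: (tsum_unique (summable_boundZ D0 hS) hD) => eps eps0.
pose q := B * (be - al).
have q0 : 0 <= q by rewrite mulr_ge0// subr_ge0 ltW.
have q1 : 0 < q + 1 by rewrite ltr_wpDl.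
(* The domination does not depend on [t], so one finite set approximates the sum for all [t] of the
   segment, and the error can be integrated. *)
have [s0 us0 h0] := tsum_net (summable_boundZ C0 hS) (divr_gt0 eps0 q1).
exists s0 => s us sub.
have cs : seg_continuous al be (fun t => \sum_(k <- s) pair l a t k * phi t).
  by apply: seg_continuous_sum => k; exact: (osc_continuous (l:=l) abV (k:=k) ha hp).
have cf : seg_continuous al be (fun t => fsum l a t * phi t) by exact: seg_continuousM.
rewrite /ssum /osc_int -seg_int_sum; last by move=> k; exact: (osc_continuous (l:=l) abV (k:=k) ha hp).
rewrite -seg_intB//.
apply: le_trans (seg_int_bound ab (M := eps / (q + 1) * B) _ _) _.
- by apply: seg_continuousD; [exact: cs|exact: (seg_continuousN cf)].
- move=> t ht; rewrite -mulr_suml -mulrBl normrM; apply: ler_pM => //; last exact: hB.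
  by apply: (h0 (pair l a t)) => // k; apply: hC; exact: abV.
- rewrite -mulrA -/q mulrAC ler_pdivrMr// ler_pM2l// lerDl//.
Qed.

End OnSegment.

Theorem oscillatory_sum a : tsym2 t0 dl 0 a ->
  exists f : R -> R, (forall n t, V t -> derivable (derive1n n f) t 1) /\
    forall al be phi, al < be -> (forall t, al <= t <= be -> V t) ->
      test_fun al be phi ->
      (exists2 C, 0 <= C & forall k, `|osc_int l al be a phi k| <= C * W k ^- (2 * d)) /\
      tsum (osc_int l al be a phi) = seg_int al be (fun t => f t * phi t).
Proof.
(* From order 0 down to [- 2 d - 2]: summability takes [2 d], and two more orders serve
   [fsum_is_derive]. *)
move=> ha; pose n := (2 * d + 2)%N; exists (fsum l (iter n (step l M0) a)); split.
  move=> p t Vt; apply: (fsum_csmooth c0_gt0 hl nonresonant (m := 0)) => //.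
  by rewrite /n; lia.
move=> al be phi ab abV hp; split; first exact: (osc_int_decay c0_gt0 cl_gt0 l_large ab abV ha hp).
rewrite (osc_tsum_iter ab abV n ha hp).
apply: (@osc_tsum_fsum _ _ ab abV (0 - n%:Z)) hp; first by rewrite /n; lia.
exact: (iter_step_tsym c0_gt0 hl nonresonant).
Qed.

End OscTheorem.

(** * Nonresonance and the spectrum of the torus *)

Section Periods.
Context {R : realType}.

Lemma periodic_int (f : R -> R) (T : R) (n : int) x : periodic f T -> f (x + T * n%:~R) = f x.
Proof.
move=> hf; case: n => n.
  by rewrite -pmulrn mulr_natr (periodicn hf).
rewrite NegzE mulrNz -pmulrn mulrN mulr_natr.
by have := periodicn hf n.+1 (x - T *+ n.+1); rewrite subrK => <-.
Qed.

Lemma cosD_int (n : int) (x : R) : cos (x + 2 * pi * n%:~R) = cos x.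
Proof. by apply: periodic_int => u; rewrite [2 * pi]mulr_natl cosD2pi. Qed.

(** Reduce modulo [2 pi] to [r] in [[0, 2 pi)]. If [r > 0], the sine of [r / 2] is positive, whereas
    [cos r = 1 - 2 sin^2 (r / 2)]. *)
Lemma cos_eq1 (x : R) : cos x = 1 -> exists n : int, x = 2 * pi * n%:~R.
Proof.
move=> cx; have p0 := @pi2_gt0 R; pose n := Num.floor (x / (2 * pi)).
pose r := x - 2 * pi * n%:~R.
have cr : cos r = 1 by rewrite -cx /r -mulrN -mulrNz cosD_int.
have r0 : 0 <= r by rewrite subr_ge0 mulrC -ler_pdivlMr// floor_le_tmp.
have r1 : r < 2 * pi.
  have := floorD1_gt (x / (2 * pi)); rewrite -/n ltr_pdivrMr// intrD /r.
  by move: (n%:~R : R) => N; lra.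
exists n; apply/eqP; rewrite -subr_eq0 -/r; apply/negPn/negP => rn.
have rp : 0 < r by rewrite lt_def rn.
have s0 : 0 < sin (r / 2) by apply: sin_gt0_pi; apply/andP; split; lra.
have := cosD (r / 2) (r / 2); rewrite -splitr cr -!expr2.
have := cos2Dsin2 (r / 2); have := exprn_gt0 2 s0.
by move: (sin _ ^+ 2) (cos _ ^+ 2) => a b; lra.
Qed.

Lemma cos_lipschitz (x y : R) : `|cos x - cos y| <= `|x - y|.
Proof.
have := @mvt_bound R (fun t => cos (y + t * (x - y))) (fun t => - sin (y + t * (x - y)) * (x - y)) `|x - y|.
rewrite mul1r mul0r addr0 (addrC y) subrK; apply=> t _.
  have dg : is_derive t 1 (fun t : R => y + t * (x - y)) (x - y).
    by apply: is_derive_eq; rewrite scaler0 !add0r ?[_%:A]mulr1 ?mul1r.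
  exact: (@is_derive1_comp _ cos (fun t => y + t * (x - y)) _ _ _ (is_derive_cos _) dg).
rewrite normrM normrN ler_piMl//; exact: sin_max.
Qed.

End Periods.

Section Nonresonance.
Context {R : realType} {d : nat}.
Notation W := (@lat_weight R d).
Notation E := (@lat_dir d).
Variable t0 : R.

Lemma dotv_emb_dir (i : 'I_d) (th : 'rV[R]_d) : dotv (emb (E (i, false))) th = 2 * pi * th 0 i.
Proof.
rewrite /emb dotvZl /lat_dir /= scale1r /dotv (bigD1 i)//= big1 ?addr0 => [|j ji].
  by rewrite !mxE !eqxx mul1r.
by rewrite !mxE (negPf ji) andbF mul0r.
Qed.

(** The sum of the [|q_i - 1|^2] with the increments of [l] replaced by their leading parts in the
    direction [th]. *)
Let F (th : 'rV[R]_d) := \sum_i 2 * (1 - cos (t0 * dotv (emb (E (i, false))) th)).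

Lemma direction_nonresonant :
  (forall xi : 'rV[int]_d, t0 ^+ 2 != dotv (map_mx intr xi) (map_mx intr xi)) ->
  exists2 c, 0 < c & forall th, sphere th -> c <= F th.
Proof.
move=> nr.
have term0 i th : 0 <= 2 * (1 - cos (t0 * dotv (emb (E (i, false))) th)).
  by rewrite mulr_ge0// subr_ge0 cos_le1.
have [M hM] : exists M0 : R, forall M, M0 <= M -> forall th, sphere th -> 0 < M -> M^-1 <= F th.
  apply: (@sphere_uniform R d (fun M th => 0 < M -> M^-1 <= F th)) => th0 sth.
  have F0 : 0 < F th0.
    rewrite lt_def sumr_ge0 ?andbT => [|i _]; last exact: term0.
    apply/negP => /eqP /psumr_eq0P h.
    have hq i : exists n : int, t0 * dotv (emb (E (i, false))) th0 = 2 * pi * n%:~R.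
      apply: cos_eq1; have /eqP := h (fun j _ => term0 j th0) i isT.
      by rewrite mulf_eq0 pnatr_eq0/= subr_eq0 => /eqP <-.
    have [xi hxi] := choice hq.
    have hx i : t0 * th0 0 i = (xi i)%:~R.
      have := hxi i; rewrite dotv_emb_dir mulrCA; apply: mulfI.
      by rewrite gt_eqF ?pi2_gt0.
    have /eqP[] := nr (\row_i xi i).
    have e1 : dotv th0 th0 = 1 by exact/enorm1.
    rewrite -[LHS]mulr1 -[X in _ * X]e1 /dotv mulr_sumr; apply: eq_bigr => i _.
    by rewrite !mxE -hx; ring.
  (* Lipschitz constant of [F] for the sup norm, enlarged by 1 to be positive. *)
  pose A := d%:R * (2 * (`|t0| * (2 * pi))) + 1 : R.
  have A0 : 0 < A by rewrite ltr_wpDl// !mulr_ge0// ltW// pi_gt0.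
  have lipF th : `|F th0 - F th| <= A * `|th - th0|.
    rewrite /F -sumrB; apply: le_trans (ler_norm_sum _ _ _) _.
    apply: (@le_trans _ _ (\sum_(i < d) 2 * (`|t0| * (2 * pi)) * `|th - th0|)); last first.
      by rewrite sumr_const card_ord -[leLHS]mulr_natl [A * _]mulrDl mul1r [leLHS]mulrA lerDl.
    apply: ler_sum => i _; rewrite -mulrBr normrM ger0_norm// -mulrA ler_wpM2l//.
    rewrite (_ : _ - _ = cos (t0 * dotv (emb (E (i, false))) th) - cos (t0 * dotv (emb (E (i, false))) th0)); last by lra.
    apply: le_trans (cos_lipschitz _ _) _; rewrite -mulrBr -dotvBr dotv_emb_dir !normrM -!mulrA.
    apply: ler_wpM2l => //; rewrite ger0_norm// ger0_norm ?pi_ge0//.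
    by rewrite ler_wpM2l// ler_wpM2l ?pi_ge0// coord_le.
  have F2 : 0 < F th0 / 2 by rewrite divr_gt0.
  exists (F th0 / 2)^-1, (F th0 / 2 / A); split=> [|M th hM _ hth M0]; first exact: divr_gt0.
  have : `|F th0 - F th| < F th0 / 2.
    by apply: le_lt_trans (lipF th) _; rewrite mulrC -ltr_pdivlMr.
  have : M^-1 <= F th0 / 2 by rewrite -[leRHS]invrK lef_pV2 ?posrE ?invr_gt0.
  rewrite ltr_norml => h /andP[_]; lra.
exists (Num.max M 1)^-1; first by rewrite invr_gt0 lt_max ltr01 orbT.
by move=> th sth; apply: hM; rewrite ?le_max ?lexx// lt_max ltr01 orbT.
Qed.

Lemma length_nonresonant (th : 'rV[int]_d -> 'rV[R]_d) (l : 'rV[int]_d -> R) :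
  (forall xi : 'rV[int]_d, t0 ^+ 2 != dotv (map_mx intr xi) (map_mx intr xi)) ->
  at_infinity W (sphere \o th) ->
  (exists2 C', 0 <= C' & exists M, forall k j, M <= W k ->
    `|l (k + E j) - l k - dotv (emb (E j)) (th k)| <= C' / W k) ->
  exists dl M0 c0, [/\ 0 < dl, 0 < c0 & forall t k, Vint t0 dl t -> M0 <= W k ->
    c0 <= \sum_i 2 * (1 - cos (t * incr l i k))].
Proof.
move=> nr [Ms hMs] [C C0 [Ml hMl]]; have [c c0 hc] := direction_nonresonant nr.
pose A := 2 * (d%:R + 1) * (2 * pi + C) : R.
have A0 : 0 < A by rewrite !mulr_gt0// ltr_wpDr// ?pi2_gt0// ltr_wpDl.
pose B := 2 * (d%:R + 1) * (`|t0| * C) : R.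
have B0 : 0 <= B by rewrite !mulr_ge0// addr_ge0.
(* Half of [c] is given up: one quarter for replacing [t0] by [t], one quarter for the error
   [C / W k] in the increments. *)
exists (c / 4 / A), (`|Ms| + `|Ml| + 4 / c * B), (c / 2); split; rewrite ?divr_gt0//.
move=> t k Vt hk.
have q0 : 0 <= 4 / c * B by rewrite mulr_ge0// divr_ge0// ltW.
have := normr_ge0 Ms; have := normr_ge0 Ml; have := ler_norm Ms; have := ler_norm Ml => a1 a2 a3 a4.
have sk : sphere (th k) by apply: hMs; lra.
have hkl j : `|l (k + E j) - l k - dotv (emb (E j)) (th k)| <= C / W k by apply: hMl; lra.
have W1 : 1 <= W k := lat_weight_ge1 k.
have W0 : 0 < W k by exact: lt_le_trans W1.
have BW : B / W k <= c / 4.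
  rewrite ler_pdivrMr//; have : 4 / c * B <= W k by lra.
  rewrite mulrAC ler_pdivrMr//; lra.
have i1 i : `|t * incr l i k - t0 * dotv (emb (E (i, false))) (th k)| <=
    c / 4 / A * (2 * pi + C) + `|t0| * (C / W k).
  rewrite (_ : _ - _ = (t - t0) * incr l i k + t0 * (incr l i k - dotv (emb (E (i, false))) (th k))); last by ring.
  apply: le_trans (ler_normD _ _) _; rewrite !normrM; apply: lerD; last by apply: ler_wpM2l => //; exact: (hkl (i, false)).
  apply: ler_pM => //; first exact: ltW.
  have h1 : `|dotv (emb (E (i, false))) (th k)| <= 2 * pi.
    rewrite dotv_emb_dir normrM gtr0_norm ?pi2_gt0//.
    apply: ler_piMr; first exact/ltW/pi2_gt0.
    by apply: le_trans (sphere_norm sk); exact: coord_le.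
  have h2 := hkl (i, false); rewrite -/(incr l i k) in h2.
  have h3 : C / W k <= C by rewrite ler_pdivrMr// ler_peMr.
  have := ler_normD (incr l i k - dotv (emb (E (i, false))) (th k)) (dotv (emb (E (i, false))) (th k)).
  rewrite subrK; lra.
have hF := hc _ sk.
pose rhs := c / 4 / A * (2 * pi + C) + `|t0| * (C / W k).
have hs : F (th k) - \sum_i 2 * (1 - cos (t * incr l i k)) <= d%:R * (2 * rhs).
  rewrite /F -sumrB; apply: (@le_trans _ _ (\sum_(i < d) 2 * rhs)); last first.
    by rewrite sumr_const card_ord [leRHS]mulr_natl.
  apply: ler_sum => i _; have := le_trans (cos_lipschitz _ _) (i1 i).
  rewrite ler_norml -/rhs => /andP[_]; lra.
have piC0 : 0 < 2 * pi + C by rewrite ltr_wpDr// pi2_gt0.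
have rhs0 : 0 <= rhs.
  by rewrite addr_ge0// mulr_ge0 ?(ltW piC0) ?divr_ge0// ?divr_ge0 ?ltW.
have e1 : 2 * (d%:R + 1) * rhs = c / 4 + B / W k.
  rewrite /rhs /B /A; move: (2 * pi + C) piC0 => p p0; field.
  by rewrite !gt_eqF// ltr_wpDl.
have : d%:R * (2 * rhs) <= 2 * (d%:R + 1) * rhs by lra.
lra.
Qed.

End Nonresonance.

(** * Plane waves and eigenvalues of the Laplacian *)

Section Spectrum.
Context {R : realType} {d : nat}.

Section Wave.
Variable w : 'rV[R]_d.

(** Free amplitude and phase make one family contain cosine and sine and be stable under partial
    derivatives, which shift the phase by [pi / 2]. *)
Definition wave (c p : R) (x : 'rV[R]_d) : R := c * cos (dotv w x + p).

Lemma wave_is_derive c p (x v : 'rV[R]_d) :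
  is_derive x v (wave c p) (c * dotv w v * cos (dotv w x + p + pi / 2)).
Proof.
pose g s := c * cos (dotv w x + p + s * dotv w v).
have dg : is_derive (0 : R) 1 g (c * dotv w v * cos (dotv w x + p + pi / 2)).
  have dm : is_derive (0 : R) 1 (fun s => dotv w x + p + s * dotv w v) (dotv w v).
    by apply: is_derive_eq; rewrite scaler0 !add0r ?[_%:A]mulr1 ?mul1r.
  have dc := @is_derive1_comp _ cos _ _ _ _ (is_derive_cos _) dm.
  rewrite /g; apply: is_derive_eq.
  by rewrite mul0r addr0 cosDpihalf /GRing.scale /=; ring.
have E : (fun h => h^-1 *: ((g \o shift 0) (h *: 1) - g 0)) =
    (fun h => h^-1 *: ((wave c p \o shift x) (h *: v) - wave c p x)).
  apply/funext => h /=; rewrite /shift [h *: 1]mulr1 addr0 /g /wave mul0r addr0.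
  by rewrite dotvDr dotvZr [h * _ + _]addrC addrAC.
move: dg => [d1 d2]; apply: DeriveDef.
  by move: d1; rewrite /derivable E.
by rewrite -d2 /derive E.
Qed.

Lemma partial_wave i c p :
  partial i (wave c p) = wave (c * w 0 i) (p + pi / 2).
Proof.
apply/funext => x; rewrite /partial.
by have [_ ->] := wave_is_derive c p x (delta_mx 0 i); rewrite dotv_delta /wave addrA.
Qed.

Lemma wave_continuous c p : continuous (wave c p).
Proof.
apply: (@lipschitz_continuous _ _ _ (`|c| * (d%:R * `|w|))).
  by rewrite !mulr_ge0.
move=> x y; rewrite /wave -mulrBr normrM -mulrA ler_wpM2l//.
apply: le_trans (cos_lipschitz _ _) _.
rewrite (_ : _ - _ = dotv w (x - y)); last by rewrite dotvBr; ring.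
by rewrite -mulrA; exact: dotv_le.
Qed.

Lemma wave_smooth c p : smooth_on setT (wave c p).
Proof.
move=> s x _; have [c' [p' ->]] : exists c' p', iter_partial s (wave c p) = wave c' p'.
  elim: s => [|i s [c' [p' IH]]]; first by exists c, p.
  by exists (c' * w 0 i), (p' + pi / 2); rewrite /= IH partial_wave.
split; first exact: wave_continuous.
by move=> i; have [] := wave_is_derive c' p' x (delta_mx 0 i).
Qed.

Lemma laplacian_wave c p x : laplacian (wave c p) x = - dotv w w * wave c p x.
Proof.
rewrite /laplacian /dotv -sumrN mulr_suml; apply: eq_bigr => i _.
rewrite !partial_wave /wave.
have -> : p + pi / 2 + pi / 2 = p + pi by rewrite -addrA -splitr.
by rewrite addrA cosDpi; ring.
Qed.

End Wave.

Lemma box_integral_cst n c : box_integral (fun _ : 'rV[R]_n => c) = c * (2 * pi) ^+ n.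
Proof.
elim: n => [|n IH] /=; first by rewrite mulr1.
under eq_Rintegral do rewrite IH.
rewrite Rintegral_cst//= lebesgue_measure_itv /= lte_fin pi2_gt0 -EFinB /= subr0.
by rewrite exprSr [RHS]mulrA.
Qed.

Lemma emb_phase (xi k : 'rV[int]_d) : exists n : int,
  dotv (map_mx intr xi) (emb k : 'rV[R]_d) = 2 * pi * n%:~R.
Proof.
exists (\sum_i xi 0 i * k 0 i).
rewrite /emb dotvZr; congr (_ * _); rewrite /dotv rmorph_sum /=.
by apply: eq_bigr => i _; rewrite !mxE rmorphM.
Qed.

Lemma lattice_spectrum (xi : 'rV[int]_d) :
  @spectrum R d (dotv (map_mx intr xi) (map_mx intr xi))%:C%C.
Proof.
set w : 'rV[R]_d := map_mx intr xi.
pose f (q : torus R d) : R[i] :=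
  (wave w 1 0 (generic_quotient.repr q) +i* wave w 1 (- (pi / 2)) (generic_quotient.repr q))%C.
have rp x : exists k, generic_quotient.repr (Defs.proj x) = x + emb k :> 'rV[R]_d.
  by apply/proj_eq; rewrite /Defs.proj generic_quotient.reprK.
have fr : reF (f \o @Defs.proj R d) = wave w 1 0.
  apply/funext => x; rewrite /reF /=; have [k ->] := rp x.
  have [n hn] := emb_phase xi k.
  by rewrite /wave dotvDr hn addrAC cosD_int.
have fi : imF (f \o @Defs.proj R d) = wave w 1 (- (pi / 2)).
  apply/funext => x; rewrite /imF /=; have [k ->] := rp x.
  have [n hn] := emb_phase xi k.
  by rewrite /wave dotvDr hn addrAC cosD_int.
(* The lower bound in the resolvent condition fails on [f]: the operator annihilates it, while its
   modulus is constantly 1. *)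
move=> [[c c0 hc] _].
have smf : torus_smooth f by rewrite /torus_smooth fr fi; split; exact: wave_smooth.
have := hc f smf; rewrite leNgt => /negP; apply.
rewrite [X in X < _](_ : _ = 0); last first.
  rewrite /torus_L2norm (_ : (fun _ => _) = (fun=> 0)) ?box_integral_cst ?mul0r ?sqrtr0//.
  apply/funext => x; rewrite (_ : _ - _ = 0); first by rewrite /cmod normr0 expr0n.
  rewrite /torus_laplacian fr fi !laplacian_wave /f.
  by apply/eqP; rewrite eq_complex /=; apply/andP; split; apply/eqP; ring.
apply: mulr_gt0 => //; rewrite /torus_L2norm (_ : (fun _ => _) = (fun=> 1)).
  by rewrite box_integral_cst mul1r sqrtr_gt0 exprn_gt0// pi2_gt0.
apply/funext => x; rewrite /cmod /f /= /wave !mul1r addr0.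
have -> (y : R) : cos (y - pi / 2) = sin y by rewrite cosBpihalf.
by rewrite cos2Dsin2 sqrtr1 expr1n.
Qed.

Lemma notin_spectrum (t : R) :
  ~ (spectrum_opp_sqrt R d `|` spectrum_sqrt R d) t ->
  forall xi : 'rV[int]_d, t ^+ 2 != dotv (map_mx intr xi) (map_mx intr xi).
Proof.
move=> ht xi; apply/negP => /eqP e; apply: ht.
have h : spectrum_sqrt R d `|t|.
  by exists (t ^+ 2); [rewrite /= e; exact: lattice_spectrum|exact: sqrtr_sqr].
have [t0|t0] := leP 0 t; first by right; rewrite -(ger0_norm t0).
by left; exists `|t|; rewrite // ltr0_norm// opprK.
Qed.

End Spectrum.

(** * Orthogeodesics and their length distribution *)

Section GeodesicModel.
Context {R : realType} {d : nat}.
Notation L := 'rV[int]_d.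
Notation W := (@lat_weight R d).
Notation E := (@lat_dir d).
Notation Finf := (at_infinity W).
Implicit Types (K : set 'rV[R]_d) (g h : @curve R d).

(** Orthogeodesics longer than [T0] are, without repetition, the [ga k] with [k] large together with
    a finite list [Q] of exceptional ones. *)
Definition lattice_geodesics K1 o1 K2 o2 (T0 : R) (l : L -> R) (ga : L -> @curve R d)
    (M : R) (Q : seq (@curve R d)) :=
  [/\ forall k, M <= W k -> [/\ orthogeodesics K1 o1 K2 o2 (ga k), len (ga k) = l k & T0 < l k],
      forall k k', M <= W k -> M <= W k' -> ga k = ga k' -> k = k',
      uniq Q,
      forall h, h \in Q -> [/\ orthogeodesics K1 o1 K2 o2 h, T0 < len h &
        forall k, M <= W k -> h <> ga k] &
      forall h, orthogeodesics K1 o1 K2 o2 h -> T0 < len h ->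
        h \in Q \/ exists2 k, M <= W k & h = ga k].

Lemma emb_small (k : L) : `|emb k : 'rV[R]_d| < 2 * pi -> k = 0.
Proof.
rewrite norm_emb -ltr_pdivlMl ?pi2_gt0// mulVf ?gt_eqF ?pi2_gt0// => hk.
apply/rowP => i; rewrite mxE.
have : `|(k 0 i)%:~R| < 1 :> R.
  apply: le_lt_trans hk; rewrite /lat_weight addrAC subrr add0r.
  by have := coord_le (map_mx intr k : 'rV[R]_d) i; rewrite mxE.
rewrite -intr_norm -[1]/(1%:~R) ltr_int; move: (k 0 i) => z; lia.
Qed.

Lemma emb_inj : injective (@emb R d).
Proof.
move=> k k' e; apply/eqP; rewrite -subr_eq0; apply/eqP/emb_small.
by rewrite embB e subrr normr0 pi2_gt0.
Qed.

Definition ray (x th : 'rV[R]_d) (ln : R) : @curve R d :=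
  Curve (fun t : {t : R | 0 <= t <= ln} => Defs.proj (x + val t *: th)).

Lemma ray_point (x x' th th' : 'rV[R]_d) ln ln' t :
  ray x th ln = ray x' th' ln' -> 0 <= t <= ln ->
  Defs.proj (x + t *: th) = Defs.proj (x' + t *: th').
Proof.
move=> e ht.
(* The domain of a path depends on the length, so the equality of curves is used on a generic curve
   [g], where it can be substituted. *)
suff H (g : @curve R d) : g = ray x' th' ln' -> forall (u : {t : R | 0 <= t <= len g}),
    path_of u = Defs.proj (x' + val u *: th').
  exact: (H (ray x th ln) e (exist _ t ht)).
by move=> ->.
Qed.

(** Lifts of the same curve differ by a lattice vector at each time. Between time 0 and a time
    [t <= 1] this vector changes by [t (th - th')], of norm at most 2, which is less than [2 pi];
    the change is a lattice vector and thus 0. *)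
Lemma ray_direction_inj (x x' th th' : 'rV[R]_d) ln ln' : 0 < ln ->
  sphere th -> sphere th' -> ray x th ln = ray x' th' ln' -> th = th'.
Proof.
move=> ln0 sth sth' e.
have [j0 hj0] : exists j, x + 0 *: th = x' + 0 *: th' + emb j.
  by apply/proj_eq/(ray_point e); rewrite lexx ltW.
pose t := Num.min ln 1; have t0 : 0 < t by rewrite lt_min ln0 ltr01.
have t1 : t <= 1 by rewrite ge_min lexx orbT.
have [j hj] : exists j, x + t *: th = x' + t *: th' + emb j.
  by apply/proj_eq/(ray_point e); rewrite ltW// ge_min lexx.
have ej : emb (j - j0) = t *: (th - th').
  have a : emb j = x + t *: th - (x' + t *: th') by rewrite hj addrC addKr.
  have b : emb j0 = x - x' by rewrite scale0r addr0 scale0r addr0 in hj0; rewrite hj0 addrC addKr.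
  by rewrite embB a b; apply/rowP => i; rewrite !mxE; ring.
have jj : j - j0 = 0.
  apply: emb_small; rewrite ej normrZ gtr0_norm//.
  have p2 : 2 <= pi :> R by exact: pi_ge2.
  have h : `|th - th'| <= 2.
    apply: le_trans (ler_normB _ _) _; have := sphere_norm sth; have := sphere_norm sth'; lra.
  apply: (@le_lt_trans _ _ (1 * 2)); last lra.
  by apply: ler_pM => //; exact: ltW.
move: ej; rewrite jj /emb map_mx0 scaler0 => /esym/eqP.
by rewrite scaler_eq0 gt_eqF//= subr_eq0 => /eqP.
Qed.

Section Model.
Variables (K1 K2 : set 'rV[R]_d) (o1 o2 : orientation).
Variables (Y1 Y2 : 'rV[R]_d -> 'rV[R]_d) (B C : R).
Hypotheses (d0 : (0 < d)%N) (B0 : 0 <= B) (C0 : 0 <= C).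
Hypotheses (nY1 : normal_map K1 o1 Y1) (nY2 : normal_map K2 o2 Y2).
Hypotheses (Y1B : forall th, sphere th -> `|Y1 th| <= B)
  (Y2B : forall th, sphere th -> `|Y2 th| <= B)
  (Y1C : forall th th', sphere th -> sphere th' -> `|Y1 th' - Y1 th| <= C * `|th' - th|)
  (Y2C : forall th th', sphere th -> sphere th' -> `|Y2 th' - Y2 th| <= C * `|th' - th|).
Variables (th : 'rV[int]_d -> 'rV[R]_d) (l : 'rV[int]_d -> R).
Hypothesis thl : forall k, @sol_radius R d B C <= `|emb k : 'rV[R]_d| -> sol Y1 Y2 k (th k) (l k).
Variable T0 : R.
Hypothesis hfin : forall T : R, T0 < T ->
  finite_set (truncated_orthogeodesics K1 o1 K2 o2 T0 T).

Let ga k := ray (Y1 (th k)) (th k) (l k).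

Lemma sol_orthogeodesic k t ln : sol Y1 Y2 k t ln ->
  orthogeodesics K1 o1 K2 o2 (ray (Y1 t) t ln).
Proof.
move=> [st l0 e]; have [n1 _ _ _] := nY1; have [n2 _ _ _] := nY2.
split=> //; exists (Y1 t), t; split=> //; first exact/n1.
by apply/n2 => //=; apply/proj_eq; exists k.
Qed.

Lemma orthogeodesic_sol h : orthogeodesics K1 o1 K2 o2 h ->
  exists k t, sol Y1 Y2 k t (len h) /\ h = ray (Y1 t) t (len h).
Proof.
case: h => ln p [/= ln0 [x [t [st hp b1 b2]]]].
have [n1 _ _ _] := nY1; have [n2 _ _ _] := nY2.
have /proj_eq[j hj] := (n1 _ _ st).1 b1; have /proj_eq[j' hj'] := (n2 _ _ st).1 b2.
exists (j' - j), t; split.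
  split=> //; rewrite embB addrA -hj' hj; move: (emb j) => u.
  by apply/rowP => i; rewrite !mxE; ring.
congr Curve; apply/funext => u; rewrite hp; apply/proj_eq; exists j.
by rewrite hj addrAC.
Qed.

Lemma lattice_geodesics_exist : exists2 c, 0 < c & exists M Q,
  (forall k, M <= W k -> c * W k <= l k) /\ lattice_geodesics K1 o1 K2 o2 T0 l ga M Q.
Proof.
have [c c0 [M1 hM1]] := length_bounds B0 Y1B Y2B thl.
pose rad := @sol_radius R d B C.
pose M := Num.max M1 (Num.max (rad / (2 * pi) + 1) (T0 / c + 1)).
have M_rad k : M <= W k -> rad <= `|emb k : 'rV[R]_d|.
  rewrite !ge_max => /and3P[_ hk _]; rewrite norm_emb.
  by rewrite -ler_pdivrMl ?pi2_gt0// mulrC lerBrDr.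
have M_T0 k : M <= W k -> T0 < l k.
  rewrite !ge_max => /and3P[/hM1[hl _] _ hk]; apply: lt_le_trans hl.
  rewrite mulrC -ltr_pdivrMr//; lra.
pose P := [set h | [/\ orthogeodesics K1 o1 K2 o2 h, T0 < len h &
  forall k, M <= W k -> h <> ga k]].
(* The second term bounds the length of any solution with [W k < M]; by uniqueness of solutions for
   larger [k], every exceptional orthogeodesic is of this kind, so finiteness follows from
   [hfin]. *)
pose T1 := Num.max (T0 + 1) (d%:R * (2 * pi * M + 2 * B)).
have finP : finite_set P.
  apply: (@sub_finite_set _ _ (truncated_orthogeodesics K1 o1 K2 o2 T0 T1)); last first.
    by apply: hfin; rewrite lt_max ltrDl ltr01.
  move=> h [oh Th nh]; split=> //=; rewrite Th /=.
  have [k [t [s hE]]] := orthogeodesic_sol oh.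
  have hk : W k < M.
    rewrite ltNge; apply/negP => hk; apply: (nh k hk); rewrite hE.
    have [-> ->] := sol_unique C0 Y1B Y2B Y1C Y2C (M_rad _ hk) s (thl (M_rad _ hk)).
    by [].
  rewrite le_max; apply/orP; right; rewrite (sol_len s).
  apply: le_trans (enorm_le_norm _) _; rewrite ler_wpM2l//.
  have [st _ _] := s; apply: le_trans (sol_z_norm Y1B Y2B k st).2 _.
  rewrite norm_emb lerD2r ler_wpM2l ?(ltW (@pi2_gt0 R))//; lra.
have [Q0 hQ0] := (finite_seqP P).1 finP.
pose Q := undup Q0.
have hQ h : h \in Q <-> P h by rewrite mem_undup hQ0.
exists c => //; exists M, Q; split; first by move=> k; rewrite !ge_max => /and3P[/hM1[]].
split; rewrite ?undup_uniq//.
- move=> k hk; split=> //; [exact/sol_orthogeodesic/thl/M_rad|exact: M_T0].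
- move=> k k' hk hk' e.
  have s := thl (M_rad _ hk); have s' := thl (M_rad _ hk').
  have [st l0 e1] := s; have [st' l'0 e2] := s'.
  have tt := ray_direction_inj l0 st st' e.
  have ll : l k = l k' by exact: (congr1 (@len R d) e).
  apply: emb_inj; apply: (addrI (Y2 (th k))).
  by rewrite -e1 tt ll e2.
- by move=> h /hQ.
- move=> h oh Th; have [|nk] := pselect (exists2 k, M <= W k & h = ga k); first by right.
  by left; apply/hQ; split=> // k hk e; apply: nk; exists k.
Qed.

End Model.

Theorem lattice_model K1 o1 K2 o2 T0 : (0 < d)%N ->
  strictly_convex_compact K1 -> strictly_convex_compact K2 ->
  (forall T : R, T0 < T -> finite_set (truncated_orthogeodesics K1 o1 K2 o2 T0 T)) ->
  exists th : L -> 'rV[R]_d, exists l : L -> R,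
  [/\ Finf (sphere \o th),
      exists2 C', 0 <= C' & exists M, forall k j, M <= W k ->
        `|l (k + E j) - l k - dotv (emb (E j)) (th k)| <= C' / W k,
      forall n, sym E W everywhere n 1 [set: unit] (fun=> l) &
      exists2 c, 0 < c & exists ga M Q, (forall k, M <= W k -> c * W k <= l k) /\
        lattice_geodesics K1 o1 K2 o2 T0 l ga M Q].
Proof.
move=> d0 cK1 cK2 hfin.
have [Y1 nY1] := normal_map_exists o1 d0 cK1; have [Y2 nY2] := normal_map_exists o2 d0 cK2.
have [_ [B1 B10 hB1] [C1 C10 hC1] _] := nY1; have [_ [B2 B20 hB2] [C2 C20 hC2] _] := nY2.
have B0 : 0 <= B1 + B2 by rewrite addr_ge0.
have C0 : 0 <= C1 + C2 by rewrite addr_ge0.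
have Y1B th : sphere th -> `|Y1 th| <= B1 + B2 by move=> /hB1 h; rewrite (le_trans h)// lerDl.
have Y2B th : sphere th -> `|Y2 th| <= B1 + B2 by move=> /hB2 h; rewrite (le_trans h)// lerDr.
have Y1C th th' : sphere th -> sphere th' -> `|Y1 th' - Y1 th| <= (C1 + C2) * `|th' - th|.
  by move=> s s'; apply: le_trans (hC1 _ _ s s') _; rewrite ler_wpM2r// lerDl.
have Y2C th th' : sphere th -> sphere th' -> `|Y2 th' - Y2 th| <= (C1 + C2) * `|th' - th|.
  by move=> s s'; apply: le_trans (hC2 _ _ s s') _; rewrite ler_wpM2r// lerDr.
have hex k : exists p : 'rV[R]_d * R,
    @sol_radius R d (B1 + B2) (C1 + C2) <= `|emb k : 'rV[R]_d| -> sol Y1 Y2 k p.1 p.2.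
  have [hk|hk] := pselect (sol_radius (d := d) (B1 + B2) (C1 + C2) <= `|emb k : 'rV[R]_d|).
    by have [t [ln s]] := sol_exists d0 C0 Y1B Y2B Y1C Y2C hk; exists (t, ln).
  by exists (0, 0) => /hk.
have [p hp] := choice hex; exists (fun k => (p k).1), (fun k => (p k).2); split.
- exact: th_sphere hp.
- exact: (length_increment B0 C0 nY1 nY2 Y1B Y2B Y1C Y2C hp).
- move=> n; apply: sym_everywhere.
  exact: (sym_direction_length B0 nY1 nY2 Y1B Y2B hp n).2.
- have [c c0 [M [Q h]]] := lattice_geodesics_exist B0 C0 nY1 nY2 Y1B Y2B Y1C Y2C hp hfin.
  by exists c => //; eexists; exists M, Q; exact: h.
Qed.

End GeodesicModel.

(** * Truncation by length and the limit of sums *)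

Section SumLimit.
Context {R : realType} {d : nat}.
Notation L := 'rV[int]_d.
Notation W := (@lat_weight R d).
Variables (K1 K2 : set 'rV[R]_d) (o1 o2 : orientation) (T0 : R).
Variables (l : L -> R) (ga : L -> @curve R d) (M : R) (Q : seq (@curve R d)).
Hypothesis hQ : lattice_geodesics K1 o1 K2 o2 T0 l ga M Q.
Variable c : R.
Hypotheses (c0 : 0 < c) (hc : forall k, M <= W k -> c * W k <= l k).

Lemma Re_sum (I : Type) (r : seq I) (P : pred I) (F : I -> R[i]) :
  complex.Re (\sum_(i <- r | P i) F i) = \sum_(i <- r | P i) complex.Re (F i).
Proof.
elim: r => [|i r IH]; first by rewrite !big_nil.
by rewrite !big_cons; case: (P i) => //; rewrite -IH; case: (F i); case: (\sum_(_ <- _ | _) _).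
Qed.

Lemma Im_sum (I : Type) (r : seq I) (P : pred I) (F : I -> R[i]) :
  complex.Im (\sum_(i <- r | P i) F i) = \sum_(i <- r | P i) complex.Im (F i).
Proof.
elim: r => [|i r IH]; first by rewrite !big_nil.
by rewrite !big_cons; case: (P i) => //; rewrite -IH; case: (F i); case: (\sum_(_ <- _ | _) _).
Qed.

(** Truncations by length run through finite index sets that eventually contain any prescribed one,
    which is the convergence used by [tsum]. Finiteness comes from [l k >= c * W k]. *)
Lemma truncated_sum (s0 : seq L) : exists T1, forall T, T1 <= T ->
  exists s, [/\ uniq s, {subset s0 <= s} & forall phi : R -> R[i],
    truncated_length_distribution K1 o1 K2 o2 T0 T phi =
    \sum_(h <- Q) phi (len h) + \sum_(k <- s | M <= W k) phi (l k)].
Proof.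
have [h1 h2 uQ h3 h4] := hQ.
(* Exceeds every length in [Q] and every [l k] with [k] in [s0]. *)
exists (\sum_(h <- Q) `|len h| + \sum_(k <- s0) `|l k|) => T hT.
have lQ h : h \in Q -> len h <= T.
  move=> hQh; apply: le_trans hT; rewrite (big_rem h)//= -addrA.
  by apply: le_trans (ler_norm _) _; rewrite lerDl addr_ge0 ?sumr_ge0.
have ls k : k \in s0 -> l k <= T.
  move=> hk; apply: le_trans hT; rewrite [X in _ + X](big_rem k)//= addrCA.
  by apply: le_trans (ler_norm _) _; rewrite lerDl addr_ge0 ?sumr_ge0.
have [s1 hs1] := @weight_lt_finite R d (Num.max M (T / c + 1)).
have big k : l k <= T -> k \in s1.
  move=> lk; apply: hs1; rewrite lt_max; have [//|hk] := ltP (W k) M.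
  have := le_trans (hc hk) lk; rewrite mulrC -ler_pdivlMr//; lra.
pose s := undup [seq k <- s1 ++ s0 | (l k <= T) || (W k < M)].
have us : uniq s := undup_uniq _.
exists s; split=> //.
  by move=> k hk; rewrite mem_undup mem_filter mem_cat hk orbT ls.
move=> phi; pose t := [seq k <- s | M <= W k].
have ut : uniq t by exact: filter_uniq.
have ht k : k \in t -> M <= W k /\ l k <= T.
  rewrite mem_filter mem_undup mem_filter => /and3P[hk /orP[//|+] _].
  by rewrite ltNge hk.
have uQt : uniq (Q ++ map ga t).
  rewrite cat_uniq uQ map_inj_in_uniq ?ut ?andbT => [|k k' /ht[hk _] /ht[hk' _]]; last exact: h2.
  by apply/hasPn => h /mapP[k /ht[hk _] ->]; apply/negP => /h3[_ _ /(_ k hk)].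
have -> : \sum_(k <- s | M <= W k) phi (l k) = \sum_(h <- map ga t) phi (len h).
  rewrite -big_filter -/t [RHS]big_map; apply: eq_big_seq => k /ht[/h1[_ -> _] _].
  by [].
rewrite -big_cat.
rewrite /truncated_length_distribution [RHS]fsbig_seq//; apply: eq_fsbigl.
apply/seteqP; split=> h /=.
- move=> [oh /andP[Th hh]]; rewrite mem_cat; have [->//|[k hk hE]] := h4 _ oh Th.
  apply/orP; right; apply/mapP; exists k => //.
  have [_ lk _] := h1 _ hk; rewrite hE lk in hh.
  by rewrite mem_filter hk mem_undup mem_filter hh mem_cat big.
- rewrite mem_cat => /orP[hh|/mapP[k /ht[hk lk] ->]].
    by have [oh Th _] := h3 _ hh; split=> //=; rewrite Th lQ.
  by have [oh e Th] := h1 _ hk; split=> //=; rewrite e Th.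
Qed.

Definition lat_restrict (u : R -> R) (k : L) : R := if M <= W k then u (l k) else 0.

Lemma sum_restrict u s : \sum_(k <- s | M <= W k) u (l k) = ssum (lat_restrict u) s.
Proof. by rewrite big_mkcond. Qed.

Lemma truncated_Re_cvg g S (phi : R -> R[i]) : summable_bound g S ->
  (forall k, M <= W k -> `|complex.Re (phi (l k))| <= g k) ->
  complex.Re (truncated_length_distribution K1 o1 K2 o2 T0 T phi) @[T --> +oo%R] -->
    \sum_(h <- Q) reF phi (len h) + tsum (lat_restrict (reF phi)).
Proof.
move=> hg hphi; apply/cvgrPdist_le => eps eps0.
have [s0 us0 hs0] := tsum_net hg eps0.
have [T1 hT1] := truncated_sum s0.
exists T1; split; first exact: num_real.
move=> T /ltW /hT1[s [us sub ->]].
have -> (a b : R[i]) : complex.Re (a + b) = complex.Re a + complex.Re b by case: a; case: b.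
rewrite !Re_sum (sum_restrict (reF phi)) opprD addrACA subrr add0r distrC.
apply: hs0 => // k; rewrite /lat_restrict; case: ifP => [/hphi//|_].
by rewrite normr0; exact: hg.1.
Qed.

Lemma truncated_Im_cvg g S (phi : R -> R[i]) : summable_bound g S ->
  (forall k, M <= W k -> `|complex.Im (phi (l k))| <= g k) ->
  complex.Im (truncated_length_distribution K1 o1 K2 o2 T0 T phi) @[T --> +oo%R] -->
    \sum_(h <- Q) imF phi (len h) + tsum (lat_restrict (imF phi)).
Proof.
move=> hg hphi; apply/cvgrPdist_le => eps eps0.
have [s0 us0 hs0] := tsum_net hg eps0.
have [T1 hT1] := truncated_sum s0.
exists T1; split; first exact: num_real.
move=> T /ltW /hT1[s [us sub ->]].
have -> (a b : R[i]) : complex.Im (a + b) = complex.Im a + complex.Im b by case: a; case: b.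
rewrite !Im_sum (sum_restrict (imF phi)) opprD addrACA subrr add0r distrC.
apply: hs0 => // k; rewrite /lat_restrict; case: ifP => [/hphi//|_].
by rewrite normr0; exact: hg.1.
Qed.

Lemma length_distributionE g S (phi : R -> R[i]) : summable_bound g S ->
  (forall k, M <= W k -> `|complex.Re (phi (l k))| <= g k) ->
  (forall k, M <= W k -> `|complex.Im (phi (l k))| <= g k) ->
  length_distribution K1 o1 K2 o2 T0 phi =
    ((\sum_(h <- Q) reF phi (len h) + tsum (lat_restrict (reF phi))) +i*
    (\sum_(h <- Q) imF phi (len h) + tsum (lat_restrict (imF phi))))%C.
Proof.
move=> hg h1 h2; rewrite /length_distribution; congr (_ +i* _)%C.
  by apply/cvg_lim => //; exact: truncated_Re_cvg hg h1.
by apply/cvg_lim => //; exact: truncated_Im_cvg hg h2.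
Qed.

End SumLimit.

Section ComplexModulus.
Context {R : realType}.
Implicit Types (z : R[i]) (phi psi : R -> R[i]).

Lemma cmodE z : cmod z = Num.sqrt (complex.Re z ^+ 2 + complex.Im z ^+ 2).
Proof. by case: z. Qed.

Lemma Re_le_cmod z : `|complex.Re z| <= cmod z.
Proof. by rewrite cmodE -sqrtr_sqr ler_wsqrtr// lerDl sqr_ge0. Qed.

Lemma Im_le_cmod z : `|complex.Im z| <= cmod z.
Proof. by rewrite cmodE -sqrtr_sqr ler_wsqrtr// lerDr sqr_ge0. Qed.

Lemma cmod_le z : cmod z <= `|complex.Re z| + `|complex.Im z|.
Proof.
rewrite cmodE -[leRHS]ger0_norm ?addr_ge0// -sqrtr_sqr ler_wsqrtr// sqrrD !real_normK ?num_real//.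
by rewrite lerD2r lerDl mulrn_wge0// mulr_ge0.
Qed.

Lemma cmod_ge0 z : 0 <= cmod z.
Proof. by rewrite cmodE sqrtr_ge0. Qed.

Lemma seminorm_ub phi j k x : schwartz phi ->
  `|x| ^+ j * cmod (cderiv k phi x) <= schwartz_seminorm j k phi.
Proof.
move=> [_ /(_ j k)[M hM]]; apply: ub_le_sup; last by exists x.
by exists M => _ [y _ <-]; exact: hM.
Qed.

Lemma seminorm_ge0 phi j k : schwartz phi -> 0 <= schwartz_seminorm j k phi.
Proof.
move=> hp; apply: le_trans (seminorm_ub j k 0 hp).
by rewrite mulr_ge0 ?exprn_ge0 ?cmod_ge0.
Qed.

Lemma cmod_seminorm phi j x : schwartz phi -> `|x| ^+ j * cmod (phi x) <= schwartz_seminorm j 0 phi.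
Proof.
by move=> hp; have := seminorm_ub j 0 x hp; rewrite /cderiv /= /reF /imF; case: (phi x).
Qed.

Lemma seminorm_le_sum phi (N j k : nat) : schwartz phi -> (j < N)%N -> (k < N)%N ->
  schwartz_seminorm j k phi <= \sum_(j < N) \sum_(k < N) schwartz_seminorm j k phi.
Proof.
move=> hp hj hk; rewrite (bigD1 (Ordinal hj))//= (bigD1 (Ordinal hk))//= -addrA lerDl.
by rewrite addr_ge0// ?sumr_ge0// => i _; rewrite ?sumr_ge0// => *; exact: seminorm_ge0.
Qed.

End ComplexModulus.

(** * Temperedness of the length distribution *)

Section LengthFunctional.
Context {R : realType} {d : nat}.
Notation L := 'rV[int]_d.
Notation W := (@lat_weight R d).
Variables (K1 K2 : set 'rV[R]_d) (o1 o2 : orientation) (T0 : R).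
Variables (l : L -> R) (ga : L -> @curve R d) (M : R) (Q : seq (@curve R d)).
Hypothesis hQ : lattice_geodesics K1 o1 K2 o2 T0 l ga M Q.
Variable c : R.
Hypotheses (c0 : 0 < c) (hc : forall k, M <= W k -> c * W k <= l k).
Implicit Types (u v : R -> R) (phi psi : R -> R[i]).

Definition length_sum u : R := \sum_(h <- Q) u (len h) + tsum (lat_restrict l M u).

Definition length_decay C u := forall k, M <= W k -> `|u (l k)| <= C * W k ^- (2 * d).

Let W0 k : 0 <= W k ^- (2 * d).
Proof. by rewrite invr_ge0 exprn_ge0// (le_trans ler01)// lat_weight_ge1. Qed.

Lemma length_sum_lin (a : R) u v C D : 0 <= C -> 0 <= D ->
  length_decay C u -> length_decay D v ->
  length_decay (`|a| * C + D) (fun t => a * u t + v t) /\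
  length_sum (fun t => a * u t + v t) = a * length_sum u + length_sum v.
Proof.
move=> C0 D0 hu hv; split=> [k hk|].
  apply: le_trans (ler_normD _ _) _; rewrite mulrDl normrM lerD ?hv//.
  by rewrite -mulrA ler_wpM2l// hu.
have [S hS] := @lattice_summable R d.
pose g k := (`|a| * C + C + D) * W k ^- (2 * d).
have aC : 0 <= `|a| * C by rewrite mulr_ge0.
have hg : summable_bound g ((`|a| * C + C + D) * S).
  by apply: summable_boundZ hS; rewrite !addr_ge0.
have b1 k : `|lat_restrict l M u k| <= g k.
  rewrite /lat_restrict /g; case: ifP => [/hu h|_]; last by rewrite normr0 mulr_ge0// !addr_ge0.
  by apply: le_trans h _; rewrite ler_wpM2r//; lra.
have b2 k : `|a * lat_restrict l M u k| <= g k.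
  rewrite normrM /lat_restrict /g; case: ifP => [/hu h|_]; last by rewrite normr0 mulr0 mulr_ge0// !addr_ge0.
  apply: le_trans (ler_wpM2l (normr_ge0 a) h) _; rewrite mulrA ler_wpM2r//; lra.
have b3 k : `|lat_restrict l M v k| <= g k.
  rewrite /lat_restrict /g; case: ifP => [/hv h|_]; last by rewrite normr0 mulr_ge0// !addr_ge0.
  by apply: le_trans h _; rewrite ler_wpM2r//; lra.
rewrite /length_sum mulrDr -(tsumZ _ hg b1) addrACA -(tsumD hg b2 b3) mulr_sumr -big_split.
congr (_ + tsum _); apply/funext => k; rewrite /lat_restrict.
by case: ifP => // _; rewrite mulr0 addr0.
Qed.

Lemma length_sum_bound C S u : 0 <= C -> length_decay C u -> (forall t, `|u t| <= C) ->
  summable_bound (fun k => W k ^- (2 * d)) S ->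
  `|length_sum u| <= ((size Q)%:R + S) * C.
Proof.
move=> C0 hu uC hS; apply: le_trans (ler_normD _ _) _; rewrite mulrDl lerD//.
  apply: le_trans (ler_norm_sum _ _ _) _.
  apply: (@le_trans _ _ (\sum_(h <- Q) C)); first by apply: ler_sum.
  by rewrite big_const_seq count_predT iter_addr_0 mulr_natl.
rewrite [S * C]mulrC; apply: (tsum_bound hS C0) => k; rewrite /lat_restrict.
by case: ifP => [/hu//|_]; rewrite normr0 mulr_ge0.
Qed.

Lemma length_distribution_sum C phi : 0 <= C ->
  length_decay C (reF phi) -> length_decay C (imF phi) ->
  length_distribution K1 o1 K2 o2 T0 phi =
    (length_sum (reF phi) +i* length_sum (imF phi))%C.
Proof.
move=> C0 h1 h2; have [S hS] := @lattice_summable R d.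
exact: (length_distributionE hQ c0 hc (summable_boundZ C0 hS) h1 h2).
Qed.

Let c' := c ^- (2 * d).
Let c'0 : 0 <= c'. Proof. by rewrite invr_ge0 exprn_ge0// ltW. Qed.

(** The seminorm bounds [|l k|^(2 d)] times the value at [l k], and [l k >= c * W k] turns this into
    the summable weight; [c'] is [c] to the power [- 2 d]. *)
Lemma schwartz_decay phi : schwartz phi ->
  length_decay (c' * schwartz_seminorm (2 * d) 0 phi) (reF phi) /\
  length_decay (c' * schwartz_seminorm (2 * d) 0 phi) (imF phi).
Proof.
move=> hp; suff H k : M <= W k ->
    cmod (phi (l k)) <= c' * schwartz_seminorm (2 * d) 0 phi * W k ^- (2 * d).
  split=> k /H; apply: le_trans; [exact: Re_le_cmod|exact: Im_le_cmod].
move=> /hc hk; have Wk : 0 < W k by exact: lt_le_trans ltr01 (lat_weight_ge1 k).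
have cW : 0 < c * W k by exact: mulr_gt0.
have p : 0 < (c * W k) ^+ (2 * d) by exact: exprn_gt0.
have h : (c * W k) ^+ (2 * d) * cmod (phi (l k)) <= schwartz_seminorm (2 * d) 0 phi.
  apply: le_trans (cmod_seminorm (2 * d) (l k) hp); rewrite ler_wpM2r ?cmod_ge0//.
  rewrite lerXn2r ?nnegrE ?normr_ge0 ?(ltW cW)//.
  exact: le_trans hk (ler_norm _).
rewrite /c' mulrAC -invfM -exprMn mulrC ler_pdivlMr//.
by rewrite mulrC.
Qed.

Lemma length_tempered :
  tempered_cvg (truncated_length_distribution K1 o1 K2 o2 T0)
    (length_distribution K1 o1 K2 o2 T0).
Proof.
have [S hS] := @lattice_summable R d.
have S0 : 0 <= S by have := hS.2 [::] isT; rewrite /ssum big_nil.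
pose s phi := c' * schwartz_seminorm (2 * d) 0 phi.
have s0 phi : schwartz phi -> 0 <= s phi by move=> hp; rewrite mulr_ge0// seminorm_ge0.
have E phi : schwartz phi -> length_distribution K1 o1 K2 o2 T0 phi =
    (length_sum (reF phi) +i* length_sum (imF phi))%C.
  move=> hp; have [h1 h2] := schwartz_decay hp.
  exact: length_distribution_sum (s0 _ hp) h1 h2.
split; first split.
- move=> [a1 a2] phi psi hp hq.
  have [p1 p2] := schwartz_decay hp; have [q1 q2] := schwartz_decay hq.
  have sp := s0 _ hp; have sq := s0 _ hq.
  have n0 (b : R) C D : 0 <= C -> 0 <= D -> 0 <= `|b| * C + D.
    by move=> C0 D0; rewrite addr_ge0// mulr_ge0.
  (* Real and imaginary parts of [(a1 + i a2) phi + psi] are each built by two uses of the real rule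
     [a * u + v]. *)
  have [i1 e1] := length_sum_lin (- a2) sp sq p2 q1.
  have [i2 e2] := length_sum_lin a1 sp (n0 _ _ _ sp sq) p1 i1.
  have [i3 e3] := length_sum_lin a2 sp sq p1 q2.
  have [i4 e4] := length_sum_lin a1 sp (n0 _ _ _ sp sq) p2 i3.
  have re : reF (fun x => (a1 +i* a2)%C * phi x + psi x) =
      fun t => a1 * reF phi t + (- a2 * imF phi t + reF psi t).
    apply/funext => t; rewrite /reF /imF.
    by case: (phi t) (psi t) => [z w] [p q] /=; ring.
  have im : imF (fun x => (a1 +i* a2)%C * phi x + psi x) =
      fun t => a1 * imF phi t + (a2 * reF phi t + imF psi t).
    apply/funext => t; rewrite /reF /imF.
    by case: (phi t) (psi t) => [z w] [p q] /=; ring.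
  have C0 : 0 <= `|a1| * s phi + (`|a2| * s phi + s psi) by rewrite !n0.
  rewrite (E _ hp) (E _ hq) (@length_distribution_sum _ _ C0); first last.
  + by rewrite im.
  + by rewrite re -[`|a2|]normrN.
  rewrite re im e2 e1 e4 e3.
  apply/eqP; rewrite eq_complex /=.
  by apply/andP; split; apply/eqP; ring.
(* Seminorms of index 0 control [Q] and those of index [2 d] the lattice sum, hence the range below
   [2 d + 1]; the factor 2 adds real and imaginary parts. *)
- exists (2 * (((size Q)%:R + S) * (1 + c'))), (2 * d).+1 => phi hp.
  set Sg := \sum_(j < _) _.
  have g0 : schwartz_seminorm 0 0 phi <= Sg by exact: seminorm_le_sum.
  have g1 : schwartz_seminorm (2 * d) 0 phi <= Sg by exact: seminorm_le_sum.
  have Sg0 : 0 <= Sg by apply: le_trans g0; exact: seminorm_ge0.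
  have C0 : 0 <= (1 + c') * Sg by rewrite mulr_ge0// addr_ge0.
  have sC : s phi <= (1 + c') * Sg.
    by rewrite mulrDl mul1r; have := ler_wpM2l c'0 g1; rewrite -/(s phi); lra.
  have pC t : cmod (phi t) <= (1 + c') * Sg.
    have := cmod_seminorm 0 t hp; rewrite expr0 mul1r => h.
    by rewrite mulrDl mul1r; have := mulr_ge0 c'0 Sg0; lra.
  have [h1 h2] := schwartz_decay hp.
  have dec u : length_decay (s phi) u -> length_decay ((1 + c') * Sg) u.
    by move=> h k hk; apply: le_trans (h k hk) _; rewrite ler_wpM2r.
  have r1 := length_sum_bound C0 (dec _ h1) (fun t => le_trans (Re_le_cmod _) (pC t)) hS.
  have r2 := length_sum_bound C0 (dec _ h2) (fun t => le_trans (Im_le_cmod _) (pC t)) hS.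
  rewrite E//; apply: le_trans (cmod_le _) _; rewrite /=.
  by rewrite -!mulrA mulr_natl mulr2n lerD.
- move=> phi hp; have [h1 h2] := schwartz_decay hp; rewrite E//=.
  have hg := summable_boundZ (s0 _ hp) hS.
  split; first exact: (truncated_Re_cvg hQ c0 hc hg h1).
  exact: (truncated_Im_cvg hQ c0 hc hg h2).
Qed.

End LengthFunctional.

Section SmoothFunctions.
Context {R : realType}.
Variable V : set R.
Hypothesis oV : open V.

Definition smooth_real (f : R -> R) := forall n t, V t -> derivable (derive1n n f) t 1.

Lemma smooth_realD f g : smooth_real f -> smooth_real g -> smooth_real (fun t => f t + g t).
Proof.
move=> hf hg; have e n t : V t ->
    derive1n n (fun t => f t + g t) t = derive1n n f t + derive1n n g t.
  elim: n t => [//|n IH] t Vt; rewrite !derive1nS !derive1E.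
  rewrite (@near_eq_derive _ _ _ _ (fun t => derive1n n f t + derive1n n g t)) ?oner_neq0//.
    by rewrite deriveD; [|exact: hf|exact: hg].
  exact: (near_V oV Vt).
move=> n t Vt; apply: (derivable_ext oV (f := fun t => derive1n n f t + derive1n n g t)) => //.
  by move=> u /e.
by apply: derivableD; [exact: hf|exact: hg].
Qed.

Definition trig (p q w : R) (t : R) : R := p * cos (t * w) + q * sin (t * w).

Lemma trig_is_derive p q w (t : R) : is_derive t 1 (trig p q w) (trig (q * w) (- (p * w)) w t).
Proof.
have dm : is_derive t 1 (fun t : R => t * w) w.
  by apply: is_derive_eq; rewrite scaler0 add0r [_%:A]mulr1.
have dc := @is_derive1_comp _ cos _ _ _ _ (is_derive_cos _) dm.
have ds := @is_derive1_comp _ sin _ _ _ _ (is_derive_sin _) dm.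
by rewrite /trig; apply: is_derive_eq; rewrite /trig /GRing.scale /=; ring.
Qed.

Lemma trig_smooth p q w : smooth_real (trig p q w).
Proof.
move=> n t _; have [p' [q' ->]] : exists p' q', derive1n n (trig p q w) = trig p' q' w.
  elim: n => [|n [p' [q' IH]]]; first by exists p, q.
  exists (q' * w), (- (p' * w)); rewrite derive1nS IH; apply/funext => u.
  by rewrite derive1E; have [_ ->] := trig_is_derive p' q' w u.
by have [] := trig_is_derive p' q' w t.
Qed.

Lemma trig_sum_smooth (I : Type) (r : seq I) p q (w : I -> R) :
  smooth_real (fun t => \sum_(i <- r) trig p q (w i) t).
Proof.
elim: r => [|i r IH].
  rewrite (_ : (fun _ => _) = trig 0 0 0); first exact: trig_smooth.
  by apply/funext => t; rewrite big_nil /trig !mul0r addr0.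
under eq_fun do rewrite big_cons.
by apply: smooth_realD; [exact: trig_smooth|exact: IH].
Qed.

Lemma derive1n_eq0 n (f : R -> R) t : (forall u, V u -> f u = 0) -> V t -> derive1n n f t = 0.
Proof.
move=> f0 Vt; rewrite (derive1n_ext n oV (g := trig 0 0 0)) => [|u /f0 ->|//]; last first.
  by rewrite /trig !mul0r addr0.
suff -> : derive1n n (trig 0 0 0) = trig 0 0 0 by rewrite /trig !mul0r addr0.
elim: n => [//|n IH]; rewrite derive1nS IH; apply/funext => u.
by rewrite derive1E; have [_ ->] := trig_is_derive 0 0 0 u; rewrite mulr0 oppr0.
Qed.

End SmoothFunctions.

(** * Fourier transforms of test functions *)

Section Fourier.
Context {R : realType}.
Implicit Types (phi : R -> R[i]).

(** The distance to [t0] attains its maximum on the compact support, below [dl]; a radius strictly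
    between leaves room for a closed segment inside the open interval. *)
Lemma schwartz_test_fun phi t0 dl : 0 < dl -> schwartz phi -> compact (Defs.support phi) ->
  Defs.support phi `<=` Vint t0 dl -> exists al be, [/\ al < be,
    forall t, al <= t <= be -> Vint t0 dl t,
    test_fun al be (reF phi) & test_fun al be (imF phi)].
Proof.
move=> dl0 [sm _] cS SV.
have [r r0 [rdl hr]] : exists2 r, 0 < r & r < dl /\ forall t, Defs.support phi t -> `|t - t0| < r.
  have [|/set0P S0] := eqVneq (Defs.support phi) set0.
    move=> ->; exists (dl / 2); rewrite ?divr_gt0//; split=> //; lra.
  have cf : {within Defs.support phi, continuous (fun t : R => `|t - t0|)}.
    apply: continuous_subspaceT => t.
    apply: cvg_norm; apply: cvgB; [exact: cvg_id|exact: cvg_cst].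
  have [m /set_mem/SV mS hm] := compact_EVT_max S0 cS cf.
  rewrite /Vint /= in mS; have := normr_ge0 (m - t0) => m0.
  exists ((`|m - t0| + dl) / 2); first lra.
  split=> [|t ht]; first lra.
  by have := hm t (mem_set ht); lra.
have oC : open (~` Defs.support phi) by apply: closed_openC; exact: closed_closure.
have z t : (~` Defs.support phi) t -> phi t = 0.
  by move=> ht; apply/eqP/negPn/negP => h; apply: ht; exact: subset_closure.
have out t : ~ (t0 - r < t < t0 + r) -> (~` Defs.support phi) t.
  move=> ht /hr; rewrite ltr_norml => /andP[h1 h2]; apply: ht.
  by apply/andP; split; lra.
exists (t0 - r), (t0 + r); split; first lra.
- by move=> t /andP[h1 h2]; rewrite /Vint /= ltr_norml; apply/andP; split; lra.
- move=> n; split=> [t|t /out ht]; first by have [] := sm n t I.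
  by apply: (derive1n_eq0 oC) => // u /z; rewrite /reF => ->.
- move=> n; split=> [t|t /out ht]; first by have [] := sm n t I.
  by apply: (derive1n_eq0 oC) => // u /z; rewrite /imF => ->.
Qed.

Lemma Rintegral_support al be (f : R -> R) : (forall t, ~ (al < t < be) -> f t = 0) ->
  \int[lebesgue_measure]_x f x = seg_int al be f.
Proof.
move=> f0; rewrite /seg_int /Rintegral [in RHS]integral_mkcond; congr fine.
apply: eq_integral => t _; rewrite /patch; case: ifPn => // ht.
rewrite f0// => /andP[h1 h2]; move/negP: ht; apply; apply/mem_set => /=.
by rewrite in_itv/= !ltW.
Qed.

Section Segment.
Variables al be : R.

Definition trig_int (p q : R) (u : R -> R) (w : R) : R :=
  seg_int al be (fun t => trig p q w t * u t).

Lemma trig_continuous p q w u : test_fun al be u ->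
  seg_continuous al be (fun t => trig p q w t * u t).
Proof.
move=> hu; apply: seg_continuousM; last exact: test_fun_continuous.
by apply: seg_continuous_derivable => t _; have [] := trig_is_derive p q w t.
Qed.

(** Both parts are written as [a * u + v], the form on which [length_sum_lin] acts. *)
Lemma fourier_trig phi : test_fun al be (reF phi) -> test_fun al be (imF phi) ->
  (reF (fourier phi) = fun w => -1 * trig_int 0 (-1) (imF phi) w + trig_int 1 0 (reF phi) w) /\
  (imF (fourier phi) = fun w => 1 * trig_int 0 (-1) (reF phi) w + trig_int 1 0 (imF phi) w).
Proof.
move=> h1 h2; have c0 p q w := @trig_continuous p q w _ h1; have c1 p q w := @trig_continuous p q w _ h2.
split; apply/funext => w; rewrite /trig_int ?mulN1r ?mul1r.
- rewrite addrC -seg_intB// /reF /= (@Rintegral_support al be).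
    apply: seg_int_ext => t _; rewrite /reF /imF /trig /=.
    by case: (phi t) => x y /=; ring.
  move=> t ht; have := test_fun_out h1 ht; have := test_fun_out h2 ht; rewrite /reF /imF.
  by case: (phi t) => x y /= -> ->; rewrite !mulr0 subr0.
- rewrite addrC -seg_intD// /imF /= (@Rintegral_support al be).
    apply: seg_int_ext => t _; rewrite /reF /imF /trig /=.
    by case: (phi t) => x y /=; ring.
  move=> t ht; have := test_fun_out h1 ht; have := test_fun_out h2 ht; rewrite /reF /imF.
  by case: (phi t) => x y /= -> ->; rewrite !mulr0 addr0.
Qed.

Lemma cintegral_mul (f1 f2 : R -> R) phi : test_fun al be (reF phi) -> test_fun al be (imF phi) ->
  seg_continuous al be f1 -> seg_continuous al be f2 ->
  cintegral (fun x => (f1 x +i* f2 x)%C * phi x) =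
  ((-1 * seg_int al be (fun t => f2 t * imF phi t) + seg_int al be (fun t => f1 t * reF phi t)) +i*
   (1 * seg_int al be (fun t => f2 t * reF phi t) + seg_int al be (fun t => f1 t * imF phi t)))%C.
Proof.
move=> h1 h2 s1 s2; have t1 := test_fun_continuous h1; have t2 := test_fun_continuous h2.
have m11 := seg_continuousM s1 t1; have m12 := seg_continuousM s1 t2.
have m21 := seg_continuousM s2 t1; have m22 := seg_continuousM s2 t2.
rewrite /cintegral mulN1r mul1r; congr (_ +i* _)%C.
- rewrite addrC -seg_intB// (@Rintegral_support al be).
    apply: seg_int_ext => t _; rewrite /reF /imF /=.
    by case: (phi t) => x y /=; ring.
  move=> t ht; have := test_fun_out h1 ht; have := test_fun_out h2 ht; rewrite /reF /imF.
  by case: (phi t) => x y /= -> ->; rewrite !mulr0 subr0.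
- rewrite addrC -seg_intD// (@Rintegral_support al be).
    apply: seg_int_ext => t _; rewrite /reF /imF /=.
    by case: (phi t) => x y /=; ring.
  move=> t ht; have := test_fun_out h1 ht; have := test_fun_out h2 ht; rewrite /reF /imF.
  by case: (phi t) => x y /= -> ->; rewrite !mulr0 addr0.
Qed.

End Segment.

End Fourier.

(** * Smoothness of the Fourier transform off the spectrum *)

Section SingularSupport.
Context {R : realType} {d : nat}.
Notation L := 'rV[int]_d.
Notation W := (@lat_weight R d).
Notation E := (@lat_dir d).
Variables (K1 K2 : set 'rV[R]_d) (o1 o2 : orientation) (T0 : R).
Variables (l : L -> R) (ga : L -> @curve R d) (M : R) (Q : seq (@curve R d)).
Hypothesis hQ : lattice_geodesics K1 o1 K2 o2 T0 l ga M Q.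
Variable c : R.
Hypotheses (c0 : 0 < c) (hc : forall k, M <= W k -> c * W k <= l k).
Hypothesis hl : forall n, sym E W everywhere n 1 [set: unit] (fun=> l).
Variables (t0 dl M0 e0 : R).
Notation V := (Vint t0 dl).
Hypotheses (dl0 : 0 < dl) (e0_gt0 : 0 < e0).
Hypothesis nonresonant : forall t k, V t -> M0 <= W k ->
  e0 <= \sum_i 2 * (1 - cos (t * incr l i k)).

Let oV : open V := @Vint_open R t0 dl.

Lemma trig_length_sum (p q : R) : exists2 f : R -> R, smooth_real V f &
  forall al be u, al < be -> (forall t, al <= t <= be -> V t) -> test_fun al be u ->
    (exists2 C, 0 <= C & length_decay l M C (trig_int al be p q u)) /\
    length_sum l M Q (trig_int al be p q u) = seg_int al be (fun t => f t * u t).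
Proof.
(* The amplitude is eventually constant in [k], hence of order 0; the cutoff restricts the sum to
   the indices for which [ga k] is an orthogeodesic. *)
pose a : (R -> L -> R) * (R -> L -> R) :=
  (fun _ k => p * cutoff M k, fun _ k => q * cutoff M k).
have ha : tsym2 t0 dl 0 a.
  have h r : tsym V 0 (fun _ (k : L) => r * cutoff M k : R).
    by have := tsym_mul oV (@cst_tsym R d t0 dl r) (@cutoff_tsym R d t0 dl M); rewrite addr0.
  by split; exact: h.
have [f0 [sf0 hf0]] := oscillatory_sum e0_gt0 hl nonresonant c0 hc ha.
(* The exceptional orthogeodesics only add a finite trigonometric sum, which is smooth
   everywhere. *)
exists (fun t => f0 t + \sum_(h <- Q) trig p q (len h) t).
  by apply: (smooth_realD oV); [exact: sf0|exact: trig_sum_smooth].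
move=> al be u ab abV hu; have [[C C0 hC] e] := hf0 al be u ab abV hu.
have lr : lat_restrict l M (trig_int al be p q u) = osc_int l al be a u.
  apply/funext => k; rewrite /lat_restrict /trig_int /osc_int; case: ifP => hk.
    by apply: seg_int_ext => t _; rewrite /pair /a /cutoff /= hk !mulr1.
  rewrite (@seg_int_ext _ _ _ _ (fun t => 0 * 0)) => [|t _]; last first.
    by rewrite /pair /a /cutoff /= hk !mulr0 !mul0r addr0 mul0r.
  by rewrite seg_intZ ?mul0r//; exact: seg_continuous_cst.
split; first exists C => // k hk.
  have := hC k; rewrite -lr /lat_restrict hk; exact.
rewrite /length_sum lr e.
have cu := test_fun_continuous hu.
have cs h : seg_continuous al be (fun t => trig p q (len h) t * u t) := @trig_continuous _ _ _ p q (len h) _ hu.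
have cf0 : seg_continuous al be f0.
  by apply: seg_continuous_derivable => t /abV Vt; exact: (sf0 0%N).
have csum : seg_continuous al be (fun t => \sum_(h <- Q) trig p q (len h) t * u t).
  by apply: seg_continuous_sum => h; exact: cs.
rewrite /trig_int -seg_int_sum => [|h]; last exact: cs.
rewrite addrC -seg_intD//; last exact: seg_continuousM.
by apply: seg_int_ext => t _; rewrite mulrDl mulr_suml.
Qed.

(** The real densities for the phases [cos (t l)] and [- sin (t l)] combine to [f1 + i f2], the
    density for [exp(- i t l)]. *)
Lemma length_fourier_smooth :
  smooth_distribution_on V (fourier_distribution (length_distribution K1 o1 K2 o2 T0)).
Proof.
have [f1 sf1 hf1] := trig_length_sum 1 0; have [f2 sf2 hf2] := trig_length_sum 0 (-1).
exists (fun t => (f1 t +i* f2 t)%C).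
  by move=> n t Vt; split; [exact: sf1|exact: sf2].
move=> phi hp cS SV.
have [al [be [ab abV h1 h2]]] := schwartz_test_fun dl0 hp cS SV.
have cf f : smooth_real V f -> seg_continuous al be f.
  by move=> sf; apply: seg_continuous_derivable => t /abV Vt; exact: (sf 0%N).
have [Fr Fi] := fourier_trig h1 h2.
have [[C1 C10 k1] e1] := hf1 _ _ _ ab abV h1; have [[C2 C20 k2] e2] := hf1 _ _ _ ab abV h2.
have [[C3 C30 k3] e3] := hf2 _ _ _ ab abV h1; have [[C4 C40 k4] e4] := hf2 _ _ _ ab abV h2.
have [r1 g1] := length_sum_lin Q (-1) C40 C10 k4 k1.
have [r2 g2] := length_sum_lin Q 1 C30 C20 k3 k2.
pose C := `|-1| * C4 + C1 + (`|1| * C3 + C2).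
have C_ge0 : 0 <= C by rewrite !addr_ge0// mulr_ge0.
have W0 k : 0 <= W k ^- (2 * d).
  by rewrite invr_ge0 exprn_ge0// (le_trans ler01)// lat_weight_ge1.
rewrite /fourier_distribution (length_distribution_sum hQ c0 hc C_ge0).
- by rewrite Fr Fi g1 g2 e1 e2 e3 e4 (cintegral_mul h1 h2 (cf _ sf1) (cf _ sf2)).
- rewrite Fr => k hk; apply: le_trans (r1 k hk) _; rewrite ler_wpM2r// lerDl.
  by rewrite addr_ge0// mulr_ge0.
- rewrite Fi => k hk; apply: le_trans (r2 k hk) _; rewrite ler_wpM2r// lerDr.
  by rewrite addr_ge0// mulr_ge0.
Qed.

End SingularSupport.

Theorem theorem2p4 (R : realType) (d : nat) (hd : (2 <= d)%N)
    (K1 K2 : set 'rV[R]_d)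
    (hK1 : strictly_convex_compact K1) (hK2 : strictly_convex_compact K2)
    (o1 o2 : orientation)
    (T0 : R) (hT0 : 0 < T0)
    (hfin : forall T : R, T0 < T ->
       finite_set (truncated_orthogeodesics K1 o1 K2 o2 T0 T)) :
  tempered_cvg (truncated_length_distribution K1 o1 K2 o2 T0)
               (length_distribution K1 o1 K2 o2 T0) /\
  singular_support
    (fourier_distribution (length_distribution K1 o1 K2 o2 T0))
    `<=` spectrum_opp_sqrt R d `|` spectrum_sqrt R d.
Proof.
have d0 : (0 < d)%N by exact: ltnW.
have [th [l [hth hinc hl [c c0 [ga [M [Q [hc hQ]]]]]]]] := lattice_model d0 hK1 hK2 hfin.
split; first exact: (length_tempered hQ c0 hc).
move=> t ht; apply: contrapT => /notin_spectrum nr; apply: ht.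
have [dl [M0 [e0 [dl0 e00 nonres]]]] := length_nonresonant nr hth hinc.
exists (Vint t dl); last by rewrite /Vint /= subrr normr0.
split; first exact: Vint_open.
exact: (length_fourier_smooth hQ c0 hc hl dl0 e00 nonres).
Qed.
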